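(* Let $d\ge2$. As $\lambda\downarrow0$, the distribution of the random closed set $\mathcal{S}_\lambda$ converges weakly to the distribution of the random closed set $\mathcal{S}$. The convergence holds in the following stronger sense: given a sequence $(\lambda_n)_{n\in\mathbb{N}}$ of positive numbers with $\lambda_n\to0$, one may define $((\mathcal{S}_{\lambda_n})_{n\in\mathbb{N}},\mathcal{S})$ on the same probability space (each with its prescribed distribution) such that, for every $R>0$, $$\lim_{n\to\infty}\mathbb{P}\big(\mathcal{S}_{\lambda_n}\cap\mathbb{B}_R^{d-1}\ne\mathcal{S}\cap\mathbb{B}_R^{d-1}\big)=0 .$$
   Context: $\mathbb{B}_R^{d-1}$ is the Euclidean ball in $\mathbb{R}^{d-1}$ of radius $R$ centred at the origin. $\mathbb{H}^d$ is hyperbolic space in the upper halfspace model $\mathbb{R}^{d-1}\times(0,\infty)$ with volume measure $d\mathrm{vol}_{\mathbb{H}^d}(v,y)=y^{-d}\,dv\,dy$. For $\gamma,\lambda>0$ let $\eta_{\gamma,\lambda}$ be a Poisson point process on $\mathbb{H}^d$ with intensity measure $\gamma\,\mathrm{vol}_{\mathbb{H}^d}$ restricted to the horoball $\{(v,y):y\ge\lambda\}$. $\mathcal{D}_{\gamma,\lambda}$ is the (almost surely locally finite, simplicial) random tessellation of $\mathbb{R}^{d-1}$ consisting of all simplices $[v_1,\dots,v_d]$ (Euclidean convex hulls) such that $(v_1,y_1),\dots,(v_d,y_d)$ are pairwise distinct points of $\eta_{\gamma,\lambda}$, $v_1,\dots,v_d$ are affinely independent, and the unique half-ball $\{(v,y)\in\mathbb{R}^{d-1}\times(0,\infty):\|v-w\|^2+y^2\le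 r^2\}$ whose bounding hemisphere contains these $d$ points has no point of $\eta_{\gamma,\lambda}$ in its interior. For $c>0$, $\mathcal{D}_c$ (single index) denotes the classical Poisson--Delaunay tessellation of $\mathbb{R}^{d-1}$ of intensity $c$: the collection of simplices $[x_1,\dots,x_d]$ with $x_1,\dots,x_d$ distinct points of a homogeneous Poisson point process on $\mathbb{R}^{d-1}$ of intensity $c$ whose open circumscribed ball contains no points of the process. The skeletons are $\mathcal{S}_\lambda:=\bigcup_{C\in\mathcal{D}_{\lambda^{d-1},\lambda}}\partial C$ and $\mathcal{S}:=\bigcup_{C\in\mathcal{D}_{1/(d-1)}}\partial C$, regarded as random closed sets, i.e. random elements of the space of closed subsets of $\mathbb{R}^{d-1}$ with the Fell topology. *)

(* Defs.v *)
From HB Require Import structures.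
From mathcomp Require Import all_boot all_order all_algebra.
From mathcomp Require Import all_classical all_reals all_analysis.
From mathcomp Require Import measurable_realfun.

Set Implicit Arguments.
Unset Strict Implicit.
Unset Printing Implicit Defensive.
Import Order.TTheory GRing.Theory Num.Theory.
Import numFieldNormedType.Exports.
Local Open Scope classical_set_scope.
Local Open Scope ring_scope.

(* The sigma-algebra on row vectors generated by the coordinates; on 'rV[R]_n
   this is the Borel sigma-algebra. *)
Definition measure_rV_display : measure_display -> measure_display.
Proof. exact. Qed.

Section measurable_rV.
Context {disp : measure_display} {T : measurableType disp} (n : nat).

Let coor : 'I_n -> 'rV[T]_n -> T := fun i v => v ord0 i.

Let rV_set0 : g_sigma_preimage coor set0.
Proof. exact: sigma_algebra0. Qed.

Let rV_setC A : g_sigma_preimage coor A -> g_sigma_preimage coor (~` A).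
Proof. exact: sigma_algebraC. Qed.

Let rV_bigcup (F : (set 'rV[T]_n)^nat) :
  (forall i, g_sigma_preimage coor (F i)) ->
  g_sigma_preimage coor (\bigcup_i (F i)).
Proof. exact: sigma_algebra_bigcup. Qed.

HB.instance Definition _ := @isMeasurable.Build (measure_rV_display disp)
  'rV[T]_n (g_sigma_preimage coor) rV_set0 rV_setC rV_bigcup.

End measurable_rV.

Lemma measurable_fun_rV d1 d2 (T1 : measurableType d1) (T2 : measurableType d2)
    (n : nat) (f : T1 -> 'rV[T2]_n) :
  (forall i, measurable_fun [set: T1] (fun x => f x ord0 i)) ->
  measurable_fun [set: T1] f.
Proof.
move=> mf.
suff H : g_sigma_preimage (fun i x => f x ord0 i) `<=` @measurable _ T1.
  move=> _ A mA; apply: H.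
  have -> : g_sigma_preimage (fun i x => f x ord0 i) =
      preimage_set_system [set: T1] f
        (g_sigma_preimage (fun i (v : 'rV[T2]_n) => v ord0 i)).
    exact: (g_sigma_preimage_comp (fun i (v : 'rV[T2]_n) => v ord0 i) f).
  by exists A.
apply: smallest_sub; first exact: sigma_algebra_measurable.
rewrite -bigcup_seq; apply: bigcup_sub => i _ A [B mB <-].
exact: mf.
Qed.

Section lebesgue_measure_rV.
Context (R : realType).

Definition rV_cons n (p : 'rV[R]_n * measurableTypeR R) : 'rV[R]_n.+1 :=
  row_mx (p.2%:M : 'rV_1) p.1.

Lemma measurable_rV_cons n : measurable_fun setT (@rV_cons n).
Proof.
apply: measurable_fun_rV => i; rewrite /rV_cons.
have [j ij|j ij] := split_ordP (i : 'I_(1 + n)).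
- rewrite (_ : (fun _ => _) = snd); first exact: measurable_snd.
  apply/funext => p; rewrite ij.
  by apply: (etrans (row_mxEl _ _ _ _)); rewrite mxE [j]ord1 mulr1n.
- rewrite (_ : (fun _ => _) = (fun v : 'rV[R]_n => v ord0 j) \o fst).
    apply: measurableT_comp measurable_fst.
    move=> _ B mB; rewrite setTI; apply: sub_sigma_algebra.
    rewrite -bigcup_seq; exists j; first by rewrite /= mem_index_enum.
    by exists B => //; rewrite setTI.
  by apply/funext => p; rewrite ij; exact: (etrans (row_mxEr _ _ _ _)).
Qed.

(* Lebesgue measure on R^n as an iterated product. The measure structure of
   [pushforward] is applied explicitly because it takes the measurability proof
   of the map as an argument, which unification cannot find. *)
Fixpoint lebesgue_measure_rV n : {measure set 'rV[R]_n -> \bar R} :=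
  match n with
  | 0 => dirac (0 : 'rV[R]_0)
  | m.+1 => measure_function_pushforward__canonical__measure_function_Measure
              (lebesgue_measure_rV m \x lebesgue_measure)%E
              (@measurable_rV_cons m)
  end.
End lebesgue_measure_rV.

Section fell_topology.
Context (T : topologicalType).

Record closed_set :=
  ClosedSet { closed_set_val :> set T; closed_setP : closed closed_set_val }.

HB.instance Definition _ := gen_eqMixin closed_set.
HB.instance Definition _ := gen_choiceMixin closed_set.
HB.instance Definition _ := isPointed.Build closed_set (ClosedSet closed0).

Definition fell_subbase : set (set closed_set) :=
  [set U | (exists2 K : set T, compact K & U = [set F : closed_set | F `&` K = set0]) \/
           (exists2 G : set T, open G & U = [set F : closed_set | F `&` G !=set0])].

HB.instance Definition _ := isSubBaseTopological.Build closed_set fell_subbase id.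
HB.instance Definition _ := Measurable.copy closed_set (g_sigma_algebraType (@open closed_set)).
End fell_topology.

Section point_processes.
Context {dX dO : measure_display} {X : measurableType dX}
        {Om : measurableType dO} {R : realType}.

Definition point_count (eta : Om -> set X) (B : set X) (w : Om) : \bar R :=
  counting (eta w `&` B).

(* A Poisson process is represented by the random set of its points, which
   loses nothing since it is only used for diffuse intensities [Lam], where
   the process is almost surely simple. The second argument of [poisson_prob]
   is a dummy. *)
Definition is_poisson_process (P : probability Om R) (Lam : set X -> \bar R)
    (eta : Om -> set X) : Prop :=
  [/\ forall B, measurable B -> measurable_fun [set: Om] (point_count eta B),
      forall B, measurable B -> Lam B \is a fin_num -> forall k : nat,
        P [set w | point_count eta B w = k%:R%:E] =
        poisson_prob (fine (Lam B)) 0 [set k],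
      forall B, measurable B -> Lam B = +oo%E ->
        P [set w | point_count eta B w = +oo%E] = 1%E &
      forall (m : nat) (B : 'I_m -> set X),
        (forall i, measurable (B i)) -> trivIset [set: 'I_m] B ->
        forall A : 'I_m -> set (\bar R), (forall i, measurable (A i)) ->
        P (\bigcap_i (point_count eta (B i) @^-1` A i)) =
        (\prod_(i < m) P (point_count eta (B i) @^-1` A i))%E].

End point_processes.

Definition weakly_converges {T : topologicalType} {R : realType} {I : Type}
    (F : set_system I) (mu : I -> probability (closed_set T) R)
    (nu : probability (closed_set T) R) : Prop :=
  forall f : closed_set T -> R, continuous f ->
    (exists M : R, forall x, `|f x| <= M) ->
    (\int[mu i]_x (f x)%:E @[i --> F] --> \int[nu]_x (f x)%:E)%E.

(* [mu] is the distribution of the random closed set [sk eta], for [eta] a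
   Poisson process with intensity [Lam]; [sk eta] need only be closed almost
   surely. *)
Definition is_law_of_poisson_set {dX : measure_display}
    {X : measurableType dX} {T : topologicalType} {R : realType}
    (Lam : set X -> \bar R) (sk : set X -> set T)
    (mu : probability (closed_set T) R) : Prop :=
  exists (dO : measure_display) (Om : measurableType dO)
    (P : probability Om R) (eta : Om -> set X) (Z : {mfun Om >-> closed_set T}),
    [/\ is_poisson_process P Lam eta,
        {ae P, forall w, closed_set_val (Z w) = sk (eta w)} &
        forall A, measurable A -> mu A = distribution P Z A].

Section euclidean.
Context {R : realType} {n : nat}.
Implicit Types v w : 'rV[R]_n.

(* The library norm on ['rV[R]_n] is the sup norm. *)
Definition enorm v : R := Num.sqrt (\sum_(i < n) v ord0 i ^+ 2).

Definition eball (r : R) : set 'rV[R]_n := [set v | enorm v <= r].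

Definition affinely_independent m (x : 'I_m -> 'rV[R]_n) : Prop :=
  forall a : 'I_m -> R, \sum_i a i = 0 -> \sum_i a i *: x i = 0 ->
  forall i, a i = 0.

Definition simplex m (x : 'I_m -> 'rV[R]_n) : set 'rV[R]_n :=
  [set v | exists t : 'I_m -> R,
    [/\ forall i, 0 <= t i, \sum_i t i = 1 & v = \sum_i t i *: x i]].

Definition boundary (C : set 'rV[R]_n) : set 'rV[R]_n :=
  closure C `\` interior C.

Definition skeleton (D : set (set 'rV[R]_n)) : set 'rV[R]_n :=
  \bigcup_(C in D) boundary C.

End euclidean.

Section tessellations.
Context {R : realType} (d : nat).
Local Notation E := 'rV[R]_d.-1.
Local Notation H := (E * measurableTypeR R)%type.

(* Hyperbolic space is the part [0 < p.2] of [H]. *)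
Definition hyperbolic_volume (A : set H) : \bar R :=
  (\int[lebesgue_measure_rV R d.-1 \x lebesgue_measure]_(p in
      A `&` [set p | 0 < p.2]%R) (p.2 ^- d)%:E)%E.

Definition horoball (lam : R) : set H := [set p | lam <= p.2].

Definition horoball_intensity (gam lam : R) (A : set H) : \bar R :=
  (gam%:E * hyperbolic_volume (A `&` horoball lam))%E.

(* The half-ball with centre [w] and radius [r] is determined by the [p i] since
   their first components are affinely independent, so quantifying it
   existentially is harmless; the same holds for the circumscribed ball in
   [delaunay]. *)
Definition hyperbolic_delaunay (eta : set H) : set (set E) :=
  [set C | exists p : 'I_d -> H,
    [/\ injective p, forall i, eta (p i),
        affinely_independent (fun i => (p i).1),
        exists (w : E) (r : R), [/\ 0 < r,
          forall i, enorm ((p i).1 - w) ^+ 2 + (p i).2 ^+ 2 = r ^+ 2 &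
          forall q, eta q -> ~ (enorm (q.1 - w) ^+ 2 + q.2 ^+ 2 < r ^+ 2)] &
        C = simplex (fun i => (p i).1)]].

Definition delaunay (eta : set E) : set (set E) :=
  [set C | exists x : 'I_d -> E,
    [/\ injective x, forall i, eta (x i),
        affinely_independent x,
        exists (w : E) (r : R), [/\ 0 < r,
          forall i, enorm (x i - w) = r &
          forall q, eta q -> ~ (enorm (q - w) < r)] &
        C = simplex x]].

Definition is_horoball_skeleton_law (gam lam : R) :
    probability (closed_set E) R -> Prop :=
  is_law_of_poisson_set (horoball_intensity gam lam)
    (fun eta => skeleton (hyperbolic_delaunay eta)).

Definition is_poisson_delaunay_skeleton_law (c : R) :
    probability (closed_set E) R -> Prop :=
  is_law_of_poisson_set (fun A : set E => c%:E * lebesgue_measure_rV R d.-1 A)%E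
    (fun eta => skeleton (delaunay eta)).

End tessellations.

(* Main.v *)
Require Import Defs.
From HB Require Import structures.
From mathcomp Require Import all_boot all_order all_algebra.
From mathcomp Require Import finmap.
From mathcomp Require Import all_classical all_reals all_analysis.
From mathcomp Require Import measurable_realfun.
From mathcomp Require Import ring lra zify.

Set Implicit Arguments.
Unset Strict Implicit.
Unset Printing Implicit Defensive.
Import Order.TTheory GRing.Theory Num.Theory.
Import numFieldNormedType.Exports.
Local Open Scope classical_set_scope.
Local Open Scope ring_scope.

(** The intensity [lam ^ (d - 1) * y ^ (- d) dv dy] on the horoball
    [y >= lam] is the image of [Lebesgue / (d - 1)] on the strip
    [R ^ (d - 1) x [0, 1[] under [(v, t) |-> (v, lam * height t)] with
    [height t = (1 - t) ^ (- 1 / (d - 1))] ([horoball_intensityE]). Hence one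
    Poisson process of marked points [(v, t)] carries all the models: raising
    its points to the heights [lam * height t] gives the hyperbolic process of
    parameter [lam], and forgetting the marks gives a homogeneous process of
    intensity [1 / (d - 1)], which is the case [lam = 0] of the same formula
    ([lifted_poisson], [projected_poisson], [flat_projected]).

    Let [p] consist of [d] raised points. The test that decides whether a
    further raised point [q] lies in the half-ball of [p] is the sign of a
    power function, and this function has the form [a + lam ^ 2 * b] where [a]
    is the power of the flattened points ([power_compress]). Almost surely no
    [d + 1] points are cospherical after flattening ([points_generic]), so each
    single sign is constant for small [lam]. Inside a ball of radius [R] only
    finitely many tests matter: almost surely there are arbitrarily large [M]
    such that all cells of side of order [M] near the origin contain a low
    point ([points_dense]), and then every empty half-ball whose simplex meets
    the ball of radius [M] has radius below [M] ([radius_small]). So almost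
    surely the skeletons of parameters [lam] and [0] coincide in the ball as
    soon as [lam] is small ([skeleton_compress_stable]). This gives the
    strong form of the convergence. It also gives almost sure convergence in
    the Fell topology ([fell_cvg]), hence convergence of expectations by
    dominated convergence.

    The weak form speaks of arbitrary processes with the given intensities, so
    the law of the skeleton must be shown to be determined by the intensity. A
    Poisson law is determined by its void probabilities
    ([poisson_law_unique]), and the skeleton is measurable for the sigma-algebra
    generated by the void events: hitting an open set is a countable
    combination of events which say that given cells contain a point
    ([skeleton_hitP], [measurable_has_tuple]), and such events generate the
    Borel sets of the Fell topology ([measurable_fun_closed_rV]).

    The marked Poisson process itself is built from fair coin tosses: their
    binary expansions are independent uniform variables ([fair_unif],
    [depends_on_indep]), a quantile transform makes Poisson numbers of them
    ([lebesgue_quantile]), and in each unit cell of the strip a Poisson number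
    of independent uniform points is placed. Splitting a multinomial sample of
    Poisson size gives independent Poisson counts ([cell_count_law]), and these
    add up over the cells ([total_count_law], [scattered_poisson]). *)

(** * Continuity of finite sums and products *)

Lemma cvg_bigsum {R : realType} {I T : Type} (F : set_system T) (r : seq I) (Q : pred I)
    (f : I -> T -> R) (a : I -> R) : Filter F ->
  (forall i, Q i -> f i x @[x --> F] --> a i) ->
  \sum_(i <- r | Q i) f i x @[x --> F] --> \sum_(i <- r | Q i) a i.
Proof. by move=> FF fa; apply: cvg_big => //; exact: add_continuous. Qed.

Lemma cvg_bigprod {R : realType} {I T : Type} (F : set_system T) (r : seq I) (Q : pred I)
    (f : I -> T -> R) (a : I -> R) : Filter F ->
  (forall i, Q i -> f i x @[x --> F] --> a i) ->
  \prod_(i <- r | Q i) f i x @[x --> F] --> \prod_(i <- r | Q i) a i.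
Proof. by move=> FF fa; apply: cvg_big => //; exact: mul_continuous. Qed.

Section continuous_real.
Context {R : realType} {U : topologicalType}.
Implicit Types f g : U -> R.

Lemma cont_cst (c : R) : continuous (fun _ : U => c).
Proof. by move=> x; exact: cvg_cst. Qed.

Lemma cont_add f g : continuous f -> continuous g -> continuous (fun x => f x + g x).
Proof. by move=> cf cg x; apply: cvgD; [exact: cf|exact: cg]. Qed.

Lemma cont_mul f g : continuous f -> continuous g -> continuous (fun x => f x * g x).
Proof. by move=> cf cg x; apply: cvgM; [exact: cf|exact: cg]. Qed.

Lemma cont_sub f g : continuous f -> continuous g -> continuous (fun x => f x - g x).
Proof. by move=> cf cg x; apply: cvgB; [exact: cf|exact: cg]. Qed.

Lemma cont_sum {I : Type} (r : seq I) (Q : pred I) (f : I -> U -> R) :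
  (forall i, Q i -> continuous (f i)) -> continuous (fun x => \sum_(i <- r | Q i) f i x).
Proof. by move=> cf x; apply: cvg_bigsum => i Qi; exact: cf. Qed.

Lemma cont_prod {I : Type} (r : seq I) (Q : pred I) (f : I -> U -> R) :
  (forall i, Q i -> continuous (f i)) -> continuous (fun x => \prod_(i <- r | Q i) f i x).
Proof. by move=> cf x; apply: cvg_bigprod => i Qi; exact: cf. Qed.

End continuous_real.

(** * Independent uniform variables from fair coins *)

Definition coins := nat -> bool.

Definition cyl (k : nat) (e : coins) : set coins :=
  [set w | forall i, (i < k)%N -> w i = e i].

Definition cylinders : set (set coins) :=
  [set A | A = set0 \/ exists k e, A = cyl k e].

HB.instance Definition _ := Pointed.on coins.
HB.instance Definition _ :=
  Measurable.copy coins (g_sigma_algebraType cylinders).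

Lemma cylindersI : setI_closed cylinders.
Proof.
have H k l e f : (k <= l)%N -> cylinders (cyl k e `&` cyl l f).
  move=> kl.
  have [ef|nef] := pselect (forall i, (i < k)%N -> f i = e i).
    right; exists l, f; apply/seteqP; split=> [w [_]//|w wf]; split=> // i ik.
    by rewrite wf ?ef// (leq_trans ik).
  left; rewrite -subset0 => w [we wf]; apply: nef => i ik.
  by rewrite -wf ?we// (leq_trans ik).
move=> A B [->|[k [e ->]]]; first by rewrite set0I; left.
move=> [->|[l [f ->]]]; first by rewrite setI0; left.
have [kl|/ltnW lk] := leqP k l; first exact: H.
by rewrite setIC; exact: H.
Qed.

Lemma measurable_cyl k e : measurable (cyl k e).
Proof. by apply: sub_sigma_algebra; right; exists k, e. Qed.

(** Cylinders are stable under intersection, and the empty one is the whole space. *)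
Lemma coins_measure_unique (R : realType) (m1 m2 : {measure set coins -> \bar R}) :
  (m1 setT < +oo)%E ->
  (forall k e, m1 (cyl k e) = m2 (cyl k e)) ->
  forall A, measurable A -> m1 A = m2 A.
Proof.
move=> m1T m12 A mA.
have cylT : cyl 0 (fun=> false) = setT by apply/seteqP; split.
apply: (measure_unique cylinders (fun=> setT)) => //.
- exact: cylindersI.
- by move=> _; right; exists 0%N, (fun=> false).
- by rewrite bigcup_const//; exists 0%N.
- by move=> B [->|[k [e ->]]]; [rewrite !measure0|exact: m12].
Qed.

Lemma measurable_coin i b : measurable [set w : coins | w i = b].
Proof.
rewrite [X in measurable X](_ : _ =
    \bigcup_(s : seq bool) (if nth false s i == b then cyl i.+1 (nth false s) else set0)).
  apply: countable_bigcupT_measurable; first exact: countableP.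
  by move=> s; case: ifP => // _; exact: measurable_cyl.
apply/seteqP; split=> [w /= wb|w [s _]].
  exists (mkseq w i.+1) => //; rewrite nth_mkseq// wb eqxx => j ji.
  by rewrite nth_mkseq.
by case: ifPn => // /eqP <- /(_ i); exact.
Qed.

Lemma measurable_fun_coins d (T : measurableType d) (f : T -> coins) :
  (forall i b, measurable [set x | f x i = b]) -> measurable_fun setT f.
Proof.
move=> mf; apply: (@measurability _ _ _ _ _ _ cylinders) => // _ [_ [->|[k [e ->]]] <-].
  by rewrite preimage_set0 setI0.
rewrite setTI (_ : _ @^-1` _ = \big[setI/setT]_(i < k) [set x | f x i = e i]).
  by apply: bigsetI_measurable => i _; exact: mf.
rewrite -(bigcap_mkord k (fun i => [set x | f x i = e i])).
apply/seteqP; split=> [x xk i /= ik|x xk i ik]; exact: xk.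
Qed.

Section binary_expansion.
Context {R : realType}.
Implicit Types (x : R) (w : coins).

Definition bits (x : measurableTypeR R) : coins := fun i => odd (Num.truncn (2 ^+ i.+1 * x)).

Fixpoint bits_value w (k : nat) : nat :=
  if k is k'.+1 then ((bits_value w k').*2 + w k')%N else 0%N.

Lemma truncn_half (y : R) : 0 <= y -> (Num.truncn (2 * y))./2 = Num.truncn y.
Proof.
move=> y0; have /andP[a b] := truncn_itv (mulr_ge0 (ler0n _ 2) y0).
apply/esym/truncn_def; move: a b; set t := Num.truncn _.
rewrite -{1 2}[t]odd_double_half; set h := t./2 => a b.
have o : (odd t)%:R <= 1 :> R by case: (odd t); rewrite ?ler01.
have o0 : 0 <= (odd t)%:R :> R by [].
move: a b; rewrite -!natr1 !natrD -!muln2 !natrM => a b; apply/andP; split; lra.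
Qed.

(** The first [k] binary digits of [x] are those of the integer part of
    [2 ^ k * x]. *)
Lemma bits_value_bits x k : 0 <= x < 1 -> bits_value (bits x) k = Num.truncn (2 ^+ k * x).
Proof.
move=> /andP[x0 x1]; elim: k => [|k IH] /=.
  by apply/esym/truncn_def; rewrite expr0 mul1r x0.
rewrite IH /bits addnC; rewrite -[RHS]odd_double_half; congr (_ + _.*2)%N.
by rewrite exprS -mulrA truncn_half// mulr_ge0// exprn_ge0.
Qed.

Lemma eq_bits_value k w e :
  (forall i, (i < k)%N -> w i = e i) <-> bits_value w k = bits_value e k.
Proof.
split; elim: k => [|k IH] //=.
  by move=> H; rewrite H// IH// => i ik; apply: H; exact: leqW.
move=> H i; have Hk : w k = e k.
  by move: (congr1 odd H); rewrite !oddD !odd_double /=; case: (w k) (e k) => -[].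
move/eqP: H; rewrite Hk eqn_add2r => /eqP/double_inj/IH H.
by rewrite ltnS leq_eqVlt => /predU1P[->//|]; exact: H.
Qed.

Lemma bits_value_lt w k : (bits_value w k < 2 ^ k)%N.
Proof.
elim: k => //= k IH; rewrite expnS mul2n; move: (w k) => b.
rewrite -addnn -[(2 ^ k).*2]addnn; case: b; rewrite /= ?addn1 ?addn0; lia.
Qed.

Lemma measurable_bits : measurable_fun setT bits.
Proof.
apply: measurable_fun_coins => i b.
rewrite (_ : [set _ | _] = \bigcup_j (if odd j == b then
    [set x : R | Num.truncn (2 ^+ i.+1 * x) = j] else set0)); last first.
  apply/seteqP; split=> [x /= xb|x [j _] /=].
    by exists (Num.truncn (2 ^+ i.+1 * x)) => //; rewrite -xb eqxx.
  by case: ifP => // /eqP <- /= <-.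
apply: bigcupT_measurable => j; case: ifP => // _.
have P0 : 0 < 2 ^+ i.+1 :> R by rewrite exprn_gt0.
case: j => [|j].
  rewrite (_ : mkset _ = `]-oo, (2 ^+ i.+1)^-1[%classic) //.
  apply/seteqP; split=> x /=; rewrite in_itv/=.
    move=> /eqP; rewrite -leqn0 real_truncn_le_nat ?num_real// => h.
    by rewrite -ltr_pdivlMl// in h; rewrite mulr1 in h.
  move=> h; apply/eqP; rewrite -leqn0 real_truncn_le_nat ?num_real//.
  by rewrite -ltr_pdivlMl// mulr1.
rewrite (_ : mkset _ = `[(2 ^+ i.+1)^-1 * j.+1%:R, (2 ^+ i.+1)^-1 * j.+2%:R[%classic) //.
apply/seteqP; split=> x /=; rewrite in_itv/=.
  move=> h; have x0 : 0 <= 2 ^+ i.+1 * x.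
    rewrite leNgt; apply/negP => xn; move: h; rewrite truncn_floor.
    by rewrite leNgt xn.
  by move/eqP: h; rewrite truncn_eq// ler_pdivrMl// ltr_pdivlMl.
by rewrite ler_pdivrMl// ltr_pdivlMl// => h; exact: truncn_def.
Qed.

HB.instance Definition _ := isMeasurableFun.Build _ _ _ _ _ measurable_bits.

Lemma cyl_bits k (e : coins) : bits @^-1` cyl k e `&` `[0, 1[%classic =
  `[(bits_value e k)%:R / 2 ^+ k, (bits_value e k).+1%:R / 2 ^+ k[%classic :> set R.
Proof.
have P0 : 0 < 2 ^+ k :> R by rewrite exprn_gt0.
apply/seteqP; split=> x /=; rewrite !in_itv/= ler_pdivrMr// ltr_pdivlMr// ![x * _]mulrC.
  move=> [/eq_bits_value xe x01]; move: xe; rewrite bits_value_bits// => <-.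
  by case/andP: x01 => x0 _; rewrite truncn_itv// mulr_ge0// ltW.
move=> H; have x01 : 0 <= x < 1.
  case/andP: H => a b; rewrite -(pmulr_rge0 _ P0) (le_trans _ a)//=.
  rewrite -(ltr_pM2l P0) mulr1 (lt_le_trans b)//.
  by rewrite -natrX ler_nat bits_value_lt.
by split=> //; apply/eq_bits_value; rewrite bits_value_bits//; exact: truncn_def.
Qed.

Definition unit_lebesgue : set (measurableTypeR R) -> \bar R :=
  mrestr lebesgue_measure (measurable_itv `[0%R, 1%R[).

HB.instance Definition _ := Measure.on unit_lebesgue.

Let unit_lebesgueT : unit_lebesgue setT = 1%E.
Proof.
rewrite /unit_lebesgue /mrestr setTI lebesgue_measure_itv/= lte_fin ltr01.
by rewrite -EFinB subr0.
Qed.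

HB.instance Definition _ :=
  Measure_isProbability.Build _ _ _ unit_lebesgue unit_lebesgueT.

(** Lebesgue measure on the unit interval, read through binary digits, is the law
    of a sequence of fair coins. *)
Definition coin_measure : probability coins R :=
  distribution unit_lebesgue bits.

Lemma coin_measure_cyl k e : coin_measure (cyl k e) = ((2 ^+ k)^-1)%:E.
Proof.
rewrite /coin_measure/= /distribution /pushforward /unit_lebesgue /mrestr.
rewrite cyl_bits lebesgue_measure_itv /= lte_fin ltr_pM2r ?invr_gt0 ?exprn_gt0//.
by rewrite ltr_nat ltnSn -EFinB -mulrBl -natr1 addrAC subrr add0r mul1r.
Qed.

End binary_expansion.

Definition fair {R : realType} (P : probability coins R) : Prop :=
  forall k e, P (cyl k e) = ((2 ^+ k)^-1)%:E.

Section fair_coins.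
Context {R : realType} (P : probability coins R) (fairP : fair P).

Definition flip (i : nat) (w : coins) : coins :=
  fun j => if j == i then ~~ w j else w j.

Lemma measurable_flip i : measurable_fun setT (flip i).
Proof.
apply: measurable_fun_coins => j b; rewrite /flip.
case: (j == i); last exact: measurable_coin.
rewrite (_ : mkset _ = [set w : coins | w j = ~~ b]); first exact: measurable_coin.
by apply/seteqP; split=> w /=; case: (w j) b => -[].
Qed.
HB.instance Definition _ i := isMeasurableFun.Build _ _ _ _ _ (measurable_flip i).

(** Flipping permutes the cylinders of a given length, and these all have the same
    measure. *)
Lemma fair_flip i A : measurable A -> P (flip i @^-1` A) = P A.
Proof.
move=> mA; apply: (@coins_measure_unique R (distribution P (flip i)) P) => //.
  by rewrite /= /distribution /pushforward preimage_setT probability_setT ltry.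
move=> k e; change (P (flip i @^-1` cyl k e) = P (cyl k e)).
rewrite [RHS]fairP -(fairP k (flip i e)).
congr (P _); apply/seteqP; split => w wk j jk; move: (wk j jk); rewrite /flip.
  by case: eqP => // _ <-; rewrite negbK.
by case: eqP => // _ ->; rewrite negbK.
Qed.

Definition coin_event (s : seq nat) (e : coins) : set coins :=
  [set w | forall i, i \in s -> w i = e i].

Lemma measurable_coin_event s e : measurable (coin_event s e).
Proof.
elim: s => [|i s IH].
  by rewrite (_ : coin_event _ _ = setT)//; apply/seteqP; split.
rewrite (_ : coin_event _ _ = [set w | w i = e i] `&` coin_event s e).
  by apply: measurableI => //; exact: measurable_coin.
apply/seteqP; split=> [w H|w [H1 H2] j]; last by rewrite inE => /predU1P[->|/H2].
by split=> [|j js]; apply: H; rewrite inE ?eqxx// js orbT.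
Qed.

(** By induction on [s]: by [fair_flip] the two values of one more coin split the
    event into halves of equal probability. *)
Lemma fair_event s e : uniq s ->
  P (coin_event s e) = ((2 ^+ size s)^-1)%:E.
Proof.
elim: s => [_|i s IH /andP[is_ us]].
  rewrite (_ : coin_event _ _ = setT) ?probability_setT ?expr0 ?invr1//.
  by apply/seteqP; split.
have mE b := measurableI _ _ (measurable_coin i b) (measurable_coin_event s e).
have E : coin_event s e = ([set w | w i = e i] `&` coin_event s e) `|`
   ([set w | w i = ~~ e i] `&` coin_event s e).
  rewrite -setIUl (_ : _ `|` _ = setT) ?setTI//.
  by apply/seteqP; split=> w //= _; case: (w i) (e i) => -[]; [left|right|right|left].
have F : P ([set w | w i = ~~ e i] `&` coin_event s e) =
    P ([set w | w i = e i] `&` coin_event s e).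
  rewrite -(fair_flip i (mE _)); congr (P _).
  apply/seteqP; split => w [/= H1 H2].
    split; first by apply: negb_inj; rewrite -H1 /flip eqxx.
    by move=> j js; rewrite -H2// /flip; case: eqP js is_ => // -> ->.
  split; first by rewrite /= /flip eqxx H1.
  by move=> j js; rewrite -H2// /flip; case: eqP js is_ => // -> ->.
have EU : (P (coin_event s e) = P ([set w | w i = e i] `&` coin_event s e) +
    P ([set w | w i = ~~ e i] `&` coin_event s e))%E.
  rewrite {1}E; apply: measureU => //.
  by rewrite -subset0 => w [[/= -> _] [/esym + _]]; case: (e i).
move: (IH us); rewrite EU F; set A := _ `&` _.
have -> : coin_event (i :: s) e = A.
  apply/seteqP; split=> [w H|w [H1 H2] j]; last by rewrite inE => /predU1P[->|/H2].
  by split=> [|j js]; apply: H; rewrite inE ?eqxx// js orbT.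
have [r ->] : exists r, P A = r%:E.
  by exists (fine (P A)); rewrite fineK// fin_num_measure//; exact: mE.
rewrite -EFinD => -[H]; congr EFin; rewrite exprS invfM -H; lra.
Qed.

Definition depends_on {T : Type} (S : set nat) (f : coins -> T) : Prop :=
  forall w w' : coins, (forall i, S i -> w i = w' i) -> f w = f w'.

Lemma depends_onS T (S S' : set nat) (f : coins -> T) :
  S `<=` S' -> depends_on S f -> depends_on S' f.
Proof. by move=> SS H w w' ww'; apply: H => i /SS; exact: ww'. Qed.

(** Setting the coins outside [S] to zero factors every variable that depends on
    [S] only, which reduces the independence of such variables to that of two
    masks. *)
Definition mask (S : set nat) (w : coins) : coins := fun i => (i \in S) && w i.

Lemma depends_on_mask T S (f : coins -> T) w : depends_on S f -> f (mask S w) = f w.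
Proof. by apply=> i Si; rewrite /mask mem_set. Qed.

Lemma mask_cyl S k e : mask S @^-1` cyl k e = set0 \/
  mask S @^-1` cyl k e = coin_event [seq i <- iota 0 k | i \in S] e.
Proof.
have [[i [ik /negP iS ei]]|H] := pselect (exists i, [/\ (i < k)%N, ~ i \in S & e i]).
  left; rewrite -subset0 => w /(_ i ik); rewrite /mask (negbTE iS) ei //.
right; apply/seteqP; split=> w /= Hw i.
  by rewrite mem_filter mem_iota add0n => /andP[iS /andP[_ ik]]; rewrite -Hw// /mask iS.
rewrite /mask => ik; have [iS|iS] := boolP (i \in S).
  by apply: Hw; rewrite mem_filter iS mem_iota.
by apply/esym/negbTE/negP => ei; apply: H; exists i; split => //; exact/negP.
Qed.

Lemma measurable_mask S : measurable_fun setT (mask S).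
Proof.
apply: measurable_fun_coins => i b; rewrite /mask; case: (i \in S) => /=.
  exact: measurable_coin.
by case: b; [rewrite (_ : mkset _ = set0)|rewrite (_ : mkset _ = setT)] => //;
  apply/seteqP; split.
Qed.
HB.instance Definition _ S := isMeasurableFun.Build _ _ _ _ _ (measurable_mask S).

Lemma mask_indep_cyl (S S' : set nat) k e l f : S `&` S' = set0 ->
  P (mask S @^-1` cyl k e `&` mask S' @^-1` cyl l f) =
  (P (mask S @^-1` cyl k e) * P (mask S' @^-1` cyl l f))%E.
Proof.
move=> SS.
have [->|->] := mask_cyl S k e; first by rewrite set0I measure0 mul0e.
have [->|->] := mask_cyl S' l f; first by rewrite setI0 measure0 mule0.
set s := [seq i <- iota 0 k | i \in S]; set s' := [seq i <- iota 0 l | i \in S'].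
pose g i := if i \in S then e i else f i.
have ss' i : i \in s -> i \in s' -> False.
  rewrite !mem_filter => /andP[iS _] /andP[iS' _].
  by move: SS; rewrite -subset0 => /(_ i); apply; split; exact: set_mem.
have -> : coin_event s e `&` coin_event s' f = coin_event (s ++ s') g.
  apply/seteqP; split=> w.
    move=> [we wf] i; rewrite mem_cat /g => /orP[is1|is1].
      by rewrite we//; move: is1; rewrite mem_filter => /andP[-> _].
    rewrite wf//; case: ifPn => // iS; exfalso; move: SS; rewrite -subset0 => /(_ i); apply.
    by split; apply: set_mem => //; move: is1; rewrite mem_filter => /andP[].
  move=> wg; split=> i is1; rewrite wg ?mem_cat ?is1 ?orbT// /g.
    by move: is1; rewrite mem_filter => /andP[-> _].
  case: ifPn => // iS; exfalso; move: SS; rewrite -subset0 => /(_ i); apply.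
  by split; apply: set_mem => //; move: is1; rewrite mem_filter => /andP[].
rewrite !fair_event ?filter_uniq ?iota_uniq//.
  by rewrite size_cat exprD invfM EFinM.
rewrite cat_uniq !filter_uniq ?iota_uniq// andbT /=.
by apply/hasPn => i is1; apply/negP => is2; exact: (ss' i).
Qed.

Let restricted_law (B : set coins) (mB : measurable B) (S : set nat) : {measure set coins -> \bar R} :=
  measure_function_pushforward__canonical__measure_function_Measure
    (mrestr P mB) (measurable_mask S).

(** Both sides are finite measures, first in [A] and then in [B], so that agreement
    on cylinders suffices. *)
Lemma mask_indep (S S' : set nat) A B : S `&` S' = set0 ->
  measurable A -> measurable B ->
  P (mask S @^-1` A `&` mask S' @^-1` B) =
  (P (mask S @^-1` A) * P (mask S' @^-1` B))%E.
Proof.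
move=> SS mA mB.
have mM (T : set nat) C : measurable C -> measurable (mask T @^-1` C).
  by move=> mC; rewrite -[X in measurable X]setTI; exact: measurable_mask.
have fP C : measurable C -> 0 <= fine (P C) by move=> mC; exact/fine_ge0/measure_ge0.
have H1 k e : P (mask S @^-1` cyl k e `&` mask S' @^-1` B) =
  (P (mask S @^-1` cyl k e) * P (mask S' @^-1` B))%E.
  have mc := mM S _ (measurable_cyl k e).
  pose m2 : {measure set coins -> \bar R} := mscale (NngNum (fP _ mc)) (distribution P (mask S')).
  have := @coins_measure_unique R (restricted_law mc S') m2.
  rewrite /m2/= /mscale/= /pushforward /mrestr /= fineK ?fin_num_measure// => H.
  rewrite setIC; apply: H => //.
    rewrite preimage_setT setTI (le_lt_trans (probability_le1 P _)) ?ltry//.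
  move=> l f; rewrite setIC; exact: mask_indep_cyl.
have mc := mM S' _ mB.
pose m2 : {measure set coins -> \bar R} := mscale (NngNum (fP _ mc)) (distribution P (mask S)).
have := @coins_measure_unique R (restricted_law mc S) m2.
rewrite /m2/= /mscale/= /pushforward /mrestr /= fineK ?fin_num_measure// => H.
rewrite [RHS]muleC; apply: H => //.
  rewrite preimage_setT setTI (le_lt_trans (probability_le1 P _)) ?ltry//.
by move=> k e; rewrite H1 muleC.
Qed.

Lemma depends_on_indep d1 d2 (T1 : measurableType d1) (T2 : measurableType d2)
    (S S' : set nat) (f : coins -> T1) (g : coins -> T2) A B :
  S `&` S' = set0 -> depends_on S f -> depends_on S' g ->
  measurable_fun setT f -> measurable_fun setT g ->
  measurable A -> measurable B ->
  P (f @^-1` A `&` g @^-1` B) = (P (f @^-1` A) * P (g @^-1` B))%E.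
Proof.
move=> SS Sf Sg mf mg mA mB.
have E T (h : coins -> T) U C : depends_on U h -> h @^-1` C = mask U @^-1` (h @^-1` C).
  by move=> Uh; apply/seteqP; split=> w /=; rewrite depends_on_mask.
rewrite (E _ f _ _ Sf) (E _ g _ _ Sg) mask_indep//.
  by rewrite -[X in measurable X]setTI; exact: mf.
by rewrite -[X in measurable X]setTI; exact: mg.
Qed.

End fair_coins.

Section uniforms.
Context {R : realType}.

Definition coin_real (w : coins) : R :=
  limn (fun k => (bits_value w k)%:R / 2 ^+ k : R).

Lemma cvg_coin_real w :
  (fun k => (bits_value w k)%:R / 2 ^+ k : R) @ \oo --> coin_real w.
Proof.
suff H : cvgn (fun k => (bits_value w k)%:R / 2 ^+ k : R) by exact: H.
apply: nondecreasing_is_cvgn.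
  apply/nondecreasing_seqP => k /=.
  rewrite ler_pdivlMr ?exprn_gt0// exprS mulrCA mulfVK ?gt_eqF ?exprn_gt0//.
  by rewrite natrD -muln2 natrM mulrC lerDl.
exists 1 => _ [k _ <-]; rewrite ler_pdivrMr ?exprn_gt0// mul1r -natrX ler_nat.
exact/ltnW/bits_value_lt.
Qed.

Lemma coin_real_bits (x : R) : 0 <= x < 1 -> coin_real (bits x) = x.
Proof.
move=> x01; apply: cvg_lim => //.
under eq_fun do rewrite bits_value_bits//.
apply/cvgrPdist_le => e e0; near=> k.
have P0 : 0 < 2 ^+ k :> R by rewrite exprn_gt0.
have /andP[a b] : (Num.truncn (2 ^+ k * x))%:R <= 2 ^+ k * x < (Num.truncn (2 ^+ k * x)).+1%:R.
  by rewrite truncn_itv//; case/andP: x01 => x0 _; rewrite mulr_ge0// ltW.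
have ke : (2 ^+ k)^-1 <= e.
  near: k; have z1 : `|2^-1 : R| < 1 by rewrite ger0_norm ?invr_ge0// invf_lt1// ltr1n.
  move: (cvg_expr z1) => /cvgrPdist_le /(_ e e0); apply: filterS => k /=.
  by rewrite sub0r normrN exprVn ger0_norm// invr_ge0 exprn_ge0.
move: a b; rewrite -ler_pdivrMl// -ltr_pdivlMl// -(natr1 (Num.truncn _)) mulrDr mulr1 => a b.
rewrite (le_trans _ ke)// ger0_norm; first by rewrite mulrC; lra.
by rewrite mulrC; lra.
Unshelve. all: by end_near. Qed.

Lemma measurable_coin_real : measurable_fun setT (coin_real : coins -> measurableTypeR R).
Proof.
apply: (@measurable_fun_cvg _ _ _ _ (fun k w => (bits_value w k)%:R / 2 ^+ k)); last first.
  by move=> w _; exact: cvg_coin_real.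
move=> k; apply: measurable_funM => //; elim: k => [|k IH] //=.
rewrite (_ : (fun _ => _) = (fun w => (bits_value w k)%:R + (bits_value w k)%:R + (w k)%:R)).
  apply: measurable_funD; first exact: measurable_funD.
  apply: (@measurableT_comp _ _ _ _ _ _ (fun b : bool => b%:R : R) _ (fun w : coins => w k)) => //.
  apply: (measurable_fun_bool true); rewrite setTI; exact: measurable_coin.
by apply/funext => w; rewrite natrD -addnn natrD.
Qed.

(** Cylinders determine the fair law, so the coins may be taken to be the binary
    digits of a point of the unit interval, and [coin_real] gives this point
    back. *)
Lemma fair_coin_real (P : probability coins R) (A : set (measurableTypeR R)) :
  fair P -> measurable A ->
  P (coin_real @^-1` A) = lebesgue_measure (A `&` `[0, 1[%classic).
Proof.
move=> fP mA.
have mU : measurable (coin_real @^-1` A).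
  by rewrite -[X in measurable X]setTI; exact: measurable_coin_real.
transitivity (@coin_measure R (coin_real @^-1` A)).
  apply: coins_measure_unique mU; first by rewrite (le_lt_trans (probability_le1 P measurableT)) ?ltry.
  by move=> k e; exact: (etrans (fP k e) (esym (coin_measure_cyl k e))).
rewrite /coin_measure /= /distribution /pushforward /unit_lebesgue /mrestr.
congr (lebesgue_measure _); apply/seteqP; split=> x [/= Ax].
  by rewrite in_itv/= => x01; move: Ax; rewrite coin_real_bits//.
by rewrite in_itv/= => x01; rewrite coin_real_bits.
Qed.

Context (K : countType).

(** The coins are distributed over the keys by a bijection of [K * nat] with a set
    of integers, so distinct keys read disjoint sets of coins. *)
Definition stream (a : K) (w : coins) : coins := fun k => w (choice.pickle (a, k)).

Lemma measurable_stream a : measurable_fun setT (stream a).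
Proof. by apply: measurable_fun_coins => i b; exact: measurable_coin. Qed.
HB.instance Definition _ a := isMeasurableFun.Build _ _ _ _ _ (measurable_stream a).

Lemma fair_stream (P : probability coins R) a : fair P -> fair (distribution P (stream a)).
Proof.
move=> fP k e; rewrite /distribution/= /pushforward.
pose s := [seq choice.pickle (a, i) | i <- iota 0 k].
have us : uniq s.
  by rewrite map_inj_uniq ?iota_uniq// => i j /(pcan_inj choice.pickleK) [].
pose f n := if (choice.unpickle n : option (K * nat)) is Some (_, i) then e i else false.
rewrite -[X in 2 ^+ X](_ : size s = k); last by rewrite size_map size_iota.
rewrite -(fair_event fP f us); congr (P _); apply/seteqP; split=> w /= H i.
  by move=> /mapP[j]; rewrite mem_iota => /andP[_ jk] ->; rewrite /f choice.pickleK -H.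
move=> ik; rewrite /stream H /f ?choice.pickleK//.
by apply/mapP; exists i => //; rewrite mem_iota.
Qed.

Definition unif (a : K) (w : coins) : measurableTypeR R := coin_real (stream a w).

Lemma measurable_unif a : measurable_fun setT (unif a).
Proof.
by apply: (measurableT_comp measurable_coin_real); exact: measurable_stream.
Qed.

Lemma fair_unif (P : probability coins R) a (A : set (measurableTypeR R)) :
  fair P -> measurable A ->
  P (unif a @^-1` A) = lebesgue_measure (A `&` `[0, 1[%classic).
Proof. by move=> fP mA; rewrite -(fair_coin_real (fair_stream a fP) mA). Qed.

Definition block (A : set K) : set nat := [set n | exists2 a, A a & exists k : nat, n = choice.pickle (a, k)].

Lemma blockI A B : A `&` B = set0 -> block A `&` block B = set0.
Proof.
rewrite -!subset0 => AB n [[a Aa [k ->]] [b Bb [l]]].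
by move=> /(pcan_inj choice.pickleK) [ab _]; apply: (AB a); split => //; rewrite ab.
Qed.

Lemma block_unif (A : set K) a : A a -> depends_on (block A) (unif a).
Proof.
move=> Aa w w' H; rewrite /unif; congr coin_real; apply/funext => k.
by apply: H; exists a => //; exists k.
Qed.

End uniforms.

(** * Counts of a Poisson number of independent points *)

Lemma probability_finType {d} {Om : measurableType d} {R : realType}
    (P : probability Om R) (F : finType) (A : F -> set Om) (r : F -> R) :
  (forall f, measurable (A f)) -> (forall f, P (A f) = (r f)%:E) ->
  (forall f g w, A f w -> A g w -> f = g) ->
  P (\bigcup_f A f) = (\sum_f r f)%:E.
Proof.
move=> mA PA dA; rewrite measure_fin_bigcup//; first last.
- by move=> f g _ _ [w [Af Ag]]; exact: (dA f g w).
- exact: finite_finset.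
rewrite -sumEFin (fsbigE (enum F)) ?enum_uniq//; last first.
  by move=> f _; rewrite mem_enum.
by rewrite big_enum_cond/=; apply: eq_big => [f|f _]; rewrite ?in_setT ?PA.
Qed.

Section poisson_weights.
Context {R : realType}.

Definition expo_weight (a : R) (k : nat) : R := a ^+ k / k`!%:R.

Definition poisson_weight (a : R) (k : nat) : R := expR (- a) * expo_weight a k.

Lemma expo_weightS a k : k.+1%:R * expo_weight a k.+1 = a * expo_weight a k.
Proof.
have H (n : nat) : n`!%:R != 0 :> R by rewrite pnatr_eq0 -lt0n fact_gt0.
rewrite /expo_weight exprS factS natrM; have : k.+1%:R != 0 :> R by rewrite pnatr_eq0.
by move: (H k); move: (k.+1%:R) => y x0 y0; field; rewrite x0 y0.
Qed.

Lemma expo_weightD a b k :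
  expo_weight (a + b) k = \sum_(j < k.+1) expo_weight a (k - j) * expo_weight b j.
Proof.
have H (n : nat) : n`!%:R != 0 :> R by rewrite pnatr_eq0 -lt0n fact_gt0.
rewrite /expo_weight exprDn mulr_suml; apply: eq_bigr => j _.
have jk : (j <= k)%N by rewrite -ltnS.
have B : 'C(k, j)%:R != 0 :> R by rewrite pnatr_eq0 -lt0n bin_gt0.
rewrite -(bin_fact jk) -mulr_natr !natrM.
by move: (H j) (H (k - j)%N) B => ? ? ?; field; apply/and3P.
Qed.

(** The binomial theorem: sums of independent Poisson variables are Poisson. *)
Lemma poisson_weightD a b k :
  poisson_weight (a + b) k = \sum_(j < k.+1) poisson_weight a (k - j) * poisson_weight b j.
Proof.
rewrite /poisson_weight expo_weightD opprD expRD mulr_sumr.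
by apply: eq_bigr => j _; ring.
Qed.

Definition poisson_cdf (a : R) (t : nat) : R := \sum_(k < t.+1) poisson_weight a k.

Lemma poisson_weight_ge0 a k : 0 <= a -> 0 <= poisson_weight a k.
Proof.
by move=> a0; rewrite /poisson_weight mulr_ge0 ?expR_ge0// divr_ge0// exprn_ge0.
Qed.

(** The exponential series. *)
Lemma cvg_poisson_cdf1 a : (fun t => poisson_cdf a t) @ \oo --> (1 : R).
Proof.
have -> : (1 : R) = expR (- a) * expR a by rewrite expRN mulVf// gt_eqF// expR_gt0.
rewrite (_ : (fun t => _) = (fun t => expR (- a) * (series (exp_coeff a) t.+1))).
  apply: cvgMr; rewrite (cvg_shiftS (series (exp_coeff a))).
  exact: is_cvg_series_exp_coeff.
apply/funext => t; rewrite /poisson_cdf /series/= -mulr_sumr big_mkord.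
by congr (_ * _); apply: eq_bigr => i _; rewrite /exp_coeff.
Qed.

Lemma cvg_poisson_cdf (a : nat -> R) (b : R) t :
  a @ \oo --> b -> (fun M => poisson_cdf (a M) t) @ \oo --> poisson_cdf b t.
Proof.
move=> ab; rewrite /poisson_cdf; apply: cvg_bigsum => k _; rewrite /poisson_weight /expo_weight.
apply: cvgM; last first.
  apply: cvgMl; exact: (cvg_comp _ _ ab (@exprn_continuous R k b)).
exact: (cvg_comp _ _ (cvgN ab) (@continuous_expR R (- b))).
Qed.

(** Comparison of [exp a] with [a ^ (t + 1) / (t + 1)!] bounds each of the [t + 1]
    weights by a multiple of [1 / a]. *)
Lemma poisson_cdf_vanish (a : nat -> R) t :
  a @ \oo --> +oo -> (fun M => poisson_cdf (a M) t) @ \oo --> (0 : R).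
Proof.
move=> /cvgryPge ay; set c : R := t.+1%:R * (t.+1)`!%:R.
have c0 : 0 < c by rewrite mulr_gt0// ltr0n fact_gt0.
apply/cvgrPdist_le => e e0; near=> M.
have a1 : 1 <= a M by near: M; exact: ay.
have ace : c / e <= a M by near: M; exact: ay.
have a0 : 0 < a M by rewrite (lt_le_trans _ a1).
rewrite sub0r normrN ger0_norm; last first.
  by apply: sumr_ge0 => k _; apply: poisson_weight_ge0; exact: ltW.
have W (k : 'I_t.+1) : poisson_weight (a M) k <= (t.+1)`!%:R / a M.
  have E : expR (- a M) <= (t.+1)`!%:R / a M ^+ t.+1.
    rewrite expRN -[leRHS]invrK lef_pV2 ?posrE ?expR_gt0//; last first.
      by rewrite invr_gt0 divr_gt0 ?exprn_gt0// ltr0n fact_gt0.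
    by rewrite invf_div (le_trans _ (expR_ge1Dxn t (ltW a0)))// lerDr.
  rewrite /poisson_weight /expo_weight.
  rewrite (le_trans (ler_wpM2r _ E))//; first by rewrite divr_ge0// exprn_ge0// ltW.
  rewrite -mulrA ler_pM2l ?ltr0n ?fact_gt0// exprS invfM -mulrA -[leRHS]mulr1.
  rewrite ler_pM2l ?invr_gt0// ler_pdivrMl ?exprn_gt0// mulr1.
  rewrite ler_pdivrMr ?ltr0n ?fact_gt0//.
  have kt : (k <= t)%N by rewrite -ltnS.
  rewrite (le_trans (ler_weXn2l a1 kt))// ler_peMr//; first by rewrite exprn_ge0// ltW.
  by rewrite ler1n fact_gt0.
rewrite (le_trans (ler_sum _ (fun k _ => W k)))// sumr_const card_ord -[leLHS]mulr_natl mulrA.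
by rewrite -/c ler_pdivrMr// mulrC -ler_pdivrMr.
Unshelve. all: by end_near. Qed.

End poisson_weights.

Section poisson_counts.
Context {R : realType} (P : probability coins R) (fairP : fair P).
Context {d : measure_display} {T : measurableType d}.
Variables (theta : R) (mu : nat -> probability T R).
Local Notation I := (nat + nat * nat)%type.
Variable S : I -> set nat.
Hypothesis SI : forall i j, i <> j -> S i `&` S j = set0.
Variables (N : nat -> coins -> nat) (X : nat -> nat -> coins -> T).
Hypothesis mN : forall j, measurable_fun setT (N j).
Hypothesis dN : forall j, depends_on (S (inl j)) (N j).
Hypothesis lN : forall j k, P [set w | N j w = k] = (poisson_weight theta k)%:E.
Hypothesis mX : forall j l, measurable_fun setT (X j l).
Hypothesis dX : forall j l, depends_on (S (inr (j, l))) (X j l).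
Hypothesis lX : forall j l B, measurable B -> P (X j l @^-1` B) = mu j B.

Definition sources (A : set I) : set nat := \bigcup_(i in A) S i.

Lemma sourcesI A B : A `&` B = set0 -> sources A `&` sources B = set0.
Proof.
rewrite -!subset0 => AB n [[i Ai Si] [j Bj Sj]].
have [ij|/SI] := pselect (i = j); first by apply: (AB i); split => //; rewrite ij.
by rewrite -subset0 => /(_ n); apply.
Qed.

Lemma depends_on_source Y A i (f : coins -> Y) :
  A i -> depends_on (S i) f -> depends_on (sources A) f.
Proof. by move=> Ai; apply: depends_onS => n Sn; exists i. Qed.

(** The points are sorted into finitely many categories; a category is later the
    set where a point falls, and the sets of a finite disjoint family are treated
    at once. *)
Section categories.
Context {J : finType} (cat : T -> J).
Hypothesis mcat : forall i, measurable (cat @^-1` [set i]).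

Definition weight j i : R := fine (mu j (cat @^-1` [set i])).

Lemma weightE j i : mu j (cat @^-1` [set i]) = (weight j i)%:E.
Proof. by rewrite /weight fineK// fin_num_measure. Qed.

Lemma sum_weight j : \sum_i weight j i = 1.
Proof.
apply: EFin_inj; rewrite -(probability_finType (P := mu j) (A := fun i => cat @^-1` [set i])) //.
- rewrite (_ : \bigcup_i _ = setT) ?probability_setT//.
  by apply/seteqP; split=> // x _; exists (cat x).
- by move=> i; exact: weightE.
- by move=> f g w /= <- <-.
Qed.

Definition num_hits j L i w : nat := count (fun l => cat (X j l w) == i) (iota 0 L).

Lemma num_hitsS j L i w : num_hits j L.+1 i w = (num_hits j L i w + (cat (X j L w) == i))%N.
Proof. by rewrite /num_hits -addn1 iotaD count_cat /= addn0 add0n. Qed.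

Lemma sum_num_hits j L w : (\sum_i num_hits j L i w = L)%N.
Proof.
elim: L => [|L IH]; first by rewrite big1.
under eq_bigr do rewrite num_hitsS.
by rewrite big_split/= IH (bigD1 (cat (X j L w)))//= eqxx big1 ?addn0 ?addn1// => i /negbTE; rewrite eq_sym => ->.
Qed.

Lemma measurable_catX j l i : measurable [set w | cat (X j l w) = i].
Proof. by have := mX j l measurableT (mcat i); rewrite setTI. Qed.

Lemma measurable_num_hits j L i k : measurable [set w | num_hits j L i w = k].
Proof.
elim: L k => [|L IH] k.
  case: k => [|k]; first by rewrite (_ : mkset _ = setT)//; apply/seteqP; split.
  by rewrite (_ : mkset _ = set0)//; apply/seteqP; split.
rewrite (_ : mkset _ =
    ([set w | cat (X j L w) = i] `&` (if k is k'.+1 then [set w | num_hits j L i w = k'] else set0)) `|`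
    (~` [set w | cat (X j L w) = i] `&` [set w | num_hits j L i w = k])).
  apply: measurableU; apply: measurableI => //.
  - exact: measurable_catX.
  - by case: k.
  - by apply: measurableC; exact: measurable_catX.
apply/seteqP; split=> w /=; rewrite num_hitsS.
  case: eqP => [<- <-|E <-]; first by left; split => //; rewrite addn1.
  by right; split => //; rewrite addn0.
case=> [[<-]|[/eqP/negbTE ->]]; last by rewrite addn0.
by rewrite eqxx addn1; case: k => // k ->.
Qed.

Lemma measurable_all_eq (F : coins -> J -> nat) (k : J -> nat) :
  (forall i n, measurable [set w | F w i = n]) -> measurable [set w | forall i, F w i = k i].
Proof.
move=> mF; rewrite (_ : mkset _ = \bigcap_(i in [set: J]) [set w | F w i = k i]).
  by apply: fin_bigcap_measurable => // i _; exact: mF.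
by apply/seteqP; split=> [w H i _|w H i]; exact: H.
Qed.

Lemma hits_depends (A : set I) j L :
  (forall l, (l < L)%N -> A (inr (j, l))) ->
  depends_on (sources A) (fun w i => num_hits j L i w).
Proof.
move=> AL w w' ww'; apply/funext => i; rewrite /num_hits.
apply: eq_in_count => l; rewrite mem_iota => /andP[_ lL].
by rewrite (depends_on_source (AL _ lL) (@dX j l) ww').
Qed.

Lemma depends_on_set (A : set nat) (Y : Type) (f : coins -> Y) (p : Y -> Prop) :
  depends_on A f -> depends_on A (fun w => asbool (p (f w))).
Proof. by move=> Af w w' /Af ->. Qed.

Lemma depends_on_indep_set (A B : set I) (YA YB : Type) (f : coins -> YA) (g : coins -> YB)
    (p : YA -> Prop) (q : YB -> Prop) :
  A `&` B = set0 -> depends_on (sources A) f -> depends_on (sources B) g ->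
  measurable [set w | p (f w)] -> measurable [set w | q (g w)] ->
  P ([set w | p (f w)] `&` [set w | q (g w)]) = (P [set w | p (f w)] * P [set w | q (g w)])%E.
Proof.
move=> AB Af Bg mp mq.
have E Z (h : coins -> Z) (r : Z -> Prop) : [set w | r (h w)] =
    (fun w => asbool (r (h w))) @^-1` [set true].
  by apply/seteqP; split=> w /= /asboolP.
have mE Z (h : coins -> Z) (r : Z -> Prop) : measurable [set w | r (h w)] ->
    measurable_fun setT (fun w => asbool (r (h w))).
  by move=> mr; apply: (measurable_fun_bool true); rewrite setTI -E.
rewrite (E _ f p) (E _ g q); apply: (depends_on_indep fairP (sourcesI AB)) => //.
- exact: (depends_on_set p Af).
- exact: (depends_on_set q Bg).
- exact: (mE _ f p mp).
- exact: (mE _ g q mq).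
Qed.

(** The multinomial law of [L] independent draws, by induction on the last draw:
    if it falls in category [i], the count [k i] drops by one, and the identity
    [(k + 1) * expo_weight a (k + 1) = a * expo_weight a k] collects the terms to
    the factor [\sum_i k i = L + 1]. *)
Lemma hits_law j L (k : J -> nat) : (\sum_i k i = L)%N ->
  P [set w | forall i, num_hits j L i w = k i] =
  (L`!%:R * \prod_i expo_weight (weight j i) (k i))%:E.
Proof.
elim: L k => [|L IH] k kL.
  have k0 i : k i = 0%N by apply/eqP; rewrite -leqn0 -kL (bigD1 i)//= leq_addr.
  rewrite (_ : mkset _ = setT); last by apply/seteqP; split=> // w _ i /=; rewrite k0.
  rewrite probability_setT fact0 mul1r big1// => i _.
  by rewrite k0 /expo_weight expr0 fact0 divr1.
pose A i := [set w | cat (X j L w) = i] `&` [set w | forall i', num_hits j L.+1 i' w = k i'].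
have -> : [set w | forall i, num_hits j L.+1 i w = k i] = \bigcup_i A i.
  by apply/seteqP; split=> [w H|w [i _ []]//]; exists (cat (X j L w)).
pose W := \prod_i expo_weight (weight j i) (k i).
rewrite (probability_finType (r := fun i => L`!%:R * (k i)%:R * W)).
- congr EFin; rewrite -mulr_suml -mulr_sumr -natr_sum kL factS natrM.
  by rewrite (mulrC L.+1%:R).
- move=> i; apply: measurableI; first exact: measurable_catX.
  by apply: measurable_all_eq => i' n; exact: measurable_num_hits.
- move=> i; case ki: (k i) => [|n].
    rewrite mulr0 mul0r (_ : A i = set0) ?measure0//.
    rewrite -subset0 => w [/= wi /(_ i)].
    by rewrite num_hitsS wi eqxx ki addn1.
  (* the counts before the last draw *)
  pose k' i' := if i' == i then n else k i'.
  have -> : A i = [set w | cat (X j L w) = i] `&` [set w | forall i', num_hits j L i' w = k' i'].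
    apply/seteqP; split=> w [/= wi H]; split=> // i'; move: (H i').
      rewrite num_hitsS wi /k' eq_sym; case: eqP => [->|_]; last by rewrite addn0.
      by rewrite ki addn1 => -[].
    by rewrite num_hitsS wi /k' eq_sym; case: eqP => [<-|_] ->; rewrite ?addn0// ki addn1.
  have k'L : (\sum_i k' i = L)%N.
    apply: succn_inj; rewrite -kL (bigD1 i)//= [RHS](bigD1 i)//= ki /k' eqxx addSn.
    by congr (_ + _).+1; apply: eq_bigr => i' /negbTE ->.
  rewrite (@depends_on_indep_set [set inr (j, L)] [set x | exists2 l, (l < L)%N & x = inr (j, l)]
    _ _ (X j L) (fun w i => num_hits j L i w) (fun x => cat x = i) (fun h => forall i', h i' = k' i')).
  + rewrite [X in (X * _)%E](lX j L (mcat i)) weightE IH// -EFinM; congr EFin.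
    rewrite /W (bigD1 i)//= [in RHS](bigD1 i)//= ki.
    rewrite (eq_bigr (fun i' => expo_weight (weight j i') (k i'))); last first.
      by move=> i' /negbTE i'i; rewrite /k' i'i.
    set Q := \prod_(_ | _) _; rewrite {1}/k' eqxx.
    transitivity (L`!%:R * (weight j i * expo_weight (weight j i) n) * Q); first by ring.
    by rewrite -expo_weightS; ring.
  + rewrite -subset0 => x [/= -> [l lL [Ll]]].
    by rewrite Ll ltnn in lL.
  + by apply: (@depends_on_source _ _ (inr (j, L))) => //; exact: dX.
  + by apply: hits_depends => l lL; exists l.
  + exact: measurable_catX.
  + by apply: measurable_all_eq => i' m; exact: measurable_num_hits.
- by move=> f g w [/= <- _] [/= <- _].
Qed.

Definition cell_count j i w : nat := num_hits j (N j w) i w.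

Lemma measurable_N j k : measurable [set w | N j w = k].
Proof.
have mk : measurable [set k] by [].
by have := mN j measurableT mk; rewrite setTI.
Qed.

Lemma measurable_cell_count j i k : measurable [set w | cell_count j i w = k].
Proof.
rewrite (_ : mkset _ = \bigcup_n ([set w | N j w = n] `&` [set w | num_hits j n i w = k])).
  apply: bigcupT_measurable => n; apply: measurableI; first exact: measurable_N.
  exact: measurable_num_hits.
apply/seteqP; split=> [w H|w [n _ [/= Nw <-]]]; first by exists (N j w).
by rewrite /cell_count Nw.
Qed.

Lemma cell_count_depends (A : set I) j :
  A (inl j) -> (forall l, A (inr (j, l))) ->
  depends_on (sources A) (fun w i => cell_count j i w).
Proof.
move=> Aj Al w w' ww'; apply/funext => i; rewrite /cell_count.
rewrite (depends_on_source Aj (@dN j) ww').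
exact: (congr1 (@^~ i) (hits_depends (fun l _ => Al l) ww')).
Qed.

(** Thinning: the number of draws is determined by the counts, and the factor
    [exp (- theta)] distributes over the categories because their probabilities
    add up to one. *)
Lemma cell_count_law j (k : J -> nat) :
  P [set w | forall i, cell_count j i w = k i] =
  (\prod_i poisson_weight (theta * weight j i) (k i))%:E.
Proof.
pose L := (\sum_i k i)%N.
have -> : [set w | forall i, cell_count j i w = k i] =
    [set w | N j w = L] `&` [set w | forall i, num_hits j L i w = k i].
  apply/seteqP; split=> w /=.
    move=> H; suff NL : N j w = L by split=> // i; rewrite -NL; exact: H.
    by rewrite -(sum_num_hits j (N j w) w); apply: eq_bigr => i _; exact: H.
  by move=> [NL H] i; rewrite /cell_count NL.
rewrite (@depends_on_indep_set [set inl j] [set x | exists2 l, (l < L)%N & x = inr (j, l)]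
    _ _ (N j) (fun w i => num_hits j L i w) (fun x => x = L) (fun h => forall i', h i' = k i')).
- rewrite lN hits_law// -EFinM; congr EFin.
  under [RHS]eq_bigr do rewrite /poisson_weight /expo_weight exprMn.
  rewrite [RHS]big_split/= -expR_sum sumrN -mulr_sumr sum_weight mulr1 /poisson_weight -mulrA.
  congr (_ * _); rewrite /expo_weight -mulrA mulKf ?pnatr_eq0 -?lt0n ?fact_gt0//.
  under [RHS]eq_bigr do rewrite -mulrA.
  by rewrite [RHS]big_split/= prodrXr.
- by rewrite -subset0 => x [/= -> [l lL]].
- by apply: (@depends_on_source _ _ (inl j)) => //; exact: dN.
- by apply: hits_depends => l lL; exists l.
- exact: measurable_N.
- by apply: measurable_all_eq => i' m; exact: measurable_num_hits.
Qed.

Definition total_count M i w : nat := (\sum_(j < M) cell_count j i w)%N.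

Lemma measurable_total_count M i k : measurable [set w | total_count M i w = k].
Proof.
elim: M k => [|M IH] k.
  rewrite /total_count; under eq_fun do rewrite big_ord0.
  by case: k => [|k]; [rewrite (_ : mkset _ = setT)|rewrite (_ : mkset _ = set0)] => //; apply/seteqP; split.
rewrite (_ : mkset _ = \bigcup_n ([set w | cell_count M i w = n] `&`
    (if (n <= k)%N then [set w | total_count M i w = k - n]%N else set0))).
  apply: bigcupT_measurable => n; apply: measurableI; first exact: measurable_cell_count.
  by case: ifP.
apply/seteqP; split=> [w /= H|w [n _ [/= Nw]]].
  exists (cell_count M i w) => //; split => //.
  by move: H; rewrite /total_count big_ord_recr/= => <-; rewrite leq_addl addnK.
by case: ifP => // nk /= H; rewrite /total_count big_ord_recr/= -/(total_count M i w) H Nw subnK.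
Qed.

(** The cells are independent and Poisson parameters add ([poisson_weightD]); the
    convolution is taken for all categories at once by exchanging the product
    over the categories with the sum over the ways to split the counts. *)
Lemma total_count_law M (k : J -> nat) :
  P [set w | forall i, total_count M i w = k i] =
  (\prod_i poisson_weight (theta * \sum_(j < M) weight j i) (k i))%:E.
Proof.
elim: M k => [|M IH] k.
  have [k0|k0] := pselect (forall i, k i = 0%N).
    rewrite (_ : mkset _ = setT); last first.
      by apply/seteqP; split=> // w _ i; rewrite /total_count big_ord0 k0.
    rewrite probability_setT big1// => i _; rewrite big_ord0 mulr0 k0.
    by rewrite /poisson_weight /expo_weight oppr0 expR0 expr0 fact0 divr1 mul1r.
  have [i /eqP ki] : exists i, k i <> 0%N by apply/existsNP.
  rewrite (_ : mkset _ = set0) ?measure0; last first.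
    by rewrite -subset0 => w /(_ i); rewrite /total_count big_ord0 => /esym/eqP; exact/negP.
  rewrite (bigD1 i)//= big_ord0 mulr0 /poisson_weight /expo_weight.
  by rewrite expr0n (negbTE ki) !mul0r mulr0 mul0r.
pose K := (\sum_i k i)%N.
have kK i : (k i <= K)%N by rewrite /K (bigD1 i)//= leq_addr.
pose A (f : {ffun J -> 'I_K.+1}) := [set w | forall i, cell_count M i w = f i] `&`
  [set w | forall i, total_count M.+1 i w = k i].
have -> : [set w | forall i, total_count M.+1 i w = k i] = \bigcup_f A f.
  apply/seteqP; split=> [w H|w [f _ []]//].
  have cK i : (cell_count M i w < K.+1)%N.
    by rewrite ltnS (leq_trans _ (kK i))// -H /total_count big_ord_recr/= leq_addl.
  exists [ffun i => Ordinal (cK i)] => //; split => // i; by rewrite ffunE.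
rewrite (probability_finType (r := fun f : {ffun J -> 'I_K.+1} => if [forall i, (f i <= k i)%N] then
  \prod_i (poisson_weight (theta * \sum_(j < M) weight j i) (k i - f i) *
           poisson_weight (theta * weight M i) (f i)) else 0)).
- congr EFin; rewrite -big_mkcond/=.
  pose F i (j : nat) := poisson_weight (theta * \sum_(j < M) weight j i) (k i - j) *
    poisson_weight (theta * weight M i) j.
  under [RHS]eq_bigr => i _.
    rewrite big_ord_recr/= mulrDr poisson_weightD.
    rewrite -/(F i) (@big_ord_widen _ _ _ (k i).+1 K.+1 (F i) (kK i)).
    over.
  rewrite [RHS](bigA_distr_big_dep (fun i (j : 'I_K.+1) => (j < (k i).+1)%N) (fun i (j : 'I_K.+1) => F i j)).
  apply: eq_bigl => f; apply/forallP/familyP => H i; move: (H i);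
    by rewrite unfold_in ltnS.
- move=> f; apply: measurableI.
    by apply: measurable_all_eq => i m; exact: measurable_cell_count.
  by apply: measurable_all_eq => i m; exact: measurable_total_count.
- move=> f; case: ifPn => [/forallP fk|/forallPn[i fk]]; last first.
    rewrite (_ : A f = set0) ?measure0//; rewrite -subset0 => w [/= wi /(_ i)].
    rewrite /total_count big_ord_recr/= wi => H; move: fk.
    by rewrite -H leq_addl.
  have -> : A f = [set w | forall i, cell_count M i w = f i] `&`
      [set w | forall i, total_count M i w = k i - f i]%N.
    apply/seteqP; split=> w [/= wi H]; split=> // i; move: (H i).
      by rewrite /total_count big_ord_recr/= wi => <-; rewrite addnK.
    by rewrite /total_count [in X in _ -> X]big_ord_recr/= wi => ->; rewrite subnK.
  rewrite (@depends_on_indep_set [set x | x = inl M \/ exists l, x = inr (M, l)]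
     [set x | exists2 j, (j < M)%N & (x = inl j \/ exists l, x = inr (j, l))]
    _ _ (fun w i => cell_count M i w) (fun w i => total_count M i w)
    (fun h => forall i, h i = f i) (fun h => forall i, h i = k i - f i)%N).
  + by rewrite cell_count_law IH -EFinM -big_split/=; congr EFin; apply: eq_bigr => i _; rewrite mulrC.
  + rewrite -subset0 => x [/= [->|[l ->]] [j jM]] [].
    * by move=> [Mj]; rewrite Mj ltnn in jM.
    * by case.
    * by [].
    * by move=> [l' [Mj]]; rewrite Mj ltnn in jM.
  + by apply: cell_count_depends => [|l]; [left|right; exists l].
  + move=> w w' ww'; apply/funext => i; rewrite /total_count; apply: eq_bigr => j _.
    refine (congr1 (@^~ i) (@cell_count_depends _ j _ _ w w' ww')).
      by exists j => //; left.
    by move=> l; exists j => //; right; exists l.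
  + by apply: measurable_all_eq => i m; exact: measurable_cell_count.
  + by apply: measurable_all_eq => i m; exact: measurable_total_count.
- by move=> f g w [/= Hf _] [/= Hg _]; apply/ffunP => i; apply: val_inj; rewrite /= -Hf -Hg.
Qed.

End categories.
Definition drawn M w : seq T := [seq X j l w | j <- iota 0 M, l <- iota 0 (N j w)].

Lemma total_count_points (J : finType) (cat : T -> J) M i w :
  total_count cat M i w = count (fun x => cat x == i) (drawn M w).
Proof.
elim: M => [|M IH]; first by rewrite /total_count big_ord0.
rewrite /total_count big_ord_recr/= -/(total_count cat M i w) IH.
rewrite /drawn -addn1 iotaD map_cat flatten_cat count_cat add0n /= cats0 count_map.
by congr addn; exact: eq_count.
Qed.

Section categories_limit.
Context {J : finType} (cat : T -> J).
Hypothesis mcat : forall i, measurable (cat @^-1` [set i]).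

Definition mean M i : R := theta * \sum_(j < M) weight cat j i.

Lemma measurable_total_le M i t : measurable [set w | (total_count cat M i w <= t)%N].
Proof.
rewrite (_ : mkset _ = \bigcup_(k in [set k | (k <= t)%N]) [set w | total_count cat M i w = k]).
  by apply: bigcup_measurable => k _; exact: measurable_total_count.
by apply/seteqP; split=> [w H|w [k kt /= ->]//]; exists (total_count cat M i w).
Qed.

Lemma measurable_total_le_cond (Q : pred J) M t :
  measurable [set w | forall i, Q i -> (total_count cat M i w <= t i)%N].
Proof.
rewrite (_ : mkset _ = \bigcap_(i in [set i | Q i]) [set w | (total_count cat M i w <= t i)%N]).
  apply: fin_bigcap_measurable => [|i _]; last exact: measurable_total_le.
  exact: finite_finset.
by apply/seteqP; split=> [w H i|w H i]; exact: H.
Qed.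

Lemma total_le_law M (t : J -> nat) :
  P [set w | forall i, (total_count cat M i w <= t i)%N] =
  (\prod_i poisson_cdf (mean M i) (t i))%:E.
Proof.
pose K := (\sum_i t i)%N.
have tK i : (t i <= K)%N by rewrite /K (bigD1 i)//= leq_addr.
pose A (f : {ffun J -> 'I_K.+1}) := if [forall i, (f i <= t i)%N] then
  [set w | forall i, total_count cat M i w = f i] else set0.
have -> : [set w | forall i, (total_count cat M i w <= t i)%N] = \bigcup_f A f.
  apply/seteqP; split=> [w H|w [f _]].
    have cK i : (total_count cat M i w < K.+1)%N by rewrite ltnS (leq_trans (H i)).
    exists [ffun i => Ordinal (cK i)] => //; rewrite /A ifT; first by move=> i; rewrite ffunE.
    by apply/forallP => i; rewrite ffunE; exact: H.
  by rewrite /A; case: ifPn => // /forallP ft H i; rewrite H.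
rewrite (probability_finType (r := fun f : {ffun J -> 'I_K.+1} =>
  if [forall i, (f i <= t i)%N] then \prod_i poisson_weight (mean M i) (f i) else 0)).
- congr EFin; rewrite -big_mkcond/=.
  pose F i (j : nat) := poisson_weight (mean M i) j.
  under [RHS]eq_bigr => i _.
    rewrite /poisson_cdf -/(F i) (@big_ord_widen _ _ _ (t i).+1 K.+1 (F i) (tK i)).
    over.
  rewrite [RHS](bigA_distr_big_dep (fun i (j : 'I_K.+1) => (j < (t i).+1)%N) (fun i (j : 'I_K.+1) => F i j)).
  apply: eq_bigl => f; apply/forallP/familyP => H i; move: (H i);
    by rewrite unfold_in ltnS.
- move=> f; rewrite /A; case: ifP => // _.
  by apply: measurable_all_eq => i m; exact: measurable_total_count.
- by move=> f; rewrite /A; case: ifP => _; rewrite ?measure0// total_count_law.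
- move=> f g w; rewrite /A; case: ifP => // _ Hf; case: ifP => // _ Hg.
  by apply/ffunP => i; apply: val_inj; rewrite /= -Hf -Hg.
Qed.

(** The categories outside [Q] are released by letting their bounds tend to
    infinity. *)
Lemma total_le_law_cond (Q : pred J) M (t : J -> nat) :
  P [set w | forall i, Q i -> (total_count cat M i w <= t i)%N] =
  (\prod_(i | Q i) poisson_cdf (mean M i) (t i))%:E.
Proof.
(* outside [Q] the bound is [K], and [K] tends to infinity *)
pose t' K i := if Q i then t i else K.
pose F K := [set w | forall i, (total_count cat M i w <= t' K i)%N].
have mF K : measurable (F K).
  have := @measurable_total_le_cond predT M (t' K).
  by congr measurable; apply/seteqP; split=> w H i; [|move=> _]; exact: H.
have UF : \bigcup_K F K = [set w | forall i, Q i -> (total_count cat M i w <= t i)%N].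
  apply/seteqP; split=> [w [K _ H] i Qi|w H].
    by have := H i; rewrite /t' Qi.
  exists (\sum_i total_count cat M i w)%N => // i; rewrite /t'; case: ifPn => [|_]; first exact: H.
  by rewrite (bigD1 i)//= leq_addr.
have mUF : measurable (\bigcup_K F K) by exact: bigcupT_measurable.
have ndF : nondecreasing_seq F.
  move=> K L KL; apply/subsetPset => w H i; apply: (leq_trans (H i)).
  by rewrite /t'; case: ifP.
have C : P (F K) @[K --> \oo] --> P (\bigcup_K F K).
  exact: nondecreasing_cvg_mu.
rewrite UF in C.
rewrite -(cvg_lim _ C)//; apply/cvg_lim => //.
under eq_cvg do rewrite /= total_le_law.
apply: cvg_EFin; first exact: nearW.
rewrite [X in _ --> X](_ : _ = \prod_i (if Q i then poisson_cdf (mean M i) (t i) else 1)); last first.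
  by rewrite big_mkcond.
apply: cvg_bigprod => i _; rewrite /t' /=; case: ifP => _; first exact: cvg_cst.
exact: cvg_poisson_cdf1.
Qed.

(** The counts increase with the number of cells, so a bound on all of them is a
    decreasing limit of events. *)
Lemma limit_le_law (Q : pred J) (t : J -> nat) (g : J -> R) :
  (forall i, Q i -> (fun M => poisson_cdf (mean M i) (t i)) @ \oo --> g i) ->
  P [set w | forall i, Q i -> forall M, (total_count cat M i w <= t i)%N] =
  (\prod_(i | Q i) g i)%:E.
Proof.
move=> cg; pose F M := [set w | forall i, Q i -> (total_count cat M i w <= t i)%N].
have mF M : measurable (F M) by exact: measurable_total_le_cond.
have UF : \bigcap_M F M = [set w | forall i, Q i -> forall M, (total_count cat M i w <= t i)%N].
  by apply/seteqP; split=> [w H i Qi M|w H M _ i Qi]; exact: H.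
have mUF : measurable (\bigcap_M F M) by exact: bigcapT_measurable.
have niF : nonincreasing_seq F.
  move=> K L KL; apply/subsetPset => w H i Qi; apply: (leq_trans _ (H i Qi)).
  rewrite /total_count (@big_ord_widen _ _ _ K L (fun j => cell_count cat j i w) KL).
  by rewrite [leqRHS](bigID (fun j : 'I_L => (j < K)%N))/= leq_addr.
have F0 : (P (F 0%N) < +oo)%E by rewrite -ge0_fin_numE ?fin_num_measure.
have C : P (F M) @[M --> \oo] --> P (\bigcap_M F M).
  exact: nonincreasing_cvg_mu.
rewrite UF in C.
rewrite -(cvg_lim _ C)//; apply/cvg_lim => //.
under eq_cvg do rewrite /= total_le_law_cond.
apply: cvg_EFin; first exact: nearW.
by apply: cvg_bigprod => i Qi; exact: cg.
Qed.

End categories_limit.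
End poisson_counts.

Section counting.
Context {T : choiceType} {R : realType}.
Implicit Types A : set T.

(** Bounding the lengths of duplicate-free lists avoids the case distinction between
    finite and infinite sets. *)
Lemma counting_leP A t : (@counting T R A <= t%:R%:E)%E <->
  forall s : seq T, uniq s -> (forall x, x \in s -> A x) -> (size s <= t)%N.
Proof.
rewrite /counting; case: asboolP => finA; last first.
  split=> [|H]; first by rewrite leye_eq.
  have [B BA Bt] := infinite_set_fset t.+1 finA.
  have := H (enum_fset B) (fset_uniq B) (fun x xB => BA x xB).
  by rewrite leqNgt (leq_trans _ Bt).
rewrite lee_fin ler_nat; split=> [At s us sA|H].
  apply: (leq_trans _ At); apply: uniq_leq_size => // x xs.
  by rewrite in_fset_set// inE; exact: sA.
by apply: H => // x; rewrite in_fset_set// inE.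
Qed.

Lemma counting_le_real A (r : R) : 0 <= r ->
  (@counting T R A <= r%:E)%E = (@counting T R A <= (Num.truncn r)%:R%:E)%E.
Proof.
move=> r0; rewrite /counting; case: asboolP => finA; last by rewrite !leye_eq.
by rewrite !lee_fin ler_nat truncn_ge_nat.
Qed.

Lemma counting_nat A : @counting T R A = +oo%E \/ exists k : nat, @counting T R A = k%:R%:E.
Proof. by rewrite /counting; case: asboolP => finA; [right; eexists|left]. Qed.

End counting.

(** * From joint counts to a Poisson process *)

Section rays.
Context {d : measure_display} {Om : measurableType d} {R : realType} (P : probability Om R).

Lemma indep_setC (E B : set Om) : measurable E -> measurable B ->
  P (E `&` B) = (P E * P B)%E -> P (E `&` ~` B) = (P E * P (~` B))%E.
Proof.
move=> mE mB EB.
have -> : (P (E `&` ~` B) = P E - P (E `&` B))%E.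
  by rewrite -setDE; apply: measureD => //; rewrite -ge0_fin_numE ?fin_num_measure.
rewrite EB probability_setC// muleBr ?mule1//; first exact: fin_num_measure.
Qed.

(** Rays form a pi-system that generates the Borel sets, and an integer variable is
    below a real bound exactly when it is below its integer part. *)
Lemma indep_of_rays (E : set Om) (C : Om -> \bar R) : measurable E ->
  measurable_fun setT C ->
  (forall w, C w = +oo%E \/ exists k : nat, C w = k%:R%:E) ->
  (forall t : nat, P (E `&` [set w | C w <= t%:R%:E]%E) =
    (P E * P [set w | C w <= t%:R%:E]%E)%E) ->
  forall A, measurable A -> P (E `&` C @^-1` A) = (P E * P (C @^-1` A))%E.
Proof.
move=> mE mC Cnat EC A mA.
have mpre B : measurable B -> measurable (C @^-1` B).
  by move=> mB; rewrite -[X in measurable X]setTI; exact: mC.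
apply: (@dynkin_induction _ _ (@ErealGenOInfty.G R)
  (fun A => P (E `&` C @^-1` A) = (P E * P (C @^-1` A))%E)) => //.
- exact: ErealGenOInfty.measurableE.
- move=> _ _ [r ->] [s ->]; exists (Order.max r s).
  apply/seteqP; split=> x /=; rewrite !in_itv/= !andbT EFin_max gt_max; first by case=> -> ->.
  by move=> /andP[].
- by rewrite preimage_setT setIT probability_setT mule1.
- move=> _ [r ->].
  have [r0|r0] := ltP r 0.
    rewrite (_ : C @^-1` _ = setT) ?setIT ?probability_setT ?mule1//.
    apply/seteqP; split=> // w _ /=; rewrite in_itv/= andbT.
    by have [->|[k ->]] := Cnat w; rewrite ?ltry// lte_fin (lt_le_trans r0).
  rewrite (_ : C @^-1` _ = ~` [set w | C w <= (Num.truncn r)%:R%:E]%E).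
    apply: indep_setC => //; have := mpre `]-oo, (Num.truncn r)%:R%:E]%classic.
    rewrite (_ : _ @^-1` _ = [set w | C w <= (Num.truncn r)%:R%:E]%E); last first.
      by apply/seteqP; split=> w /=; rewrite in_itv.
    by apply; exact: emeasurable_itv.
  apply/seteqP; split=> w /=; rewrite in_itv/= andbT => H.
    apply/negP; rewrite -ltNge (le_lt_trans _ H)// lee_fin truncn_le//.
  rewrite ltNge; apply/negP => Cr; apply: H; move: Cr.
  by have [->|[k ->]] := Cnat w; rewrite ?leye_eq// !lee_fin ler_nat truncn_ge_nat.
- by move=> B mB /(indep_setC mE (mpre _ mB)); rewrite -preimage_setC.
- move=> F mF tF HF; rewrite preimage_bigcup setI_bigcupr.
  rewrite measure_bigcup//=; last 2 first.
  + by move=> i _; apply: measurableI => //; exact: mpre.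
  + by move=> i j _ _ [w [[_ Fi] [_ Fj]]]; apply: tF => //; exists (C w).
  rewrite measure_bigcup//=; last 2 first.
  + by move=> i _; exact: mpre.
  + by move=> i j _ _ [w [Fi Fj]]; apply: tF => //; exists (C w).
  have PEf : (fine (P E))%:E = P E by rewrite fineK// fin_num_measure.
  rewrite -PEf -nneseriesZl//; apply: eq_eseriesr => i _.
  by rewrite PEf; exact: HF.
- by have <- : @measurable _ (\bar R) = <<s @ErealGenOInfty.G R >> := ErealGenOInfty.measurableE R.
Qed.

(** The rays are replaced by Borel sets one variable at a time with
    [indep_of_rays]; the event [E n Q t] of the proof has its first [n] conditions
    replaced. *)
Lemma indep_of_joint_rays (m : nat) (C : 'I_m -> Om -> \bar R) :
  (forall i, measurable_fun setT (C i)) ->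
  (forall i w, C i w = +oo%E \/ exists k : nat, C i w = k%:R%:E) ->
  (forall (Q : pred 'I_m) (t : 'I_m -> nat),
    P [set w | forall i, Q i -> (C i w <= (t i)%:R%:E)%E] =
    (\prod_(i | Q i) P [set w | C i w <= (t i)%:R%:E])%E) ->
  forall A : 'I_m -> set (\bar R), (forall i, measurable (A i)) ->
  P (\bigcap_i (C i @^-1` A i)) = (\prod_(i < m) P (C i @^-1` A i))%E.
Proof.
move=> mC Cnat joint A mA.
have mpre i B : measurable B -> measurable (C i @^-1` B).
  by move=> mB; rewrite -[X in measurable X]setTI; exact: mC.
have mle i (t : nat) : measurable [set w | C i w <= t%:R%:E]%E.
  have := mpre i `]-oo, t%:R%:E]%classic.
  rewrite (_ : _ @^-1` _ = [set w | C i w <= t%:R%:E]%E); last first.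
    by apply/seteqP; split=> w /=; rewrite in_itv.
  by apply; exact: emeasurable_itv.
pose E (n : nat) (Q : pred 'I_m) (t : 'I_m -> nat) := [set w |
  forall i : 'I_m, if (i < n)%N then A i (C i w) else Q i -> (C i w <= (t i)%:R%:E)%E].
have mE n Q t : measurable (E n Q t).
  rewrite (_ : E n Q t = \bigcap_(i in [set: 'I_m]) (if (i < n)%N then C i @^-1` A i else
     if Q i then [set w | C i w <= (t i)%:R%:E]%E else setT)).
    apply: fin_bigcap_measurable => [|i _]; first exact: finite_finset.
    by case: ifP => _; [exact: mpre|case: ifP].
  apply/seteqP; split=> [w H i _|w H i].
    by move: (H i); case: ifPn => _ //; case: (Q i) => //= h; exact: h.
  by move: (H i I); case: ifPn => _ //; case: (Q i) => //= h _.
have H n : (n <= m)%N -> forall Q t, P (E n Q t) =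
  (\prod_(i < m) if (i < n)%N then P (C i @^-1` A i) else
    if Q i then P [set w | C i w <= (t i)%:R%:E] else 1)%E.
  elim: n => [_ Q t|n IH nm Q t].
    by rewrite /E/= joint big_mkcond.
  pose i0 := Ordinal nm.
  pose Q0 := fun i => (i != i0) && Q i; pose Q1 := fun i => (i == i0) || Q i.
  have lt_ne (i : 'I_m) : i != i0 -> (i < n.+1)%N = (i < n)%N.
    move=> ii0; rewrite ltnS leq_eqVlt; case: eqP => // ni.
    by move: ii0; rewrite -(inj_eq val_inj) /= ni eqxx.
  have E0 (B : set (\bar R)) : E n Q0 t `&` C i0 @^-1` B =
     [set w | B (C i0 w) /\ forall i, i != i0 -> if (i < n)%N then A i (C i w) else Q i -> (C i w <= (t i)%:R%:E)%E].
    apply/seteqP; split=> [w [/= H B0]|w [/= B0 H]]; split=> // i.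
      by move=> ii0; move: (H i); rewrite /Q0 ii0.
    have [->|ii0] := eqVneq i i0; first by rewrite ltnn /Q0 eqxx.
    by move: (H i ii0); rewrite /Q0 ii0.
  have Eall : E n.+1 Q t = E n Q0 t `&` C i0 @^-1` A i0.
    rewrite E0; apply/seteqP; split=> [w H|w [A0 H] i].
      split; first by move: (H i0); rewrite /= ltnS leqnn.
      by move=> i ii0; move: (H i); rewrite lt_ne.
    have [->|ii0] := eqVneq i i0; first by rewrite /= ltnS leqnn.
    by move: (H i ii0); rewrite lt_ne.
  have IH0 := IH (ltnW nm) Q0 t.
  have key (r : nat) : P (E n Q0 t `&` [set w | C i0 w <= r%:R%:E]%E) =
      (P (E n Q0 t) * P [set w | C i0 w <= r%:R%:E]%E)%E.
    pose t' := fun i => if i == i0 then r else t i.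
    have -> : E n Q0 t `&` [set w | C i0 w <= r%:R%:E]%E = E n Q1 t'.
      rewrite -[X in E n Q0 t `&` X]/(C i0 @^-1` [set x | x <= r%:R%:E]%E) E0.
      apply/seteqP; split=> [w [A0 H] i|w H].
        have [->|ii0] := eqVneq i i0; first by rewrite ltnn /t' eqxx.
        by move: (H i ii0); rewrite /Q1 /t' (negbTE ii0).
      split; first by move: (H i0); rewrite ltnn /t' /Q1 eqxx; exact.
      by move=> i ii0; move: (H i); rewrite /Q1 /t' (negbTE ii0).
    rewrite IH0 (IH (ltnW nm)) (bigD1 i0)//= [in RHS](bigD1 i0)//= ltnn /Q0 /Q1 /t' eqxx /= mul1e muleC.
    by congr (_ * _)%E; apply: eq_bigr => i /negbTE ->.
  rewrite Eall (indep_of_rays (mE n Q0 t) (mC i0) (Cnat i0) key (mA i0)) IH0.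
  rewrite (bigD1 i0)//= [in RHS](bigD1 i0)//= ltnn /Q0 eqxx /= mul1e ltnS leqnn muleC.
  congr (_ * _)%E; apply: eq_bigr => i ii0; by rewrite ii0 lt_ne.
have := H m (leqnn m) xpred0 (fun=> 0%N); rewrite (_ : E _ _ _ = \bigcap_i (C i @^-1` A i)).
  by move=> ->; apply: eq_bigr => i _; rewrite ltn_ord.
apply/seteqP; split=> [w Hw i _|w Hw i]; first by move: (Hw i); rewrite ltn_ord.
by rewrite ltn_ord; exact: (Hw i).
Qed.

End rays.

Section poisson_process.
Context {R : realType} (P : probability coins R) (fairP : fair P).
Context {d : measure_display} {T : measurableType d}.
Variables (theta : R) (mu : nat -> probability T R).
Local Notation I := (nat + nat * nat)%type.
Variable S : I -> set nat.
Hypothesis SI : forall i j, i <> j -> S i `&` S j = set0.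
Variables (N : nat -> coins -> nat) (X : nat -> nat -> coins -> T).
Hypothesis mN : forall j, measurable_fun setT (N j).
Hypothesis dN : forall j, depends_on (S (inl j)) (N j).
Hypothesis lN : forall j k, P [set w | N j w = k] = (poisson_weight theta k)%:E.
Hypothesis mX : forall j l, measurable_fun setT (X j l).
Hypothesis dX : forall j l, depends_on (S (inr (j, l))) (X j l).
Hypothesis lX : forall j l B, measurable B -> P (X j l @^-1` B) = mu j B.
Variable bad : set coins.
Hypothesis mbad : measurable bad.
Hypothesis Pbad : P bad = 0%E.
Hypothesis good_inj : forall w, ~ bad w -> forall j l j' l',
  X j l w = X j' l' w -> (j, l) = (j', l').
Variable Lam : set T -> \bar R.
Hypothesis theta0 : 0 <= theta.
Hypothesis LamE : forall B, measurable B -> Lam B = (\sum_(j <oo) (theta%:E * mu j B))%E.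

(** The exceptional event [bad] is removed so that, for every outcome, distinct
    labels give distinct points; the counts of labels then are counts of points. *)
Definition scattered w : set T :=
  [set x | ~ bad w /\ exists j l, (l < N j w)%N /\ x = X j l w].

Local Notation count B w := (@point_count _ _ T coins R scattered B w).

Lemma uniq_points M w : ~ bad w -> uniq (drawn N X M w).
Proof.
move=> /good_inj inj; apply: allpairs_uniq_dep; rewrite ?iota_uniq//.
  by move=> j _; exact: iota_uniq.
by move=> [j l] [j' l'] _ _ /= /inj [-> ->].
Qed.

Lemma point_countP (J : finType) (cat : T -> J) i t w : ~ bad w ->
  (count (cat @^-1` [set i]) w <= t%:R%:E)%E <->
  forall M, (total_count N X cat M i w <= t)%N.
Proof.
move=> bw; rewrite /point_count counting_leP; split=> [H M|H s us sB].
  rewrite total_count_points -size_filter; apply: H.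
    by apply: filter_uniq; exact: uniq_points.
  move=> x; rewrite mem_filter => /andP[/eqP xi /allpairsPdep[j [l []]]].
  rewrite mem_iota => _; rewrite mem_iota => /andP[_ lN'] xE.
  by split => //; split => //; exists j, l; rewrite xE.
have [M Ms] : exists M, forall x, x \in s -> x \in drawn N X M w.
  elim: s sB {us H} => [|x s IH] sB; first by exists 0%N.
  have [M Ms] : exists M, forall x, x \in s -> x \in drawn N X M w.
    by apply: IH => y ys; apply: sB; rewrite inE ys orbT.
  have [[_ [j [l [lNj xE]]]] _] := sB x (mem_head _ _).
  exists (maxn M j.+1) => y; rewrite inE => /predU1P[->|/Ms].
    apply/allpairsPdep; exists j, l; split => //; rewrite mem_iota//=.
    by rewrite add0n leq_max ltnSn orbT.
  move=> /allpairsPdep[j' [l' [+ l'N yE]]]; rewrite mem_iota => /andP[_ j'M].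
  apply/allpairsPdep; exists j', l'; split => //; rewrite mem_iota/=.
  by move: j'M; rewrite !add0n leq_max => ->.
apply: leq_trans (H M); rewrite total_count_points -size_filter.
apply: uniq_leq_size => // x xs; rewrite mem_filter Ms// andbT.
by have [_ ->] := sB _ xs.
Qed.

Lemma point_count_bad B w : bad w -> count B w = 0%E.
Proof.
move=> bw; rewrite /point_count (_ : _ `&` _ = set0) ?measure0//.
by rewrite -subset0 => x [[]].
Qed.

Lemma bool_cat (B : set T) : B = (fun x => x \in B) @^-1` [set true].
Proof. by apply/seteqP; split=> x /=; [exact: mem_set|exact: set_mem]. Qed.

Lemma measurable_bool_cat (B : set T) : measurable B ->
  forall i, measurable ((fun x => x \in B) @^-1` [set i]).
Proof.
move=> mB [|]; first by rewrite -bool_cat.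
rewrite (_ : _ @^-1` _ = ~` B); first exact: measurableC.
apply/seteqP; split=> x /=; first by move=> xB Bx; move: xB; rewrite mem_set.
by move=> Bx; apply: memNset.
Qed.

Lemma measurable_point_count_le B (t : nat) : measurable B ->
  measurable [set w | count B w <= t%:R%:E]%E.
Proof.
move=> mB; have mcat := measurable_bool_cat mB.
rewrite (_ : mkset _ = bad `|` (~` bad `&` \bigcap_M
   [set w | (total_count N X (fun x => x \in B) M true w <= t)%N])).
  apply: measurableU => //; apply: measurableI; first exact: measurableC.
  by apply: bigcapT_measurable => M; exact: measurable_total_le.
apply/seteqP; split=> [w H|w [bw|[bw H]]].
- have [bw|bw] := pselect (bad w); [by left|right; split=> // M _].
  by move: M; apply/(point_countP (fun x => x \in B) true t bw); rewrite -bool_cat.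
- by rewrite /= point_count_bad// lee_fin.
- rewrite /= {1}(bool_cat B); apply/point_countP => // M; exact: (H M).
Qed.

Lemma measurable_point_count B : measurable B -> measurable_fun setT (point_count scattered B : coins -> \bar R).
Proof.
move=> mB; apply: (measurability (@ErealGenOInfty.G R)).
  exact: ErealGenOInfty.measurableE.
move=> _ [_ [r ->] <-]; rewrite setTI.
have [r0|r0] := ltP r 0.
  rewrite (_ : _ @^-1` _ = setT)//; apply/seteqP; split=> // w _ /=.
  rewrite in_itv/= andbT; have [|[k]] := @counting_nat T R (scattered w `&` B).
    by rewrite /point_count => ->; rewrite ltry.
  by rewrite /point_count => ->; rewrite lte_fin (lt_le_trans r0).
rewrite (_ : _ @^-1` _ = ~` [set w | count B w <= (Num.truncn r)%:R%:E]%E).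
  by apply: measurableC; exact: measurable_point_count_le.
apply/seteqP; split=> w /=; rewrite in_itv/= andbT ltNge /point_count (counting_le_real _ r0).
  by move/negP.
by move=> H; apply/negP.
Qed.

Lemma probability_off_bad (A B : set coins) : measurable A -> measurable B ->
  (forall w, ~ bad w -> A w <-> B w) -> P A = P B.
Proof.
have H C : measurable C -> P C = P (C `\` bad).
  move=> mC; transitivity (P (C `\` bad) + P (C `&` bad))%E.
    by rewrite -measureDI.
  by rewrite [X in (_ + X)%E](_ : _ = 0%E) ?adde0//; apply: (subset_measure0 _ _ _ Pbad) => //; exact: measurableI.
move=> mA mB AB; rewrite (H _ mA) (H _ mB); congr (P _).
by apply/seteqP; split=> w [Cw bw]; split => //; apply/(AB w).
Qed.

(** The distribution function of a Poisson variable of parameter [Lam B], which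
    vanishes when the parameter is infinite. *)
Definition limit_cdf (B : set T) t : R :=
  if Lam B is r%:E then poisson_cdf r t else 0.

Lemma Lam_ge0 B : measurable B -> (0 <= Lam B)%E.
Proof.
by move=> mB; rewrite LamE//; apply: nneseries_ge0 => j _ _; rewrite mule_ge0// lee_fin.
Qed.

Lemma cvg_mean (J : finType) (cat : T -> J) (mcat : forall i, measurable (cat @^-1` [set i])) i t :
  (fun M => poisson_cdf (mean theta mu cat M i) t) @ \oo --> limit_cdf (cat @^-1` [set i]) t.
Proof.
have C : (fun M => (mean theta mu cat M i)%:E) @ \oo --> Lam (cat @^-1` [set i]).
  rewrite LamE//.
  rewrite (_ : (fun M => _) = (fun M => \sum_(0 <= j < M) (theta%:E * mu j (cat @^-1` [set i])))%E).
    by apply: is_cvg_nneseries => j _ _; rewrite mule_ge0// lee_fin.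
  apply/funext => M; rewrite /mean big_mkord mulr_sumr -sumEFin; apply: eq_bigr => j _.
  by rewrite weightE// EFinM.
rewrite /limit_cdf; case: (Lam _) (Lam_ge0 (mcat i)) C => [r _|_|//].
- by move=> /fine_cvgP[_]; exact: cvg_poisson_cdf.
- by move=> /cvgeryP; exact: poisson_cdf_vanish.
Qed.

Lemma point_count_joint (J : finType) (cat : T -> J) (mcat : forall i, measurable (cat @^-1` [set i]))
  (Q : pred J) (t : J -> nat) :
  P [set w | forall i, Q i -> (count (cat @^-1` [set i]) w <= (t i)%:R%:E)%E] =
  (\prod_(i | Q i) limit_cdf (cat @^-1` [set i]) (t i))%:E.
Proof.
rewrite -(@limit_le_law R P fairP d T theta mu S SI N X mN dN lN mX dX lX J cat mcat Q t
  (fun i => limit_cdf (cat @^-1` [set i]) (t i))); last by move=> i _; exact: cvg_mean.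
apply: probability_off_bad.
- rewrite (_ : mkset _ = \bigcap_(i in [set i | Q i])
    [set w | (count (cat @^-1` [set i]) w <= (t i)%:R%:E)%E]).
    apply: fin_bigcap_measurable => [|i _]; first exact: finite_finset.
    exact: measurable_point_count_le.
  by apply/seteqP; split=> w H i; exact: H.
- rewrite (_ : mkset _ = \bigcap_M [set w | forall i, Q i -> (total_count N X cat M i w <= t i)%N]).
    by apply: bigcapT_measurable => M; exact: measurable_total_le_cond.
  by apply/seteqP; split=> [w H M _ i Qi|w H i Qi M]; exact: H.
- by move=> w bw; split=> H i Qi; move: (H i Qi) => /(point_countP _ _ _ bw).
Qed.

Lemma point_count_le_law B t : measurable B ->
  P [set w | count B w <= t%:R%:E]%E = (limit_cdf B t)%:E.
Proof.
move=> mB; have := point_count_joint (measurable_bool_cat mB) (pred1 true) (fun=> t).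
rewrite big_pred1_eq -bool_cat => <-; congr (P _); apply/seteqP; split=> w /=.
  by move=> H i /eqP ->; rewrite -bool_cat.
by move=> /(_ true isT); rewrite -bool_cat.
Qed.

(** A finite disjoint family of sets, together with the complement of its union,
    is a system of categories. The joint law of its counts below given bounds is a
    product by [point_count_joint], and this extends to all Borel sets of values
    by [indep_of_joint_rays]. *)
Theorem scattered_poisson : is_poisson_process P Lam scattered.
Proof.
have cnat B w : count B w = +oo%E \/ exists k : nat, count B w = k%:R%:E by exact: counting_nat.
split.
- exact: measurable_point_count.
- move=> B mB finL k.
  have [r Lr] : exists r, Lam B = r%:E by exists (fine (Lam B)); rewrite fineK.
  have r0 : 0 <= r by rewrite -lee_fin -Lr Lam_ge0.
  rewrite Lr/=; have -> : poisson_prob r 0 [set k] = (poisson_weight r k)%:E.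
    rewrite /poisson_prob /poisson_weight /expo_weight; case: ifPn => rp.
      rewrite esum_set1; last by rewrite lee_fin poisson_pmf_ge0.
      by rewrite /poisson_pmf rp mulrC mulrA.
    have -> : r = 0 by apply/eqP; rewrite eq_le r0 leNgt rp.
    rewrite diracE oppr0 expR0 mul1r expr0n; case: k => [|k]; first by rewrite mem_set// fact0 divr1.
    by rewrite memNset//= mul0r.
  have le_law t : P [set w | count B w <= t%:R%:E]%E = (poisson_cdf r t)%:E.
    by rewrite point_count_le_law// /limit_cdf Lr.
  case: k => [|k].
    rewrite (_ : mkset _ = [set w | count B w <= 0%:R%:E]%E).
      by rewrite le_law /poisson_cdf big_ord_recl big_ord0 addr0.
    apply/seteqP; split=> w /=; first by move=> ->.
    by have [->|[k ->]] := cnat B w; rewrite ?leye_eq// lee_fin ler_nat leqn0 => /eqP ->.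
  rewrite (_ : mkset _ = [set w | count B w <= k.+1%:R%:E]%E `\` [set w | count B w <= k%:R%:E]%E).
    have -> : (P ([set w | count B w <= k.+1%:R%:E] `\` [set w | count B w <= k%:R%:E]) =
      P [set w | count B w <= k.+1%:R%:E] - P [set w | count B w <= k%:R%:E])%E.
      rewrite -[X in (_ - P X)%E](_ : [set w | count B w <= k.+1%:R%:E]%E `&` [set w | count B w <= k%:R%:E]%E = _).
        apply: measureD; [exact: measurable_point_count_le|exact: measurable_point_count_le|].
        by rewrite -ge0_fin_numE ?fin_num_measure//; exact: measurable_point_count_le.
      by apply/setIidr => w /= /le_trans; apply; rewrite lee_fin ler_nat.
    by rewrite !le_law -EFinB /poisson_cdf [X in X - _]big_ord_recr/= addrAC subrr add0r.
  apply/seteqP; split=> w /=.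
    by move=> ->; rewrite !lee_fin !ler_nat leqnn ltnn.
  have [->|[l ->]] := cnat B w; first by rewrite leye_eq => -[].
  by rewrite !lee_fin !ler_nat => -[lk /negP]; rewrite -ltnNge => kl; congr (_%:R%:E); apply/eqP; rewrite eqn_leq lk.
- move=> B mB Ly.
  rewrite (_ : mkset _ = ~` \bigcup_(t in [set: nat]) [set w | count B w <= t%:R%:E]%E).
    have mU : measurable (\bigcup_(t in [set: nat]) [set w | count B w <= t%:R%:E]%E).
      by apply: bigcupT_measurable => t; exact: measurable_point_count_le.
    rewrite probability_setC// [X in (_ - X)%E](_ : _ = 0%E) ?sube0//.
    apply/eqP; rewrite eq_le measure_ge0 andbT.
    apply: (le_trans (measure_sigma_subadditive _ _ mU (@subset_refl _ _))).
      by move=> t; exact: measurable_point_count_le.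
    rewrite eseries0// => t _ _ /=.
    by have := point_count_le_law t mB; rewrite /limit_cdf Ly.
  apply/seteqP; split=> w /=; first by move=> H [t _ /=]; rewrite H leye_eq.
  by move=> H; have [//|[k ck]] := cnat B w; exfalso; apply: H; exists k => //=; rewrite ck.
- move=> m B mB dB A mA.
  apply: (indep_of_joint_rays (C := fun i => point_count scattered (B i))) => //.
    by move=> i; exact: measurable_point_count.
  move=> Q t; pose cat (x : T) : option 'I_m := [pick i | x \in B i].
  have catE i : cat @^-1` [set Some i] = B i.
    apply/seteqP; split=> x; rewrite /cat /=; first by case: pickP => // j /set_mem Bj [<-].
    move=> Bi; case: pickP => [j /set_mem Bj|/(_ i)]; last by rewrite mem_set.
    by congr Some; apply: dB => //; exists x.
  have mcat i : measurable (cat @^-1` [set i]).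
    case: i => [i|]; first by rewrite catE.
    rewrite (_ : _ @^-1` _ = ~` \bigcup_(i in [set: 'I_m]) B i).
      by apply: measurableC; apply: fin_bigcup_measurable => //; exact: finite_finset.
    apply/seteqP; split=> x; rewrite /cat /=; case: pickP => //.
      by move=> H _ [i _ Bi]; move: (H i); rewrite mem_set.
    by move=> i /set_mem Bi H; exfalso; apply: H; exists i.
  have := point_count_joint mcat (fun i => if i is Some i' then Q i' else false)
    (fun i => if i is Some i' then t i' else 0%N).
  rewrite (_ : mkset _ = [set w | forall i, Q i -> (count (B i) w <= (t i)%:R%:E)%E]); last first.
    apply/seteqP; split=> w H i; first by move=> Qi; have := H (Some i) Qi; rewrite catE.
    by case: i => // i Qi; rewrite catE; exact: H.
  move=> ->; rewrite (reindex_omap Some id) => [|[i|]//].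
  rewrite -prodEFin; apply: eq_big => [i|i Qi]; first by rewrite eqxx andbT.
  by rewrite catE point_count_le_law.
Qed.

End poisson_process.

(** * A marked Poisson process on a strip *)

(** Rectangles form a pi-system. *)
Lemma finite_measure_rectangle_unique {d1 d2} {T1 : measurableType d1} {T2 : measurableType d2}
    {R : realType} (m1 m2 : {measure set (T1 * T2) -> \bar R}) :
  (m1 setT < +oo)%E ->
  (forall A B, measurable A -> measurable B -> m1 (A `*` B) = m2 (A `*` B)) ->
  forall C, measurable C -> m1 C = m2 C.
Proof.
move=> m1T m12 C mC.
apply: (measure_unique [set A `*` B | A in measurable & B in measurable] (fun=> setT)) => //.
- exact: measurable_prod_measurableType.
- move=> _ _ [A mA [B mB <-]] [A' mA' [B' mB' <-]]; rewrite -setXI.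
  by exists (A `&` A'); [exact: measurableI|exists (B `&` B') => //; exact: measurableI].
- by move=> _; exists setT => //; exists setT => //; rewrite setXTT.
- by rewrite bigcup_const//; exists 0%N.
- by move=> _ [A mA [B mB <-]]; exact: m12.
Qed.

(** The restriction as a measure, so that it can be compared with other measures on
    product spaces. *)
Definition restricted_measure {d} {T : measurableType d} {R : realType}
  (mu : {measure set T -> \bar R}) (D : set T) (mD : measurable D) :
  {measure set T -> \bar R} := mrestr mu mD.

Lemma lebesgue_measure_translate {R : realType} (c : R) (A : set (measurableTypeR R)) :
  measurable A -> lebesgue_measure ((fun x : R => x + c) @^-1` A) = lebesgue_measure A :> \bar R.
Proof.
move=> mA; have mf : measurable_fun setT (fun x : measurableTypeR R => x + c : measurableTypeR R).
  exact: measurable_funD.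
pose m := measure_function_pushforward__canonical__measure_function_Measure
  (@lebesgue_measure R) mf.
apply/esym; apply: (lebesgue_measure_unique (mu := m)) mA => _ [[a b] _ <-].
rewrite /m /= /pushforward (_ : _ @^-1` _ = `]a - c, b - c]%classic); last first.
  by apply/seteqP; split=> x /=; rewrite !in_itv/= ltrBlDr lerBrDr.
rewrite !lebesgue_measure_itv/= !lte_fin ltrD2r; case: ifP => // _.
by rewrite -!EFinB; congr EFin; ring.
Qed.

Lemma unit_itv_translate {R : realType} (c : R) (A : set (measurableTypeR R)) :
  measurable A -> lebesgue_measure ((fun x : R => x + c) @^-1` A `&` `[0, 1[%classic) =
    lebesgue_measure (A `&` `[c, c + 1[%classic) :> \bar R.
Proof.
move=> mA; rewrite -(lebesgue_measure_translate c (measurableI _ _ mA (measurable_itv `[c, c + 1[))).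
rewrite preimage_setI; congr (lebesgue_measure (_ `&` _)).
by apply/seteqP; split=> x /=; rewrite !in_itv/= [x + c]addrC lerDl ltrD2l.
Qed.

Section independent_pairs.
Context {R : realType} (P : probability coins R) (fairP : fair P).
Context {d1 d2 : measure_display} {T1 : measurableType d1} {T2 : measurableType d2}.
Variables (S S' : set nat) (f : coins -> T1) (g : coins -> T2).
Hypothesis SS' : S `&` S' = set0.
Hypotheses (Sf : depends_on S f) (Sg : depends_on S' g).
Hypotheses (mf : measurable_fun setT f) (mg : measurable_fun setT g).

Lemma measurable_pair : measurable_fun setT (fun w => (f w, g w)).
Proof. exact: measurable_fun_pair. Qed.

Let mfE : {mfun coins >-> T1} := mfun_Sub (mem_set mf).
Let mgE : {mfun coins >-> T2} := mfun_Sub (mem_set mg).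

Lemma indep_pair_law D : measurable D ->
  P ((fun w => (f w, g w)) @^-1` D) = (distribution P mfE \x distribution P mgE)%E D.
Proof.
move=> mD; pose m := measure_function_pushforward__canonical__measure_function_Measure
  P measurable_pair.
apply/esym; apply: (product_measure_unique (m' := m)) mD => A B mA mB.
exact: (depends_on_indep fairP SS' Sf Sg mf mg mA mB).
Qed.

(** Fubini: a null set may be detected on the sections over the independent
    variable. *)
Lemma indep_pair_null D : measurable D ->
  (forall x, P (g @^-1` xsection D x) = 0%E) -> P ((fun w => (f w, g w)) @^-1` D) = 0%E.
Proof.
move=> mD D0; rewrite indep_pair_law// /product_measure1; apply: integral0_eq => x _.
exact: D0.
Qed.

Lemma indep_pair_rectangle (m : {measure set (T1 * T2) -> \bar R}) :
  (forall A B, measurable A -> measurable B ->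
    m (A `*` B) = (P (f @^-1` A) * P (g @^-1` B))%E) ->
  forall C, measurable C -> P ((fun w => (f w, g w)) @^-1` C) = m C.
Proof.
move=> mAB C mC; pose m1 := measure_function_pushforward__canonical__measure_function_Measure
  P measurable_pair.
apply: (finite_measure_rectangle_unique (m1 := m1)) mC.
  by rewrite /m1/= /pushforward preimage_setT (le_lt_trans (probability_le1 P measurableT)) ?ltry.
move=> A B mA mB; rewrite mAB//.
exact: (depends_on_indep fairP SS' Sf Sg mf mg mA mB).
Qed.

End independent_pairs.

Section cells.
Context {R : realType}.

Definition cell n (z : 'I_n -> int) : set 'rV[R]_n :=
  [set v | forall i, (z i)%:~R <= v ord0 i < (z i)%:~R + 1].

Lemma cell_floor n (z : 'I_n -> int) v : cell z v <-> forall i, Num.floor (v ord0 i) = z i.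
Proof.
split=> H i.
  by apply: floor_def; rewrite intrD; exact: H.
by rewrite -H -intrD1; exact: floor_itv.
Qed.

Lemma measurable_row_coord n (i : 'I_n) :
  measurable_fun setT (fun v : 'rV[R]_n => v ord0 i : measurableTypeR R).
Proof.
move=> _ B mB; rewrite setTI; apply: sub_sigma_algebra.
rewrite -bigcup_seq; exists i; first by rewrite /= mem_index_enum.
by exists B => //; rewrite setTI.
Qed.

Lemma measurable_cell n (z : 'I_n -> int) : measurable (cell z : set 'rV[R]_n).
Proof.
rewrite (_ : cell z = \bigcap_(i in [set: 'I_n])
   ((fun v : 'rV[R]_n => v ord0 i) @^-1` `[(z i)%:~R, (z i)%:~R + 1[%classic)).
  apply: fin_bigcap_measurable => [|i _]; first exact: finite_finset.
  rewrite -[X in measurable X]setTI; apply: measurable_row_coord => //; exact: measurable_itv.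
by apply/seteqP; split=> v H i; [move=> _ /=; rewrite in_itv; exact: H|move: (H i I); rewrite /= in_itv].
Qed.

Lemma rV_cons0 n (p : 'rV[R]_n * measurableTypeR R) : rV_cons p ord0 ord0 = p.2.
Proof.
rewrite /rV_cons; have -> : ord0 = lshift n (ord0 : 'I_1) by exact: val_inj.
by apply: (etrans (row_mxEl _ _ _ _)); rewrite mxE mulr1n.
Qed.

Lemma rV_consS n (p : 'rV[R]_n * measurableTypeR R) (i : 'I_n) :
  rV_cons p ord0 (lift ord0 i) = p.1 ord0 i.
Proof.
rewrite /rV_cons; have -> : lift ord0 i = rshift 1 i by exact: val_inj.
exact: (etrans (row_mxEr _ _ _ _)).
Qed.

Context (P : probability coins R) (fairP : fair P) (K : countType).

Lemma unif_shift_law (a : K) (c : R) (A : set (measurableTypeR R)) : measurable A ->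
  P ((fun w => unif a w + c) @^-1` A) = lebesgue_measure (A `&` `[c, c + 1[%classic).
Proof.
move=> mA; rewrite -unit_itv_translate// -(fair_unif a fairP)//.
rewrite -[X in measurable X]setTI; apply: (measurable_funD _ _) => //.
Qed.

Definition random_row n (f : 'I_n -> K) (z : 'I_n -> int) (w : coins) : 'rV[R]_n :=
  \row_i (unif (f i) w + (z i)%:~R).

Lemma measurable_random_row n (f : 'I_n -> K) z : measurable_fun setT (random_row f z).
Proof.
apply: measurable_fun_rV => i; rewrite /random_row.
under eq_fun do rewrite mxE.
by apply: measurable_funD => //; exact: measurable_unif.
Qed.

Lemma random_row_depends n (f : 'I_n -> K) z (A : set K) : (forall i, A (f i)) ->
  depends_on (block A) (random_row f z).
Proof.
move=> Af w w' H; apply/rowP => i; rewrite !mxE; congr (_ + _).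
exact: (block_unif (Af i)).
Qed.

(** Coordinate by coordinate, following the recursive definition of Lebesgue measure
    as an iterated product. *)
Lemma random_row_law n (f : 'I_n -> K) z (A : set 'rV[R]_n) : injective f ->
  measurable A -> P (random_row f z @^-1` A) = lebesgue_measure_rV R n (A `&` cell z).
Proof.
elim: n f z A => [|n IH] f z A finj mA.
  have cT : cell z = setT by apply/seteqP; split=> // v _ [].
  rewrite cT setIT /= diracE.
  have [A0|A0] := pselect (A 0).
    rewrite (_ : _ @^-1` _ = setT) ?probability_setT ?mem_set//.
    by apply/seteqP; split=> // w _ /=; rewrite (_ : random_row f z w = 0)//; apply/rowP => -[].
  rewrite (_ : _ @^-1` _ = set0) ?measure0 ?memNset//.
  by rewrite -subset0 => w /=; rewrite (_ : random_row f z w = 0)//; apply/rowP => -[].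
pose f' (i : 'I_n) := f (lift ord0 i); pose z' (i : 'I_n) := z (lift ord0 i).
pose g w := unif (f ord0) w + (z ord0)%:~R : measurableTypeR R.
have rowE w : random_row f z w = @rV_cons R n (random_row f' z' w, g w).
  apply/rowP => i; rewrite mxE; have [j ->|->] := unliftP ord0 i; last by rewrite rV_cons0.
  by rewrite rV_consS mxE.
have -> : random_row f z @^-1` A =
    (fun w => (random_row f' z' w, g w)) @^-1` ((@rV_cons R n) @^-1` A).
  by apply/seteqP; split=> w /=; rewrite rowE.
have mcz : measurable (cell z' `*` `[(z ord0)%:~R : R, (z ord0)%:~R + 1[%classic :
    set ('rV[R]_n * measurableTypeR R)).
  by apply: measurableX; [exact: measurable_cell|exact: measurable_itv].
pose m := restricted_measure (lebesgue_measure_rV R n \x lebesgue_measure)%E mcz.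
rewrite (@indep_pair_rectangle R P fairP _ _ _ _ (block [set k | exists i, k = f' i])
  (block [set f ord0]) (random_row f' z') g _ _ _ _ _ m).
- rewrite /m /restricted_measure/= /mrestr/= /pushforward; congr ((_ \x _)%E _).
  apply/seteqP; split=> -[v x] [/= Avx].
    move=> [vz xz]; split => // i; have [j ->|->] := unliftP ord0 i.
      by rewrite rV_consS; exact: vz.
    by rewrite rV_cons0; move: xz; rewrite in_itv.
  move=> H; split => //; split => /=.
    by move=> i; move: (H (lift ord0 i)); rewrite rV_consS.
  by move: (H ord0); rewrite rV_cons0 in_itv.
- apply: blockI; rewrite -subset0 => k [[i ->]] /= /finj.
  by move/eqP; rewrite eq_sym (negbTE (neq_lift _ _)).
- by apply: random_row_depends => i; exists i.
- by move=> w w' H; rewrite /g; congr (_ + _); exact: (block_unif (erefl : [set f ord0] (f ord0))).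
- exact: measurable_random_row.
- by apply: measurable_funD => //; exact: measurable_unif.
- move=> B C mB mC; rewrite IH//; last by move=> i j /finj /lift_inj.
  rewrite unif_shift_law// /m /restricted_measure/= /mrestr /= -setXI product_measure1E//.
  + by apply: measurableI => //; exact: measurable_cell.
  + by apply: measurableI => //; exact: measurable_itv.
- by rewrite -[X in measurable X]setTI; exact: measurable_rV_cons.
Qed.

End cells.

Section quantile.
Context {R : realType} (theta : R) (theta0 : 0 <= theta).

(** The inverse of the distribution function, with an arbitrary value where it does
    not exist. *)
Definition poisson_quantile (x : R) : nat :=
  match pselect (exists k, x < poisson_cdf theta k) with
  | left h => ex_minn h
  | right _ => 0%N
  end.

Lemma poisson_cdf_nd : {homo poisson_cdf theta : s t / (s <= t)%N >-> s <= t}.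
Proof.
move=> s t st; rewrite /poisson_cdf (@big_ord_widen _ _ _ s.+1 t.+1 (poisson_weight theta) st).
rewrite [leRHS](bigID (fun j : 'I_t.+1 => (j < s.+1)%N))/= lerDl.
by apply: sumr_ge0 => j _; exact: poisson_weight_ge0.
Qed.

Lemma poisson_cdf_le1 t : poisson_cdf theta t <= 1.
Proof.
have := @cvg_poisson_cdf1 R theta => c; rewrite -(cvg_lim _ c)//.
apply: nondecreasing_cvgn_le; first by move=> s u; exact: poisson_cdf_nd.
by apply/cvg_ex; exists 1.
Qed.

Lemma poisson_quantileP (x : R) k : x < 1 ->
  (poisson_quantile x = k) <->
  (x < poisson_cdf theta k /\ forall l, (l < k)%N -> poisson_cdf theta l <= x).
Proof.
move=> x1; have ex : exists k, x < poisson_cdf theta k.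
  have /cvgr_gt/(_ _ x1)[M _ /(_ M (leqnn _)) /= xM] := @cvg_poisson_cdf1 R theta.
  by exists M.
rewrite /poisson_quantile; case: pselect => // h; case: ex_minnP => m xm mmin.
split=> [<-|[xk kmin]].
  by split => // l; rewrite leNgt; apply: contraTN => /mmin; rewrite -leqNgt.
apply/eqP; rewrite eqn_leq mmin//= leqNgt; apply/negP => /kmin.
by rewrite leNgt xm.
Qed.

Lemma poisson_quantile_ge1 (x : R) : 1 <= x -> poisson_quantile x = 0%N.
Proof.
move=> x1; rewrite /poisson_quantile; case: pselect => // -[k kx]; exfalso.
by move: kx; rewrite ltNge (le_trans (poisson_cdf_le1 _)).
Qed.

Definition quantile_itv k : set R :=
  if k is l.+1 then `[poisson_cdf theta l, poisson_cdf theta l.+1[%classic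
  else `]-oo, poisson_cdf theta 0[%classic.

Lemma quantile_itvP (x : R) k : x < 1 -> poisson_quantile x = k <-> quantile_itv k x.
Proof.
move=> x1; rewrite poisson_quantileP//; case: k => [|k] /=; rewrite in_itv/=.
  by split=> [[]//|].
split=> [[-> /(_ k (ltnSn _)) ->]//|/andP[xk ->]]; split => // l lk.
by rewrite (le_trans _ xk)// poisson_cdf_nd.
Qed.

Lemma measurable_poisson_quantile :
  measurable_fun setT (poisson_quantile : measurableTypeR R -> nat).
Proof.
move=> _ B _; rewrite setTI.
have -> : poisson_quantile @^-1` B = \bigcup_(k in B) (poisson_quantile @^-1` [set k]).
  by apply/seteqP; split=> [x Bx|x [k Bk /= ->]//]; exists (poisson_quantile x).
apply: bigcup_measurable => k _.
rewrite (_ : _ @^-1` _ = (quantile_itv k `&` `]-oo, 1[%classic) `|`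
    (if k == 0%N then `[1, +oo[%classic else set0)).
  apply: measurableU; last by case: ifP => // _; exact: measurable_itv.
  apply: measurableI; last exact: measurable_itv.
  by case: k => [|k]; exact: measurable_itv.
apply/seteqP; split=> x /=; rewrite !in_itv/=.
  have [x1|x1] := ltP x 1; first by move=> /(quantile_itvP _ x1) ?; left.
  by rewrite poisson_quantile_ge1// => <-; right; rewrite /= in_itv/= x1.
case=> [[kx x1]|]; first exact/quantile_itvP.
by case: ifP => // /eqP ->; rewrite /= in_itv/= andbT => /poisson_quantile_ge1.
Qed.

(** The set of arguments where the quantile is [k] is an interval whose length is the
    jump of the distribution function at [k]. *)
Lemma lebesgue_quantile k :
  lebesgue_measure (poisson_quantile @^-1` [set k] `&` `[0, 1[%classic) = (poisson_weight theta k)%:E.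
Proof.
have c0 t : 0 <= poisson_cdf theta t.
  by apply: sumr_ge0 => j _; exact: poisson_weight_ge0.
case: k => [|k].
  have -> : poisson_quantile @^-1` [set 0%N] `&` `[0, 1[%classic = `[0, poisson_cdf theta 0[%classic.
    apply/seteqP; split=> x /=; rewrite !in_itv/=.
      by move=> [+ /andP[-> x1]]; move=> /(quantile_itvP _ x1) /=; rewrite in_itv.
    move=> /andP[x0 xc]; have x1 := lt_le_trans xc (poisson_cdf_le1 _).
    by rewrite x0 x1; split => //; apply/quantile_itvP => //=; rewrite in_itv.
  rewrite lebesgue_measure_itv/= lte_fin; case: ifPn => [_|].
    by rewrite -EFinB subr0 /poisson_cdf big_ord_recl big_ord0 addr0.
  rewrite -leNgt => H; congr EFin; have := c0 0%N.
  rewrite /poisson_cdf big_ord_recl big_ord0 addr0 in H * => H'.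
  by apply/eqP; rewrite eq_le H H'.
have -> : poisson_quantile @^-1` [set k.+1] `&` `[0, 1[%classic =
   `[poisson_cdf theta k, poisson_cdf theta k.+1[%classic.
  apply/seteqP; split=> x /=; rewrite !in_itv/=.
    by move=> [+ /andP[_ x1]]; move=> /(quantile_itvP _ x1) /=; rewrite in_itv.
  move=> /andP[x0 xc]; have x1 := lt_le_trans xc (poisson_cdf_le1 _).
  by rewrite (le_trans (c0 k) x0) x1; split => //; apply/quantile_itvP => //=; rewrite in_itv/= x0.
have E : poisson_cdf theta k.+1 = poisson_cdf theta k + poisson_weight theta k.+1.
  by rewrite /poisson_cdf [LHS]big_ord_recr.
have w0 := poisson_weight_ge0 k.+1 theta0.
rewrite lebesgue_measure_itv/= lte_fin; case: ifPn => [_|].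
  by rewrite -EFinB E addrAC subrr add0r.
by rewrite E -leNgt gerDl => H; congr EFin; apply/eqP; rewrite eq_le H w0.
Qed.

End quantile.

Lemma int_vectors_enum n :
  exists z : nat -> {ffun 'I_n.+1 -> int}, bijective z.
Proof.
have : ([set: {ffun 'I_n.+1 -> int}] #= [set: nat])%card.
  apply: eq_card_nat; first exact: countableP.
  have finj : injective (fun k : nat => [ffun _ : 'I_n.+1 => k%:Z]).
    by move=> k l /ffunP/(_ ord0); rewrite !ffunE => -[].
  move=> fin; apply: infinite_nat.
  rewrite (_ : [set: nat] = (fun k : nat => [ffun _ : 'I_n.+1 => k%:Z]) @^-1` setT)//.
  by apply: finite_preimage => // k l _ _; exact: finj.
move=> /card_set_bijP[f]; rewrite setTT_bijective => -[g fK gK].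
by exists g; exists f.
Qed.

Section base_process.
Context {R : realType} (P : probability coins R) (fairP : fair P) (n : nat).
Local Notation E := 'rV[R]_n.+1.
Local Notation H := (E * measurableTypeR R)%type.
Local Notation K := (nat + nat * nat * nat)%type.
Variables (theta : R) (theta0 : 0 <= theta).
Variables (z : nat -> {ffun 'I_n.+1 -> int}) (zbij : bijective z).

Definition base_intensity (B : set H) : \bar R :=
  (theta%:E * (lebesgue_measure_rV R n.+1 \x lebesgue_measure)
     (B `&` (setT `*` `[0%R, 1%R[%classic)))%E.

(** The keys [inl j] hold the number of points of the cell [j]; the key
    [inr (j, l, 0)] holds the mark of its point [l], and [inr (j, l, i + 1)] holds
    the coordinate [i]. *)
Definition base_number (j : nat) (w : coins) : nat :=
  poisson_quantile theta (unif (inl j : K) w).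

Definition base_location (j l : nat) (w : coins) : E :=
  random_row (fun i => inr (j, l, i.+1) : K) (z j) w.

Definition base_point (j l : nat) (w : coins) : H :=
  (base_location j l w, unif (inr (j, l, 0%N) : K) w).

Definition base_keys (i : nat + nat * nat) : set K :=
  match i with
  | inl j => [set inl j]
  | inr p => [set k | exists m, k = inr (p, m)]
  end.

Definition base_source (i : nat + nat * nat) : set nat := block (base_keys i).

Lemma base_sourceI i j : i <> j -> base_source i `&` base_source j = set0.
Proof.
move=> ij; apply: blockI; rewrite -subset0 => k []; case: i j ij => [i|i] [j|j] /= ij.
- by move=> -> [] /(congr1 (@inl nat (nat * nat))).
- by move=> -> [].
- by move=> [m ->].
- by move=> [m ->] [m' [ij' _]]; apply: ij; rewrite ij'.
Qed.

Lemma measurable_base_number j : measurable_fun setT (base_number j).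
Proof.
apply: (measurableT_comp (measurable_poisson_quantile theta0)).
exact: measurable_unif.
Qed.

Lemma base_number_depends j : depends_on (base_source (inl j)) (base_number j).
Proof. by move=> w w' H; congr poisson_quantile; exact: (block_unif (erefl : [set inl j] (inl j : K))). Qed.

Lemma base_number_law j k : P [set w | base_number j w = k] = (poisson_weight theta k)%:E.
Proof.
rewrite -lebesgue_quantile// -(fair_unif (inl j : K) fairP)//.
rewrite -[X in measurable X]setTI; exact: measurable_poisson_quantile.
Qed.

Lemma measurable_base_location j l : measurable_fun setT (base_location j l).
Proof. exact: measurable_random_row. Qed.

Lemma measurable_base_point j l : measurable_fun setT (base_point j l).
Proof.
by apply: measurable_fun_pair; [exact: measurable_base_location|exact: measurable_unif].
Qed.

Lemma base_location_depends j l :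
  depends_on (base_source (inr (j, l))) (base_location j l).
Proof. by apply: random_row_depends => i; exists i.+1. Qed.

Lemma base_point_depends j l : depends_on (base_source (inr (j, l))) (base_point j l).
Proof.
move=> w w' H; rewrite /base_point (base_location_depends H); congr pair.
by apply: (@block_unif R K (base_keys (inr (j, l))) (inr (j, l, 0%N))) => //; exists 0%N.
Qed.

Definition base_cell j : set H := cell (z j) `*` `[0%R, 1%R[%classic.

Lemma measurable_base_cell j : measurable (base_cell j).
Proof. by apply: measurableX; [exact: measurable_cell|exact: measurable_itv]. Qed.

Lemma base_location_law j l (A : set E) : measurable A ->
  P (base_location j l @^-1` A) = lebesgue_measure_rV R n.+1 (A `&` cell (z j)).
Proof.
by move=> mA; rewrite /base_location random_row_law// => i i' [/val_inj].
Qed.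

Lemma base_point_law j l (B : set H) : measurable B ->
  P (base_point j l @^-1` B) =
  (lebesgue_measure_rV R n.+1 \x lebesgue_measure)%E (B `&` base_cell j).
Proof.
pose m := restricted_measure (lebesgue_measure_rV R n.+1 \x lebesgue_measure)%E (measurable_base_cell j).
apply: (@indep_pair_rectangle R P fairP _ _ _ _ (block [set k : K | exists i : 'I_n.+1, k = inr (j, l, i.+1)])
  (block [set inr (j, l, 0%N) : K]) (base_location j l) (unif (inr (j, l, 0%N) : K)) _ _ _ _ _ m).
- by apply: blockI; rewrite -subset0 => k [[i ->]] [].
- by apply: random_row_depends => i; exists i.
- by move=> w w' H; exact: (block_unif (erefl : [set inr (j, l, 0%N)] (inr (j, l, 0%N) : K))).
- exact: measurable_base_location.
- exact: measurable_unif.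
- move=> A C mA mC; rewrite base_location_law// fair_unif//.
  have -> : m (A `*` C) = (lebesgue_measure_rV R n.+1 \x lebesgue_measure)%E
      ((A `&` cell (z j)) `*` (C `&` `[0%R, 1%R[%classic)) by rewrite setXI.
  apply: product_measure1E.
  + by apply: measurableI => //; exact: measurable_cell.
  + by apply: measurableI => //; exact: measurable_itv.
Qed.

Lemma trivIset_base_cell : trivIset setT base_cell.
Proof.
move=> j j' _ _ [[v x] [[/= vj _] [/= vj' _]]].
apply: (bij_inj zbij); apply/ffunP => i.
by rewrite -((cell_floor _ _).1 vj) ((cell_floor _ _).1 vj').
Qed.

Lemma bigcup_base_cell : \bigcup_j base_cell j = setT `*` `[0%R, 1%R[%classic.
Proof.
apply/seteqP; split=> [[v x] [j _ [_ H]]//|[v x] [_ /= H]].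
have [g gK Kg] := zbij.
exists (g [ffun i => Num.floor (v ord0 i)]) => //; split => //=.
by apply/cell_floor => i; rewrite Kg ffunE.
Qed.

Variable extra : set coins.
Hypothesis mextra : measurable extra.
Hypothesis Pextra : P extra = 0%E.

(** Points with equal first coordinates are excluded, so that any map which keeps
    the location is injective on the configuration. *)
Definition base_clash : set coins := \bigcup_(p : (nat * nat) * (nat * nat))
  (if p.1 == p.2 then set0 else [set w | base_location p.1.1 p.1.2 w ord0 ord0 =
    base_location p.2.1 p.2.2 w ord0 ord0]).

Definition base_bad : set coins := base_clash `|` extra.

(** The two coordinates are independent, and one of them has a diffuse law. *)
Lemma base_clash_pair (a b : nat * nat) : a <> b ->
  measurable [set w | base_location a.1 a.2 w ord0 ord0 = base_location b.1 b.2 w ord0 ord0] /\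
  P [set w | base_location a.1 a.2 w ord0 ord0 = base_location b.1 b.2 w ord0 ord0] = 0%E.
Proof.
move=> ab.
have mloc (c : nat * nat) : measurable_fun setT (fun w => base_location c.1 c.2 w ord0 ord0 : measurableTypeR R).
  by apply: (measurableT_comp (@measurable_row_coord R n.+1 ord0)); exact: measurable_base_location.
pose D : set (measurableTypeR R * measurableTypeR R) :=
  (fun p => p.1 - p.2 : measurableTypeR R) @^-1` [set 0].
have mD : measurable D.
  have mB : measurable_fun setT (fun p : measurableTypeR R * measurableTypeR R =>
      p.1 - p.2 : measurableTypeR R).
    by apply: measurable_funB; [exact: measurable_fst|exact: measurable_snd].
  by rewrite -[X in measurable X]setTI; exact: mB.
pose f (c : nat * nat) w : measurableTypeR R := base_location c.1 c.2 w ord0 ord0.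
have -> : [set w | base_location a.1 a.2 w ord0 ord0 = base_location b.1 b.2 w ord0 ord0] =
    (fun w => (f a w, f b w)) @^-1` D.
  by apply/seteqP; split=> w; rewrite /D /f /= => /eqP; rewrite ?subr_eq0 => /eqP // ->; rewrite subrr.
split.
  have mff : measurable_fun setT (fun w => (f a w, f b w)).
    by apply: measurable_fun_pair; exact: mloc.
  by rewrite -[X in measurable X]setTI; exact: mff.
have fdep c : depends_on (base_source (inr c)) (f c).
  by move=> w w' ww'; rewrite /f; case: c ww' => j l ww'; rewrite (base_location_depends ww').
apply: (indep_pair_null fairP _ (fdep a) (fdep b) (mloc a) (mloc b) mD).
  by apply: base_sourceI => -[].
move=> x; have -> : xsection D x = [set x].
  apply/seteqP; split=> y; rewrite xsectionE /D /=.
    by move/eqP; rewrite subr_eq0 => /eqP.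
  by move=> ->; rewrite subrr.
rewrite (_ : f b @^-1` _ = (fun w => unif (inr (b.1, b.2, 1%N) : K) w + (z b.1 ord0)%:~R) @^-1` [set x]).
  rewrite unif_shift_law//; apply/eqP; rewrite eq_le measure_ge0 andbT.
  rewrite -[leRHS](lebesgue_measure_set1 x); apply: le_measure; rewrite ?inE//.
  by apply: measurableI => //; exact: measurable_itv.
by apply/seteqP; split=> w; rewrite /f /base_location /random_row /= mxE.
Qed.

Lemma measurable_base_bad : measurable base_bad.
Proof.
apply: measurableU => //; apply: countable_bigcupT_measurable; first exact: countableP.
by move=> [a b] /=; case: eqP => // ab; have [] := base_clash_pair ab.
Qed.

Lemma base_bad_null : P base_bad = 0%E.
Proof.
have clash0 : P.-negligible base_clash.
  rewrite /base_clash (_ : \bigcup_p _ = \bigcup_(k : nat) (if (@choice.unpickle ((nat * nat) * (nat * nat))%type k) is Some p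
    then (if p.1 == p.2 then set0 else [set w | base_location p.1.1 p.1.2 w ord0 ord0 =
    base_location p.2.1 p.2.2 w ord0 ord0]) else set0)).
    apply: negligible_bigcup => k; case: (choice.unpickle k) => [[a b]|]; last exact: negligible_set0.
    case: eqP => /= [_|ab]; first exact: negligible_set0.
    by have [m0 P0] := base_clash_pair ab; apply/negligibleP.
  apply/seteqP; split=> w [p _ Hp]; first by exists (choice.pickle p) => //; rewrite choice.pickleK.
  by move: Hp; case: (choice.unpickle p) => // q Hq; exists q.
have : P.-negligible base_bad.
  by apply: negligibleU => //; exists extra; split.
by move=> /negligibleP -> //; exact: measurable_base_bad.
Qed.

Definition base_config : coins -> set H := scattered base_number base_point base_bad.

Theorem base_poisson : is_poisson_process P base_intensity base_config.
Proof.
pose mu j := distribution P (mfun_Sub (mem_set (measurable_base_point j 0))).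
apply: (@scattered_poisson R P fairP _ _ theta mu base_source base_sourceI base_number
  base_point measurable_base_number base_number_depends base_number_law
  measurable_base_point base_point_depends _ base_bad measurable_base_bad base_bad_null) => //.
- move=> j l B mB; rewrite base_point_law//.
  exact/esym/(base_point_law j 0 mB).
- move=> w bw j l j' l' [ejl _]; apply/eqP/negPn/negP => /eqP ne; apply: bw; left.
  by exists ((j, l), (j', l')) => //=; case: eqP => //= _; rewrite ejl.
- move=> B mB; rewrite /base_intensity -bigcup_base_cell setI_bigcupr.
  rewrite measure_bigcup//=; last 2 first.
  + by move=> j _; apply: measurableI => //; exact: measurable_base_cell.
  + by move=> i j _ _ [w [[_ Ci] [_ Cj]]]; apply: trivIset_base_cell => //; exists w.
  rewrite -nneseriesZl//.
  rewrite [RHS]eseries_mkcond [LHS]eseries_mkcond; apply: eq_eseriesr => j _; rewrite in_setT.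
  by congr (_ * _)%E; exact/esym/(base_point_law j 0 mB).
  by move=> j _; exact: (measure_ge0 (lebesgue_measure_rV R n.+1 \x lebesgue_measure)%E).
Qed.

End base_process.

(** * Configurations and void events *)

Section configurations.
Context {d : measure_display} (X : measurableType d).

(** Configurations carry the sigma-algebra generated by the void events, which is the
    natural one for simple point processes. *)
Definition config := set X.

Definition empty_on (B : set X) : set config := [set c | c `&` B = set0].

Definition voids : set (set config) := [set empty_on B | B in measurable].

HB.instance Definition _ := gen_eqMixin config.
HB.instance Definition _ := gen_choiceMixin config.
HB.instance Definition _ := isPointed.Build config (set0 : set X).
HB.instance Definition _ := Measurable.copy config (g_sigma_algebraType voids).

Lemma measurable_void (B : set X) : measurable B -> measurable (empty_on B).
Proof. by move=> mB; apply: sub_sigma_algebra; exists B. Qed.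

(** A configuration avoids two sets exactly when it avoids their union, so the void
    events form a pi-system. *)
Lemma voids_measure_unique (R : realType) (m1 m2 : {measure set config -> \bar R}) :
  (m1 setT < +oo)%E -> (forall B, measurable B -> m1 (empty_on B) = m2 (empty_on B)) ->
  forall A, measurable A -> m1 A = m2 A.
Proof.
move=> m1T m12 A mA; apply: (measure_unique voids (fun=> setT)) => //.
- move=> _ _ [B mB <-] [C mC <-]; exists (B `|` C); first exact: measurableU.
  by apply/seteqP; split=> c; rewrite /empty_on /= setIUr setU_eq0.
- by move=> _; exists set0 => //; apply/seteqP; split=> // c _; rewrite /empty_on /= setI0.
- by rewrite bigcup_const//; exists 0%N.
- by move=> _ [B mB <-]; exact: m12.
Qed.

Lemma measurable_fun_config d' (T : measurableType d') (f : T -> config) :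
  (forall B, measurable B -> measurable [set x | f x `&` B = set0]) -> measurable_fun setT f.
Proof.
move=> mf; apply: (@measurability _ _ _ _ _ _ voids) => // _ [_ [B mB <-] <-].
by rewrite setTI; exact: mf.
Qed.

End configurations.

Section poisson_law.
Context {dX : measure_display} {X : measurableType dX} {R : realType}.
Implicit Types Lam : set X -> \bar R.

Lemma point_count0 {dO : measure_display} {Om : measurableType dO} (eta : Om -> set X) B w :
  (point_count eta B w = 0%:R%:E :> \bar R) <-> eta w `&` B = set0.
Proof.
rewrite /point_count; split=> [c0|->]; last by rewrite measure0.
apply/eqP/negPn/negP => /set0P[x Bx].
have /counting_leP/(_ [:: x] isT) : (@counting X R (eta w `&` B) <= 0%:R%:E)%E by rewrite c0.
by move=> /(_ (fun y => _)) H; have : (1 <= 0)%N by apply: H => y; rewrite inE => /eqP ->.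
Qed.

Context {dO : measure_display} {Om : measurableType dO} (P : probability Om R) (eta : Om -> set X).

Lemma measurable_poisson_config Lam : is_poisson_process P Lam eta ->
  measurable_fun setT (eta : Om -> config X).
Proof.
move=> [mc _ _ _]; apply: measurable_fun_config => B mB.
have := mc B mB measurableT _ (emeasurable_set1 (0%:R%:E)); rewrite setTI.
by congr measurable; apply/seteqP; split=> w /= /point_count0.
Qed.

Lemma poisson_void Lam B : is_poisson_process P Lam eta -> measurable B -> (0 <= Lam B)%E ->
  P [set w | eta w `&` B = set0] =
    if Lam B \is a fin_num then poisson_prob (fine (Lam B)) 0 [set 0%N] else 0%E.
Proof.
move=> [mc fin inf _] mB L0.
have -> : [set w | eta w `&` B = set0] = [set w | point_count eta B w = 0%:R%:E :> \bar R].
  by apply/seteqP; split=> w /= /point_count0.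
case: ifPn => [/fin ->//|]; rewrite ge0_fin_numE// -leNgt leye_eq => /eqP/(inf B mB) Pinf.
have m1 (y : \bar R) : measurable [set w | point_count eta B w = y].
  by have := mc B mB measurableT _ (emeasurable_set1 y); rewrite setTI.
apply/eqP; rewrite eq_le measure_ge0 andbT.
have := probability_setC P (m1 +oo%E); rewrite Pinf subee// => <-.
apply: le_measure; rewrite ?inE//; first exact: measurableC.
by move=> w /= ->.
Qed.

End poisson_law.

(** The void probability of [B] is [exp (- Lam B)]. *)
Theorem poisson_law_unique {dX d1 d2 : measure_display} {X : measurableType dX} {R : realType}
    {Om1 : measurableType d1} {Om2 : measurableType d2} (P1 : probability Om1 R) (P2 : probability Om2 R)
    (eta1 : Om1 -> set X) (eta2 : Om2 -> set X) (Lam : set X -> \bar R) :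
  (forall B, measurable B -> (0 <= Lam B)%E) ->
  is_poisson_process P1 Lam eta1 -> is_poisson_process P2 Lam eta2 ->
  forall A : set (config X), measurable A -> P1 (eta1 @^-1` A) = P2 (eta2 @^-1` A).
Proof.
move=> L0 h1 h2 A mA.
pose m1 := measure_function_pushforward__canonical__measure_function_Measure
  P1 (measurable_poisson_config h1).
pose m2 := measure_function_pushforward__canonical__measure_function_Measure
  P2 (measurable_poisson_config h2).
apply: (@voids_measure_unique _ X R m1 m2) => //.
  by rewrite /m1/= /pushforward preimage_setT (le_lt_trans (probability_le1 P1 measurableT)) ?ltry.
move=> B mB; rewrite /m1 /m2 /= /pushforward.
exact: etrans (poisson_void h1 mB (L0 _ mB)) (esym (poisson_void h2 mB (L0 _ mB))).
Qed.

Section dyadic.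
Context {R : realType} (n : nat).
Local Notation X := ('rV[R]_n * measurableTypeR R)%type.

(** The index of the cube of side [2 ^ (- m)] that contains [q]. *)
Definition dyadic_index (m : nat) (q : X) : {ffun 'I_n.+1 -> int} :=
  [ffun i => Num.floor (2 ^+ m * rV_cons q ord0 i)].

Definition tuple_mx k (p : 'I_k -> X) : 'M[R]_(k, n.+1) :=
  \matrix_(i, j) rV_cons (p i) ord0 j.

Lemma measurable_dyadic_cell m z : measurable [set q : X | dyadic_index m q = z].
Proof.
have P0 : 0 < 2 ^+ m :> R by rewrite exprn_gt0.
rewrite (_ : mkset _ = \bigcap_(i in [set: 'I_n.+1])
   (@rV_cons R n @^-1` ((fun v : 'rV[R]_n.+1 => v ord0 i) @^-1`
     `[(2 ^+ m)^-1 * (z i)%:~R, (2 ^+ m)^-1 * (z i + 1)%:~R[%classic))).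
  apply: fin_bigcap_measurable => [|i _]; first exact: finite_finset.
  rewrite -[X in measurable X]setTI; apply: measurable_rV_cons => //.
  apply: sub_sigma_algebra; rewrite -bigcup_seq; exists i; first by rewrite /= mem_index_enum.
  by exists `[(2 ^+ m)^-1 * (z i)%:~R, (2 ^+ m)^-1 * (z i + 1)%:~R[%classic; rewrite ?setTI.
have E i q : (Num.floor (2 ^+ m * rV_cons q ord0 i) = z i) <->
    (2 ^+ m)^-1 * (z i)%:~R <= rV_cons q ord0 i < (2 ^+ m)^-1 * (z i + 1)%:~R.
  rewrite ler_pdivrMl// ltr_pdivlMl// -floor_eq.
  by split => [->|/eqP].
apply/seteqP; split=> q /= H.
  by move=> i _ /=; rewrite in_itv/=; apply/E; rewrite -H ffunE.
by apply/ffunP => i; rewrite ffunE; apply/E; have := H i I; rewrite /= in_itv.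
Qed.

Lemma dyadic_index_near m p q i : dyadic_index m p = dyadic_index m q ->
  `|rV_cons p ord0 i - rV_cons q ord0 i| < (2 ^+ m)^-1.
Proof.
have P0 : 0 < 2 ^+ m :> R by rewrite exprn_gt0.
move=> /ffunP/(_ i); rewrite !ffunE => pq.
have /andP[] := floor_itv (2 ^+ m * rV_cons p ord0 i).
have /andP[] := floor_itv (2 ^+ m * rV_cons q ord0 i).
rewrite pq intrD; set f := (Num.floor _)%:~R => a b c d.
rewrite -(ltr_pM2l P0) mulfV ?gt_eqF// -[X in X * `|_|](gtr0_norm P0) -normrM mulrBr.
by rewrite ltr_norml; apply/andP; split; lra.
Qed.

Lemma rV_cons_inj : injective (@rV_cons R n).
Proof.
move=> [v x] [v' x'] H; have [e /= ->] := @eq_row_mx R 1 1 n _ _ _ _ H.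
by move/matrixP/(_ ord0 ord0): e; rewrite !mxE !mulr1n /= => ->.
Qed.

Lemma pow2_small (e : R) : 0 < e -> exists m, forall l, (m <= l)%N -> (2 ^+ l)^-1 <= e.
Proof.
move=> e0; have z1 : `|2^-1 : R| < 1 by rewrite ger0_norm ?invr_ge0// invf_lt1// ltr1n.
move: (cvg_expr z1) => /cvgrPdist_le /(_ e e0) [m _ me]; exists m => l /me /=.
by rewrite sub0r normrN exprVn ger0_norm// invr_ge0 exprn_ge0.
Qed.

Lemma dyadic_separation k (p : 'I_k -> X) : injective p ->
  exists m, forall l, (m <= l)%N -> injective (dyadic_index l \o p).
Proof.
move=> pinj; pose D (i j : 'I_k) l := dyadic_index l (p i) = dyadic_index l (p j) -> i = j.
have H i j : exists m, forall l, (m <= l)%N -> D i j l.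
  have [->|ij] := eqVneq i j; first by exists 0%N.
  have [a pa] : exists a, rV_cons (p i) ord0 a != rV_cons (p j) ord0 a.
    apply: contrapT => /forallNP H.
    move/eqP: ij; apply; apply: pinj; apply: rV_cons_inj; apply/rowP => a.
    by apply/eqP/negPn/negP; exact: H.
  have [|m Hm] := @pow2_small `|rV_cons (p i) ord0 a - rV_cons (p j) ord0 a|.
    by rewrite normr_gt0 subr_eq0.
  exists m => l /Hm lm /(@dyadic_index_near l (p i) (p j) a); rewrite ltNge lm//.
pose f i j := projT1 (cid (H i j)).
exists (\max_i \max_j f i j)%N => l lm i j /= e.
apply: (projT2 (cid (H i j)) l _ e); apply: leq_trans lm.
by rewrite (leq_trans _ (leq_bigmax i))// (leq_trans _ (leq_bigmax j)).
Qed.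

Definition has_tuple k (B : 'I_k -> set X) (O : set 'M[R]_(k, n.+1)) : set (config X) :=
  [set c | exists p : 'I_k -> X, [/\ injective p, forall i, c (p i) /\ B i (p i) & O (tuple_mx p)]].

(** If the configuration has such a tuple then, at a scale fine enough, its points
    lie in distinct cubes and every other choice of points in these cubes still
    satisfies the open condition. So the event is a countable union of events
    which say that finitely many given sets are not empty. *)
Lemma measurable_has_tuple k (B : 'I_k -> set X) (O : set 'M[R]_(k, n.+1)) :
  (forall i, measurable (B i)) -> open O -> measurable (has_tuple B O).
Proof.
move=> mB oO.
pose ok (x : nat * {ffun 'I_k -> {ffun 'I_n.+1 -> int}}) :=
  injectiveb x.2 /\ forall p : 'I_k -> X, (forall i, dyadic_index x.1 (p i) = x.2 i) -> O (tuple_mx p).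
pose F (x : nat * {ffun 'I_k -> {ffun 'I_n.+1 -> int}}) : set (config X) :=
  if `[< ok x >] then \bigcap_(i in [set: 'I_k])
    ~` empty_on (B i `&` [set q | dyadic_index x.1 q = x.2 i]) else set0.
have -> : has_tuple B O = \bigcup_x F x.
  apply/seteqP; split=> c.
    move=> [p [pinj pB Op]].
    have [e /= e0 eO] : exists2 e : R, 0 < e & ball (tuple_mx p) e `<=` O.
      by have /nbhs_ballP[e e0 eO] := open_nbhs_nbhs (conj oO Op); exists e.
    have [m1 Hm1] := dyadic_separation pinj; have [m2 Hm2] := pow2_small e0.
    pose m := maxn m1 m2.
    exists (m, [ffun i => dyadic_index m (p i)]) => //; rewrite /F asboolT; last first.
      split => /=.
        by apply/injectiveP => i j; rewrite !ffunE; apply: Hm1; exact: leq_maxl.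
      move=> p' pp'; apply: eO; split => // i j.
      have E (r : 'I_k -> X) : tuple_mx r i j = rV_cons (r i) ord0 j by rewrite mxE.
      rewrite !E /ball/=; have := pp' i; rewrite ffunE => /esym.
      move=> /(@dyadic_index_near m (p i) (p' i) j) /lt_le_trans; apply.
      by apply: Hm2; exact: leq_maxr.
    move=> i _ /= /seteqP[+ _] => /(_ (p i)); apply; have [cp Bp] := pB i.
    by split => //; split => //=; rewrite ffunE.
  move=> [[m zz] _]; rewrite /F; case: asboolP => // -[/= /injectiveP zinj zO] H.
  have ex i : exists q, c q /\ B i q /\ dyadic_index m q = zz i.
    by have /eqP/set0P[q [cq [Bq qz]]] := H i I; exists q.
  pose p i := projT1 (cid (ex i)); have pP i := projT2 (cid (ex i)).
  exists p; split.
  - move=> i j pij; apply: zinj; have [_ [_ <-]] := pP i; have [_ [_ <-]] := pP j.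
    by rewrite -/(p i) -/(p j) pij.
  - by move=> i; have [? []] := pP i.
  - by apply: zO => i; have [_ []] := pP i.
apply: countable_bigcupT_measurable; first exact: countableP.
move=> x; rewrite /F; case: asboolP => // _.
apply: fin_bigcap_measurable => [|i _]; first exact: finite_finset.
apply: measurableC; apply: measurable_void; apply: measurableI => //.
exact: measurable_dyadic_cell.
Qed.

Lemma infinite_injection (c : set X) k : infinite_set c ->
  exists p : 'I_k -> X, injective p /\ forall i, c (p i).
Proof.
move=> /(infinite_set_fset k)[A Ac Ak].
case: k Ak => [|k] Ak; first by exists (fun i => point); split=> -[].
have [x0 _] : exists x, x \in A by apply/fset0Pn; rewrite -cardfs_gt0 (leq_trans _ Ak).
exists (fun i : 'I_k.+1 => nth x0 (enum_fset A) i); split=> [i j /eqP|i].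
  by rewrite nth_uniq ?fset_uniq ?(leq_trans _ Ak)// => /eqP/val_inj.
by apply: Ac; rewrite /= mem_nth// (leq_trans _ Ak).
Qed.

(** A set is infinite exactly when it contains tuples of every length. *)
Lemma measurable_finite_in (W : set X) : measurable W ->
  measurable [set c : config X | finite_set (c `&` W)].
Proof.
move=> mW; rewrite (_ : mkset _ = \bigcup_k ~` has_tuple (fun _ : 'I_k => W) setT).
  apply: bigcupT_measurable => k; apply: measurableC; apply: measurable_has_tuple => //.
  exact: openT.
apply/seteqP; split=> [c /= fin|c [k _ H]].
  exists #|` fset_set (c `&` W)|.+1 => // -[p [pinj pW _]].
  have /uniq_leq_size : uniq (map p (enum 'I_(#|` fset_set (c `&` W)|.+1))).
    by rewrite map_inj_uniq// enum_uniq.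
  move=> /(_ (enum_fset (fset_set (c `&` W)))); rewrite size_map size_enum_ord ltnn => H.
  suff : false by []; apply: H => x /mapP[i _ ->]; rewrite in_fset_set// inE; exact: pW.
apply: contrapT => /(@infinite_injection _ k)[p [pinj pc]]; apply: H.
by exists p; split => // i; exact: pc.
Qed.

End dyadic.

(** * Measurability for the Fell topology *)

Section fell.
Context {T : ptopologicalType} {I : countType} (Ob : I -> set T).
Hypothesis Ob_open : forall p, open (Ob p).
Hypothesis Ob_base : forall (G : set T) x, open G -> G x -> exists p, Ob p x /\ Ob p `<=` G.
Local Notation CF := (closed_set T).

Definition hits (G : set T) : set CF := [set F : CF | F `&` G !=set0].

(** For a countable base [Ob] these countably many sets form a base at every closed
    set: a compact set disjoint from it is covered by finitely many sets of [Ob]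
    that it misses. *)
Definition hits_misses (L : seq I * seq I) : set CF :=
  [set F : CF | (forall p, p \in L.1 -> hits (Ob p) F) /\ (forall p, p \in L.2 -> ~ hits (Ob p) F)].

(** The topology is generated by [fell_subbase]. *)
Lemma open_closed_setP (U : set CF) (F : CF) : open U -> U F ->
  exists s : seq (set CF), (forall B, B \in s -> fell_subbase B /\ B F) /\
    (forall F', (forall B, B \in s -> B F') -> U F').
Proof.
move=> [D' sD <-] [A D'A AF]; have [s ss sA] := sD A D'A.
exists (enum_fset s); split=> [B Bs|F' H].
  split; first by have := ss B Bs; rewrite inE.
  by have : A F by []; rewrite -sA; apply.
by exists A => //; suff : A F' by []; rewrite -sA => B; exact: H.
Qed.

Lemma compact_cover_base (K F : set T) : compact K -> closed F -> F `&` K = set0 ->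
  exists L : seq I, (forall p, p \in L -> Ob p `&` F = set0) /\
    (forall x, K x -> exists2 p, p \in L & Ob p x).
Proof.
move=> cK0 cF FK0; have cK : cover_compact K by rewrite -compact_cover.
have [|D Dp KD] := cK I [set p | Ob p `&` F = set0] Ob (fun p _ => Ob_open p).
  move=> x Kx; have [|p [px pF]] := @Ob_base (~` F) x (closed_openC cF).
    by move=> Fx; have : (F `&` K) x by []; rewrite FK0.
  by exists p => //=; rewrite -subset0 => y [/pF].
exists (enum_fset D); split=> [p pD|x /KD[p pD px]]; first by have := Dp p pD; rewrite inE.
by exists p.
Qed.

Lemma hits_misses_base (U : set CF) (F : CF) : open U -> U F ->
  exists L, hits_misses L F /\ hits_misses L `<=` U.
Proof.
move=> oU UF; have [s [sF sU]] := open_closed_setP oU UF.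
suff [L [LF LU]] : exists L, hits_misses L F /\
    (forall F', hits_misses L F' -> forall B, B \in s -> B F').
  by exists L; split => // F' LF'; apply: sU; exact: LU.
elim: s {sU} sF => [|B s IH] sF; first by exists ([::], [::]); split.
have [[L1 L2] [[LF1 LF2] LU]] : exists L, hits_misses L F /\
    (forall F', hits_misses L F' -> forall B, B \in s -> B F').
  by apply: IH => C Cs; apply: sF; rewrite inE Cs orbT.
have [[[K cK BE]|[G oG BE]] BF] := sF B (mem_head _ _).
  have [L [LF LK]] := compact_cover_base cK (@closed_setP _ F) (eq_ind B (@^~ F) BF _ BE).
  exists (L1, L ++ L2); split.
    split => // p; rewrite mem_cat => /orP[/LF pF [x [Fx px]]|]; last exact: LF2.
    by have : (Ob p `&` F) x by []; rewrite pF.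
  move=> F' [H1 H2] C; rewrite inE => /predU1P[->|Cs].
    rewrite BE /=; rewrite -subset0 => x [F'x /LK[p pL px]].
    by apply: (H2 p); [rewrite mem_cat pL|exists x].
  by apply: (LU F') => //; split => // p pL; apply: H2; rewrite mem_cat pL orbT.
have [x [Fx Gx]] : (F : set T) `&` G !=set0 by move: BF; rewrite BE.
have [p [px pG]] := Ob_base oG Gx.
exists (p :: L1, L2); split.
  by split => // q; rewrite inE => /predU1P[->|]; [exists x|exact: LF1].
move=> F' [H1 H2] C; rewrite inE => /predU1P[->|Cs].
  rewrite BE /=; have [y [F'y py]] := H1 p (mem_head _ _).
  by exists y; split => //; exact: pG.
by apply: (LU F') => //; split => // q qL; apply: H1; rewrite inE qL orbT.
Qed.

Context {d : measure_display} {Om : measurableType d} (f : Om -> CF).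
Hypothesis mhits : forall p, measurable (f @^-1` hits (Ob p)).

Lemma measurable_hits_misses L : measurable (f @^-1` hits_misses L).
Proof.
rewrite (_ : _ @^-1` _ =
    (\bigcap_(p in [set` L.1]) (f @^-1` hits (Ob p))) `&` (\bigcap_(p in [set` L.2]) ~` (f @^-1` hits (Ob p)))).
  apply: measurableI; apply: fin_bigcap_measurable => // p _.
  exact: measurableC.
by apply/seteqP; split=> w [H1 H2]; split=> p; [exact: H1|exact: H2|exact: H1|exact: H2].
Qed.

Lemma measurable_fun_closed_set : measurable_fun setT f.
Proof.
apply: (@measurability _ _ _ _ _ _ (@open CF)) => // _ [U oU <-].
rewrite setTI (_ : _ @^-1` _ = \bigcup_L
    (if `[< hits_misses L `<=` U >] then f @^-1` hits_misses L else set0)).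
  apply: countable_bigcupT_measurable; first exact: countableP.
  by move=> L; case: ifP => // _; exact: measurable_hits_misses.
apply/seteqP; split=> w.
  by move=> /(hits_misses_base oU)[L [LF LU]]; exists L => //; rewrite asboolT.
by move=> [L _]; case: asboolP => // LU /LU.
Qed.

(** A closed set misses a compact set exactly when it misses all sets of some
    finite cover of it. *)
Lemma measurable_hits_compact K : compact K -> measurable (f @^-1` hits K).
Proof.
move=> cK; rewrite -[X in measurable X]setCK; apply: measurableC.
rewrite (_ : ~` _ = \bigcup_(L : seq I)
    (if `[< forall x, K x -> exists2 p, p \in L & Ob p x >] then f @^-1` hits_misses ([::], L) else set0)).
  apply: countable_bigcupT_measurable; first exact: countableP.
  by move=> L; case: ifP => // _; exact: measurable_hits_misses.
apply/seteqP; split=> w.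
  move=> nh; have FK : f w `&` K = set0.
    by apply/eqP/negPn/negP => /set0P.
  have [L [LF LK]] := compact_cover_base cK (@closed_setP _ (f w)) FK.
  exists L => //; rewrite asboolT//; split => // p /LF pF [x [fx px]].
  by have : (Ob p `&` f w) x by []; rewrite pF.
move=> [L _]; case: asboolP => // LK [_ H] [x [fx /LK[p pL px]]].
by apply: (H p pL); exists x.
Qed.

End fell.

Section fell_rV.
Context {R : realType} {n : nat}.
Local Notation E := 'rV[R]_n.
Local Notation I := ({ffun 'I_n -> rat} * nat)%type.

Definition rat_row (p : I) : E := \row_i ratr (p.1 i).

Definition rat_ball (p : I) : set E := [set v | forall i, `|rat_row p ord0 i - v ord0 i| < 2 ^- p.2].

Definition rat_cball (p : I) : set E := [set v | forall i, `|rat_row p ord0 i - v ord0 i| <= 2 ^- p.2].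

Lemma rat_ball_open p : open (rat_ball p).
Proof.
have e0 : 0 < 2 ^- p.2 :> R by rewrite invr_gt0 exprn_gt0.
rewrite (_ : rat_ball p = ball (rat_row p) (2 ^- p.2)); first exact: ball_open.
apply/seteqP; split=> v H; first by split=> // i j; rewrite ord1; exact: H.
by move=> i; have [_ /(_ ord0 i)] := H.
Qed.

Lemma rat_ball_base (G : set E) x : open G -> G x ->
  exists p, [/\ rat_ball p x, rat_ball p `<=` rat_cball p & rat_cball p `<=` G].
Proof.
move=> oG Gx; have /nbhs_ballP[e /= e0 eG] := open_nbhs_nbhs (conj oG Gx).
have [k ke] : exists k, 2 ^- k < e / 2 :> R.
  have z1 : `|2^-1 : R| < 1 by rewrite ger0_norm ?invr_ge0// invf_lt1// ltr1n.
  have e20 : 0 < e / 2 by rewrite divr_gt0.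
  move: (cvg_expr z1) => /cvgrPdist_lt /(_ _ e20)[k _ /(_ k (leqnn k)) /=].
  rewrite sub0r normrN exprVn ger0_norm// ?invr_ge0 ?exprn_ge0// => ke.
  by exists k.
have k0 : 0 < 2 ^- k :> R by rewrite invr_gt0 exprn_gt0.
have ex i : exists q : rat, `|ratr q - x ord0 i| < 2 ^- k.
  have lt12 : x ord0 i - 2 ^- k < x ord0 i + 2 ^- k by lra.
  have [q] := rat_in_itvoo lt12.
  rewrite in_itv/= => /andP[a b]; exists q; rewrite ltr_norml; apply/andP; split; lra.
pose q i := projT1 (cid (ex i)).
exists ([ffun i => q i], k); split.
- by move=> i; rewrite mxE ffunE; exact: (projT2 (cid (ex i))).
- by move=> v H i; exact/ltW.
- move=> v H; apply: eG; split => // i j; rewrite ord1 /ball/=.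
  have := H j; have := projT2 (cid (ex j)); rewrite mxE ffunE -/(q j) => a b.
  rewrite -(subrKA (ratr (q j))) (le_lt_trans (ler_normD _ _))//.
  by rewrite distrC (lt_le_trans (ltr_leD a b))//; lra.
Qed.

Lemma compact_rat_cball p : compact (rat_cball p).
Proof.
rewrite (_ : rat_cball p = [set v : E | forall i,
   (`[rat_row p ord0 i - 2 ^- p.2, rat_row p ord0 i + 2 ^- p.2]%classic) (v ord0 i)]).
  apply: (@rV_compact R n (fun i => `[rat_row p ord0 i - 2 ^- p.2, rat_row p ord0 i + 2 ^- p.2]%classic)).
  by move=> i; exact: segment_compact.
apply/seteqP; split=> v H i; have := H i; rewrite /= in_itv/= ler_norml => /andP[a b];
  apply/andP; split; lra.
Qed.

Context {d : measure_display} {Om : measurableType d} (f g : Om -> closed_set E).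
Hypothesis mf : forall p, measurable (f @^-1` hits (rat_ball p)).
Hypothesis mg : forall p, measurable (g @^-1` hits (rat_ball p)).

Let base_ (G : set E) x : open G -> G x -> exists p, rat_ball p x /\ rat_ball p `<=` G.
Proof.
move=> oG Gx; have [p [px pc pG]] := rat_ball_base oG Gx.
by exists p; split => //; exact: subset_trans pG.
Qed.

Lemma measurable_fun_closed_rV : measurable_fun setT f.
Proof. exact: (measurable_fun_closed_set rat_ball_open base_ mf). Qed.

(** Two different closed sets are told apart by a compact cube with rational data
    which meets one of them and misses the other. *)
Lemma measurable_differ_on (B : set E) : closed B ->
  measurable [set w | closed_set_val (f w) `&` B <> closed_set_val (g w) `&` B].
Proof.
move=> cB.
pose dif (u v : Om -> closed_set E) p := u @^-1` hits (B `&` rat_cball p) `&` ~` (v @^-1` hits (rat_cball p)).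
have mcB p : compact (B `&` rat_cball p).
  rewrite setIC; apply: compact_closedI => //; exact: compact_rat_cball.
have mdif u v : (forall p, measurable (u @^-1` hits (rat_ball p))) ->
    (forall p, measurable (v @^-1` hits (rat_ball p))) -> forall p, measurable (dif u v p).
  move=> mu mv p; apply: measurableI.
    exact: (measurable_hits_compact rat_ball_open base_ mu).
  apply: measurableC; apply: (measurable_hits_compact rat_ball_open base_ mv).
  exact: compact_rat_cball.
have sub u v w : ~ (exists p, dif u v p w) -> closed_set_val (u w) `&` B `<=` closed_set_val (v w) `&` B.
  move=> H x [ux Bx]; split => //; apply: contrapT => vx; apply: H.
  have [p [px pc pv]] := rat_ball_base (closed_openC (@closed_setP _ (v w))) vx.
  exists p; split; first by exists x; split => //; split => //; exact: pc.
  by move=> [y [vy /pv]].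
rewrite (_ : mkset _ = (\bigcup_p dif f g p) `|` (\bigcup_p dif g f p)).
  apply: measurableU; apply: countable_bigcupT_measurable; try exact: countableP.
    exact: mdif.
  exact: mdif.
apply/seteqP; split=> w.
  move=> /= ne; apply: contrapT => /not_orP[H1 H2]; apply: ne.
  by apply/seteqP; split; apply: sub => -[p Hp]; [apply: H1|apply: H2]; exists p.
have noteq u v p : dif u v p w -> closed_set_val (u w) `&` B <> closed_set_val (v w) `&` B.
  move=> [[x [ux [Bx px]]] nv] /seteqP[/(_ x (conj ux Bx)) [vx _] _].
  by apply: nv; exists x.
by move=> [[p _ /noteq]|[p _ /noteq H] /esym].
Qed.

End fell_rV.

(** * The power function of the sphere through the points of a tuple *)

Section power_distance.
Context {R : realType} {n : nat}.
Local Notation E := 'rV[R]_n.+1.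
Local Notation H := (E * measurableTypeR R)%type.
Implicit Types (p : 'I_n.+2 -> H) (q : H) (v w : E).

Definition nsq v : R := \sum_i v ord0 i ^+ 2.
Definition dotv v w : R := \sum_i v ord0 i * w ord0 i.

Lemma nsq_ge0 v : 0 <= nsq v.
Proof. by apply: sumr_ge0 => i _; exact: sqr_ge0. Qed.

Lemma enorm_sqr v : enorm v ^+ 2 = nsq v.
Proof. by rewrite sqr_sqrtr// nsq_ge0. Qed.

Lemma enorm_ge0 v : 0 <= enorm v. Proof. exact: sqrtr_ge0. Qed.

Lemma nsqB v w : nsq (v - w) = nsq v - 2 * dotv v w + nsq w.
Proof.
rewrite /nsq /dotv mulr_sumr -sumrB -big_split/=; apply: eq_bigr => i _.
by rewrite !mxE; ring.
Qed.

Lemma nsq_eq0 v : nsq v = 0 -> v = 0.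
Proof.
move=> /eqP; rewrite psumr_eq0 => [/allP H|i _]; last exact: sqr_ge0.
apply/rowP => i; rewrite mxE; apply/eqP; rewrite -sqrf_eq0.
by apply: H; rewrite mem_index_enum.
Qed.

(** The point with a leading coordinate one: affine maps become linear. *)
Definition lift1 v : 'rV[R]_n.+2 := @rV_cons R n.+1 (v, 1).

Lemma lift10 v : lift1 v ord0 ord0 = 1. Proof. exact: (rV_cons0 (v, 1)). Qed.

Lemma lift1S v i : lift1 v ord0 (lift ord0 i) = v ord0 i.
Proof. exact: (rV_consS (v, 1)). Qed.

Lemma lift1_mul v (s : 'cV[R]_n.+2) :
  (lift1 v *m s) ord0 ord0 = s ord0 ord0 + \sum_i v ord0 i * s (lift ord0 i) ord0.
Proof.
rewrite mxE big_ord_recl lift10 mul1r; congr (_ + _).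
by apply: eq_bigr => i _; rewrite lift1S.
Qed.

Definition affine_mx p : 'M[R]_n.+2 := \matrix_(i, j) lift1 (p i).1 ord0 j.

Lemma affine_mxE p i j : affine_mx p i j = lift1 (p i).1 ord0 j.
Proof. by rewrite mxE. Qed.

Lemma row_affine_mx p i : row i (affine_mx p) = lift1 (p i).1.
Proof. by apply/rowP => j; rewrite mxE affine_mxE. Qed.

Lemma mul_affine_mx p (u : 'rV[R]_n.+2) :
  u *m affine_mx p = @rV_cons R n.+1 (\sum_i u ord0 i *: (p i).1, \sum_i u ord0 i).
Proof.
apply/rowP => j; rewrite mxE; have [k ->|->] := unliftP ord0 j.
  rewrite rV_consS summxE; apply: eq_bigr => i _.
  by rewrite affine_mxE lift1S [RHS]mxE.
by rewrite rV_cons0; apply: eq_bigr => i _; rewrite affine_mxE lift10 mulr1.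
Qed.

(** An affine dependence is a vector of the row kernel of [affine_mx p]. *)
Lemma affinely_independentP p :
  affinely_independent (fun i => (p i).1) <-> affine_mx p \in unitmx.
Proof.
rewrite -row_free_unit; split=> [ai|/row_freeP[B MB] a a0 ap i].
  apply: inj_row_free => u; rewrite mul_affine_mx => u0; apply/rowP => i; rewrite mxE.
  apply: ai => {i}.
    by move/rowP/(_ ord0): u0; rewrite rV_cons0 mxE.
  by apply/rowP => j; move/rowP/(_ (lift ord0 j)): u0; rewrite rV_consS !mxE.
pose u : 'rV[R]_n.+2 := \row_i a i.
have u0 : u *m affine_mx p = 0.
  rewrite mul_affine_mx; apply/rowP => j; rewrite [RHS]mxE.
  have [k ->|->] := unliftP ord0 j.
    rewrite rV_consS /=; under eq_bigr do rewrite mxE.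
    by rewrite ap mxE.
  by rewrite rV_cons0 /=; under eq_bigr do rewrite mxE.
have : u = 0 by rewrite -[u]mulmx1 -MB mulmxA u0 mul0mx.
by move=> /rowP/(_ i); rewrite !mxE.
Qed.

Definition heights p : 'cV[R]_n.+2 := \col_i (nsq (p i).1 + (p i).2 ^+ 2).

(** The coefficients of the affine function of the location that agrees with the
    squared Euclidean norm at all points of [p]. *)
Definition sphere_coef p : 'cV[R]_n.+2 := invmx (affine_mx p) *m heights p.

(** The power of [q] with respect to the unique hemisphere with centre at height
    zero through the points of [p], see [powerE] and [power_unique]. It is negative
    exactly inside the half-ball. The formula is affine in the squared heights,
    which the comparison of the models relies on. *)
Definition power p q : R :=
  nsq q.1 + q.2 ^+ 2 - (lift1 q.1 *m sphere_coef p) ord0 ord0.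

Definition circumcenter p : E := \row_i (sphere_coef p (lift ord0 i) ord0 / 2).

Definition radius2 p : R := sphere_coef p ord0 ord0 + nsq (circumcenter p).

Lemma powerE p q : power p q = nsq (q.1 - circumcenter p) + q.2 ^+ 2 - radius2 p.
Proof.
rewrite /power lift1_mul nsqB /radius2 /dotv mulr_sumr.
rewrite (eq_bigr (fun i => 2 * (q.1 ord0 i * circumcenter p ord0 i))); last first.
  by move=> i _; rewrite !mxE; field.
ring.
Qed.

Lemma power_vertex p i : affine_mx p \in unitmx -> power p (p i) = 0.
Proof.
move=> uM; rewrite /power /sphere_coef -row_affine_mx mulmxA -row_mul mulmxV//.
by rewrite -row_mul mul1mx !mxE subrr.
Qed.

Lemma affine_mx_inj p : affine_mx p \in unitmx -> injective (fun i => (p i).1).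
Proof.
move=> uM i j ij; apply/eqP/negPn/negP => nij.
have ai := (affinely_independentP p).2 uM.
pose a k : R := (k == i)%:R - (k == j)%:R.
have S (F : 'I_n.+2 -> E) : \sum_k a k *: F k = F i - F j.
  rewrite (bigD1 i)//= (bigD1 j) 1?eq_sym//= /a eqxx (negbTE nij) eqxx eq_sym (negbTE nij) big1.
    by rewrite subr0 sub0r scale1r scaleN1r addr0.
  by move=> k /andP[/negbTE -> /negbTE ->]; rewrite subrr scale0r.
have a0 : \sum_k a k = 0.
  rewrite (bigD1 i)//= (bigD1 j) 1?eq_sym//= /a eqxx (negbTE nij) eqxx eq_sym (negbTE nij) big1.
    by rewrite subr0 sub0r addr0 subrr.
  by move=> k /andP[/negbTE -> /negbTE ->]; rewrite subrr.
have := ai a a0; rewrite S ij subrr => /(_ erefl i)/eqP.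
by rewrite /a eqxx (negbTE nij) subr0 oner_eq0.
Qed.

Lemma radius2_gt0 p : affine_mx p \in unitmx -> 0 < radius2 p.
Proof.
move=> uM; have r2 i : radius2 p = nsq ((p i).1 - circumcenter p) + (p i).2 ^+ 2.
  by apply/esym/eqP; rewrite -subr_eq0 -powerE power_vertex.
have r0 : 0 <= radius2 p by rewrite (r2 ord0) addr_ge0 ?nsq_ge0 ?sqr_ge0.
rewrite lt_neqAle r0 andbT; apply/eqP => /esym r20.
have c i : (p i).1 = circumcenter p.
  apply/eqP; rewrite -subr_eq0; apply/eqP/nsq_eq0/eqP.
  move: (r2 i); rewrite r20 => /esym/eqP; rewrite paddr_eq0 ?nsq_ge0 ?sqr_ge0//.
  by case/andP.
have /(affine_mx_inj uM) : (p ord0).1 = (p (lift ord0 ord0)).1 by rewrite !c.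
by move/eqP; rewrite (negbTE (neq_lift _ _)).
Qed.

Lemma power_unique p w r : affine_mx p \in unitmx ->
  (forall i, nsq ((p i).1 - w) + (p i).2 ^+ 2 = r ^+ 2) ->
  forall q, power p q = nsq (q.1 - w) + q.2 ^+ 2 - r ^+ 2.
Proof.
move=> uM pr; pose s : 'cV[R]_n.+2 := \col_i
  (if unlift ord0 i is Some j then 2 * w ord0 j else r ^+ 2 - nsq w).
have ls v : (lift1 v *m s) ord0 ord0 = r ^+ 2 - nsq w + 2 * dotv v w.
  rewrite lift1_mul /s mxE unlift_none; congr (_ + _).
  rewrite /dotv mulr_sumr; apply: eq_bigr => i _; rewrite mxE liftK; ring.
have sE : sphere_coef p = s.
  rewrite /sphere_coef -[RHS](mulKmx uM); congr (_ *m _).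
  apply/colP => i; rewrite mxE.
  have -> : (affine_mx p *m s) i ord0 = (lift1 (p i).1 *m s) ord0 ord0.
    by rewrite -row_affine_mx -row_mul [RHS]mxE.
  by rewrite ls; move: (pr i); rewrite nsqB => <-; ring.
by move=> q; rewrite /power sE ls nsqB; ring.
Qed.

Definition is_delaunay (eta : set H) p : Prop :=
  [/\ forall i, eta (p i), affine_mx p \in unitmx & forall q, eta q -> 0 <= power p q].

(** The half-ball of a tuple is unique, so its emptiness is the sign condition of
    [is_delaunay]. *)
Lemma hyperbolic_delaunayP (eta : set H) (C : set E) :
  hyperbolic_delaunay (d := n.+2) eta C <->
  exists p : 'I_n.+2 -> H, is_delaunay eta p /\ C = simplex (fun i => (p i).1).
Proof.
split=> [[p [pinj ep /affinely_independentP uM [w [r [r0 pr emp]]] ->]]|[p [[ep uM emp] ->]]].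
  exists p; split => //; split => // q eq.
  rewrite (@power_unique p w r uM); last by move=> i; rewrite -enorm_sqr; exact: pr.
  by rewrite subr_ge0 leNgt -enorm_sqr; apply/negP; exact: emp.
exists p; split => //.
- by move=> i j /(congr1 fst); exact: affine_mx_inj.
- exact/affinely_independentP.
- have r0 := radius2_gt0 uM.
  exists (circumcenter p), (Num.sqrt (radius2 p)); rewrite sqr_sqrtr ?ltW//; split.
  + by rewrite sqrtr_gt0.
  + by move=> i; apply/eqP; rewrite enorm_sqr -subr_eq0 -powerE power_vertex.
  + by move=> q eq; rewrite enorm_sqr -subr_lt0 -powerE ltNge emp.
Qed.

(** Points at height zero: the classical tessellation becomes a special case of the
    hyperbolic one. *)
Definition flat (c : set E) : set H := [set (x, 0) | x in c].

Lemma delaunay_flat (eta : set E) :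
  delaunay (d := n.+2) eta = hyperbolic_delaunay (d := n.+2) (flat eta).
Proof.
apply/seteqP; split=> C.
  move=> [x [xinj ex ai [w [r [r0 xr emp]]] ->]].
  exists (fun i => (x i, 0)); split => //.
  - by move=> i j [] /xinj.
  - by move=> i; exists (x i).
  - exists w, r; split => // [i|_ [q eq <-]] /=; first by rewrite xr expr0n addr0.
    rewrite expr0n addr0 => H; apply: (emp q eq).
    by rewrite -(@ltr_pXn2r _ 2%N)// ?nnegrE ?enorm_ge0// ltW.
move=> [p [pinj ep ai [w [r [r0 pr emp]]] ->]].
have pE i : p i = ((p i).1, 0) by have [x _ <-] := ep i.
have p2 i : (p i).2 = 0 by rewrite pE.
exists (fun i => (p i).1); split => //.
- by move=> i j ij; apply: pinj; rewrite pE ij -pE.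
- by move=> i; have [x ex <-] := ep i.
- exists w, r; split => // [i|q eq].
    move: (pr i); rewrite p2 expr0n addr0 => H; apply/eqP.
    by rewrite -(@eqrXn2 _ 2%N)// ?enorm_ge0 ?ltW//; apply/eqP.
  move=> H; apply: (emp (q, 0)); first by exists q.
  by rewrite /= expr0n addr0 ltr_pXn2r// ?nnegrE ?enorm_ge0// ltW.
Qed.

End power_distance.

(** * Barycentric coordinates *)

Section barycentric.
Context {R : realType} {n : nat}.
Local Notation E := 'rV[R]_n.+1.
Local Notation H := (E * measurableTypeR R)%type.
Implicit Types (p : 'I_n.+2 -> H) (q : H) (v w x : E).

Definition bary p x : 'rV[R]_n.+2 := lift1 x *m invmx (affine_mx p).

Lemma baryE p x i : bary p x ord0 i = (lift1 x *m col i (invmx (affine_mx p))) ord0 ord0.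
Proof. by rewrite /bary !mxE; apply: eq_bigr => j _; rewrite !mxE. Qed.

Lemma bary_comb p x : affine_mx p \in unitmx ->
  x = \sum_i bary p x ord0 i *: (p i).1 /\ \sum_i bary p x ord0 i = 1.
Proof.
move=> uM; have := mul_affine_mx p (bary p x); rewrite /bary mulmxKV// => lx; split.
  apply/rowP => j; move/rowP/(_ (lift ord0 j)): lx.
  by rewrite lift1S rV_consS.
by move/rowP/(_ ord0): lx; rewrite lift10 rV_cons0.
Qed.

Lemma bary_unique p (t : 'I_n.+2 -> R) : affine_mx p \in unitmx -> \sum_i t i = 1 ->
  forall i, bary p (\sum_i t i *: (p i).1) ord0 i = t i.
Proof.
move=> uM t1; pose u : 'rV[R]_n.+2 := \row_i t i.
suff -> : bary p (\sum_i t i *: (p i).1) = u by move=> i; rewrite mxE.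
rewrite /bary; apply: (canLR (mulmxK uM)); rewrite mul_affine_mx.
rewrite /lift1; congr rV_cons; congr pair.
  by apply: eq_bigr => i _; rewrite mxE.
by rewrite -t1; apply: eq_bigr => i _; rewrite mxE.
Qed.

Lemma simplexP p x : affine_mx p \in unitmx ->
  simplex (fun i => (p i).1) x <-> forall i, 0 <= bary p x ord0 i.
Proof.
move=> uM; split=> [[t [t0 t1 ->]] i|b0]; first by rewrite bary_unique.
by have [xE b1] := bary_comb x uM; exists (fun i => bary p x ord0 i).
Qed.

Lemma bary_continuous p i : continuous (fun x => bary p x ord0 i).
Proof.
set s := col i (invmx (affine_mx p)).
rewrite (_ : (fun x => _) = (fun x => s ord0 ord0 + \sum_j x ord0 j * s (lift ord0 j) ord0)); last first.
  by apply/funext => x; rewrite baryE lift1_mul.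
apply: cont_add; first exact: cont_cst.
by apply: cont_sum => j _; apply: cont_mul; [exact: (@coord_continuous R 1 n.+1)|exact: cont_cst].
Qed.

Lemma bary_affine p x v (t : R) i :
  bary p (x + t *: (x - v)) ord0 i = (1 + t) * bary p x ord0 i - t * bary p v ord0 i.
Proof.
rewrite !baryE !lift1_mul.
rewrite (eq_bigr (fun j => (1 + t) * (x ord0 j * col i (invmx (affine_mx p)) (lift ord0 j) ord0) -
  t * (v ord0 j * col i (invmx (affine_mx p)) (lift ord0 j) ord0))); last first.
  move=> j _; have -> : (x + t *: (x - v)) ord0 j = x ord0 j + t * (x ord0 j - v ord0 j) by rewrite !mxE.
  by ring.
by rewrite sumrB -!mulr_sumr; ring.
Qed.

Lemma bary_vertex p i j : affine_mx p \in unitmx -> bary p (p i).1 ord0 j = (i == j)%:R.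
Proof.
move=> uM; rewrite /bary -row_affine_mx -row_mul mulmxV// !mxE.
by [].
Qed.

(** The coordinates are continuous, so a point with positive ones is interior. At a
    point where the coordinate [j] vanishes, moving away from the vertex [j]
    makes it negative at once. *)
Lemma boundary_simplexP p x : affine_mx p \in unitmx ->
  boundary (simplex (fun i => (p i).1)) x <->
  (forall i, 0 <= bary p x ord0 i) /\ exists i, bary p x ord0 i = 0.
Proof.
move=> uM; pose S := [set y : E | forall i, 0 <= bary p y ord0 i].
have -> : simplex (fun i => (p i).1) = S.
  by apply/seteqP; split=> y /(simplexP _ uM).
have cS : closed S.
  rewrite (_ : S = \bigcap_(i in [set: 'I_n.+2]) ((fun y => bary p y ord0 i) @^-1` [set r : R | 0 <= r])).
    apply: closed_bigI => i _; apply: closed_comp; last exact: closed_ge.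
    by move=> y _; exact: bary_continuous.
  by apply/seteqP; split=> y Sy i; [move=> _|]; exact: Sy.
rewrite /boundary -(closure_id S).1//; split=> [[Sx nint]|[b0 [j bj]]].
  split => //; apply: contrapT => nz; apply: nint.
  have bp i : 0 < bary p x ord0 i.
    rewrite lt_neqAle Sx andbT; apply/eqP => b0; apply: nz; by exists i.
  suff : \forall y \near x, forall i, 0 < bary p y ord0 i.
    by apply: filterS => y yp i; exact/ltW.
  apply: (@filter_forall _ _ _ (nbhs x) (nbhs_filter x)) => i.
  exact: (cvgr_gt (bary p x ord0 i) (@bary_continuous p i x) _ (bp i)).
split => // nx; have : nbhs x S by [].
have cy : (fun t : R => x + t *: (x - (p j).1)) @ (0 : R) --> x.
  rewrite -[X in _ --> X]addr0; apply: cvgD; first exact: cvg_cst.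
  rewrite -(scale0r (x - (p j).1)); apply: cvgZr_tmp; exact: cvg_id.
move=> /cy /= /nbhs_ballP[e /= e0 eS].
have /eS/(_ j) : ball (0 : R) e (e / 2).
  by rewrite /ball/= sub0r normrN gtr0_norm ?divr_gt0// ltr_pdivrMr// ltr_pMr// ltr1n.
rewrite bary_affine bj bary_vertex// eqxx mulr0 sub0r mulr1 oppr_ge0 leNgt.
by rewrite divr_gt0.
Qed.

End barycentric.

Section continuity.
Context {R : realType} {U : topologicalType}.

Lemma continuous_det k (F : U -> 'M[R]_k) :
  (forall i j, continuous (fun x => F x i j)) -> continuous (fun x => \det (F x)).
Proof.
move=> cF; rewrite /determinant; apply: cont_sum => s _.
by apply: cont_mul; [exact: cont_cst|apply: cont_prod => i _; exact: cF].
Qed.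

Lemma continuous_adj k (F : U -> 'M[R]_k) :
  (forall i j, continuous (fun x => F x i j)) ->
  forall i j, continuous (fun x => (\adj (F x)) i j).
Proof.
move=> cF i j.
rewrite (_ : (fun x => _) = (fun x => (-1) ^+ (j + i) * \det (row' j (col' i (F x))))); last first.
  by apply/funext => x; rewrite mxE.
apply: cont_mul; first exact: cont_cst.
apply: continuous_det => a b; rewrite (_ : (fun _ => _) = (fun x => F x (lift j a) (lift i b))).
  exact: cF.
by apply/funext => y; rewrite !mxE.
Qed.

Lemma continuous_mulmx a b c (F : U -> 'M[R]_(a, b)) (G : U -> 'M[R]_(b, c)) :
  (forall i j, continuous (fun x => F x i j)) -> (forall i j, continuous (fun x => G x i j)) ->
  forall i j, continuous (fun x => (F x *m G x) i j).
Proof.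
move=> cF cG i j; rewrite (_ : (fun x => _) = (fun x => \sum_l F x i l * G x l j)); last first.
  by apply/funext => x; rewrite mxE.
by apply: cont_sum => l _; apply: cont_mul; [exact: cF|exact: cG].
Qed.

Lemma open_lt0 (f : U -> R) : continuous f -> open [set x | f x < 0].
Proof. by move=> cf; apply: (@open_comp _ _ f [set r : R | r < 0]); [move=> x _; exact: cf|exact: open_lt]. Qed.

Lemma open_neq0 (f : U -> R) : continuous f -> open [set x | f x != 0].
Proof. by move=> cf; apply: (@open_comp _ _ f [set r : R | r != 0]); [move=> x _; exact: cf|exact: open_neq]. Qed.

End continuity.

(** * The event that the skeleton hits an open set *)

Section hit_formula.
Context {R : realType} {n : nat}.
Local Notation E := 'rV[R]_n.+1.
Local Notation H := (E * measurableTypeR R)%type.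
Implicit Types (p : 'I_n.+2 -> H) (q : H) (v w x : E) (c : set H).

(** Tuples are coded as the rows of a matrix, so that openness of a condition on
    tuples refers to the topology of matrices. *)
Definition row_point k (A : 'M[R]_(k, n.+2)) (i : 'I_k) : H :=
  (\row_j A i (lift ord0 j), A i ord0).

Lemma row_point_tuple k (p : 'I_k -> H) : row_point (tuple_mx p) = p.
Proof.
apply/funext => i; rewrite /row_point; case Ep : (p i) => [v y]; congr pair.
  by apply/rowP => j; rewrite mxE /tuple_mx [LHS]mxE Ep; exact: (rV_consS (v, y)).
by rewrite /tuple_mx [LHS]mxE Ep; exact: (rV_cons0 (v, y)).
Qed.

Lemma affine_mx_continuous k (f : 'I_n.+2 -> 'I_k) i j :
  continuous (fun A : 'M[R]_(k, n.+2) => affine_mx (fun i => row_point A (f i)) i j).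
Proof.
have [l ->|->] := unliftP ord0 j.
  rewrite (_ : (fun _ => _) = (fun A : 'M[R]_(k, n.+2) => A (f i) (lift ord0 l))).
    exact: coord_continuous.
  by apply/funext => A; rewrite affine_mxE lift1S mxE.
rewrite (_ : (fun _ => _) = (fun A : 'M[R]_(k, n.+2) => 1)); first exact: cont_cst.
by apply/funext => A; rewrite affine_mxE lift10.
Qed.

Definition hit_set (G : set E) : set 'M[R]_(n.+2, n.+2) :=
  [set A | affine_mx (row_point A) \in unitmx /\
     boundary (simplex (fun i => (row_point A i).1)) `&` G !=set0].

(** The point of the boundary in [G] is moved along with the vertices by keeping its
    barycentric coordinates. *)
Lemma open_hit_set G : open G -> open (hit_set G).
Proof.
move=> oG; rewrite openE => A [uM [x [bx Gx]]].
have [b0 [l bl]] := (boundary_simplexP x uM).1 bx.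
pose t i := bary (row_point A) x ord0 i.
have [xE t1] := bary_comb x uM.
have /nbhs_ballP[e /= e0 eG] := open_nbhs_nbhs (conj oG Gx).
(* the point with the same barycentric coordinates in the moved simplex *)
pose y (B : 'M[R]_(n.+2, n.+2)) : E := \sum_i t i *: (row_point B i).1.
have n1 : \forall B \near A, \det (affine_mx (row_point B)) != 0.
  have oD := open_neq0 (continuous_det (fun i j => @affine_mx_continuous n.+2 id i j)).
  apply: open_nbhs_nbhs; split; first exact: oD.
  by move: uM; rewrite unitmxE unitfE.
have n2 : \forall B \near A, forall j, `|x ord0 j - y B ord0 j| < e.
  apply: (@filter_forall _ _ _ (nbhs A) (nbhs_filter A)) => j.
  have cy : continuous (fun B => y B ord0 j).
    rewrite (_ : (fun B => _) = (fun B : 'M[R]_(n.+2, n.+2) => \sum_i t i * B i (lift ord0 j))).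
      apply: cont_sum => i _; apply: cont_mul; first exact: cont_cst.
      exact: coord_continuous.
    by apply/funext => B; rewrite /y summxE; apply: eq_bigr => i _; rewrite !mxE.
  have yA : y A = x by rewrite /y [RHS]xE.
  by have /cvgrPdist_lt/(_ e e0) := cy A; rewrite yA.
apply: filterS2 n1 n2 => B dB yB.
have uB : affine_mx (row_point B) \in unitmx by rewrite unitmxE unitfE.
split => //; exists (y B); split.
  apply/boundary_simplexP => //; have bt i : bary (row_point B) (y B) ord0 i = t i.
    exact: bary_unique.
  by split=> [i|]; [rewrite bt; exact: b0|exists l; rewrite bt].
by apply: eG; split => // i j; rewrite ord1; exact: yB.
Qed.

(** Row zero lies inside the half-ball of the other rows. *)
Definition conflict_set : set 'M[R]_(n.+3, n.+2) :=
  [set A | affine_mx (fun i => row_point A (lift ord0 i)) \in unitmx /\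
     power (fun i => row_point A (lift ord0 i)) (row_point A ord0) < 0].

(** Multiplied by the square of the determinant, the condition is the negativity of
    a polynomial in the entries. *)
Lemma open_conflict_set : open conflict_set.
Proof.
pose M (A : 'M[R]_(n.+3, n.+2)) := affine_mx (fun i => row_point A (lift ord0 i)).
pose h (A : 'M[R]_(n.+3, n.+2)) := heights (fun i => row_point A (lift ord0 i)).
pose q (A : 'M[R]_(n.+3, n.+2)) := row_point A ord0.
pose D A := \det (M A) * (\det (M A) * (nsq (q A).1 + (q A).2 ^+ 2) -
  (lift1 (q A).1 *m (\adj (M A) *m h A)) ord0 ord0).
have DE A : M A \in unitmx ->
    D A = \det (M A) ^+ 2 * power (fun i => row_point A (lift ord0 i)) (q A).
  move=> uM; have d0 : \det (M A) != 0 by rewrite -unitfE -unitmxE.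
  rewrite /power /sphere_coef /invmx -/(M A) uM -scalemxAl -scalemxAr [X in _ = _ * (_ - X)]mxE.
  rewrite -/(h A) /D; move: ((lift1 _ *m _) _ _) (\det _) (nsq _ + _) d0 => x d y d0.
  by field.
have -> : conflict_set = [set A | D A < 0].
  apply/seteqP; split=> A /=; rewrite /conflict_set /=.
    move=> [uM pA]; have d0 : \det (M A) != 0 by rewrite -unitfE -unitmxE.
    by rewrite DE// pmulr_rlt0// exprn_even_gt0.
  move=> DA; have d0 : \det (M A) != 0.
    by apply: contraTneq DA => d0; rewrite /D d0 mul0r ltxx.
  have uM : M A \in unitmx by rewrite unitmxE unitfE.
  by split => //; move: DA; rewrite DE// pmulr_rlt0// exprn_even_gt0.
have cM i j : continuous (fun A => M A i j) by exact: (@affine_mx_continuous n.+3 (lift ord0)).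
have cdet : continuous (fun A => \det (M A)) by exact: continuous_det.
have cnsq i : continuous (fun A : 'M[R]_(n.+3, n.+2) => nsq (row_point A i).1 + (row_point A i).2 ^+ 2).
  apply: cont_add.
    apply: cont_sum => j _; rewrite (_ : (fun _ => _) = (fun A : 'M[R]_(n.+3, n.+2) => A i (lift ord0 j) * A i (lift ord0 j))).
      by apply: cont_mul; exact: coord_continuous.
    by apply/funext => A; rewrite /row_point /= mxE expr2.
  rewrite (_ : (fun _ => _) = (fun A : 'M[R]_(n.+3, n.+2) => A i ord0 * A i ord0)).
    by apply: cont_mul; exact: coord_continuous.
  by apply/funext => A; rewrite /row_point /= expr2.
apply: open_lt0; apply: cont_mul => //; apply: cont_sub; first by apply: cont_mul => //; exact: (cnsq ord0).
apply: (continuous_mulmx (F := fun A => lift1 (q A).1)) => [i j|i j].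
  rewrite ord1; have [l ->|->] := unliftP ord0 j.
    rewrite (_ : (fun _ => _) = (fun A : 'M[R]_(n.+3, n.+2) => A ord0 (lift ord0 l))).
      exact: coord_continuous.
    by apply/funext => A; rewrite lift1S mxE.
  rewrite (_ : (fun _ => _) = (fun A : 'M[R]_(n.+3, n.+2) => 1)); first exact: cont_cst.
  by apply/funext => A; rewrite lift10.
apply: (continuous_mulmx (F := fun A => \adj (M A))) => [a b|a b].
  exact: continuous_adj.
rewrite (_ : (fun _ => _) = (fun A : 'M[R]_(n.+3, n.+2) => nsq (row_point A (lift ord0 a)).1 + (row_point A (lift ord0 a)).2 ^+ 2)) //.
by apply/funext => A; rewrite /h mxE.
Qed.

(** Only the locations are bounded: compressing a configuration does not change which
    of its points lie in a window. *)
Definition window (k : nat) : set H := [set q : H | forall i, `|q.1 ord0 i| <= k%:R].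

Definition locally_finite c := forall k, finite_set (c `&` window k).

Definition insert_point p q : 'I_n.+3 -> H :=
  fun i => if unlift ord0 i is Some j then p j else q.

Lemma finite_enum (A : set H) : finite_set A ->
  exists k (s : 'I_k -> H), injective s /\ forall q, A q <-> exists i, s i = q.
Proof.
move=> finA; pose s := enum_fset (fset_set A).
have us : uniq s by exact: fset_uniq.
have sA q : A q <-> q \in s by rewrite in_fset_set// inE.
exists (size s), (fun i => tnth (in_tuple s) i); split=> [i j /eqP|q].
  by rewrite !(tnth_nth point) nth_uniq// => /eqP/val_inj.
rewrite sA; split=> [/(tnthP (in_tuple s))[i ->]|[i <-]]; first by exists i.
exact: mem_tnth.
Qed.

(** Only finitely many points lie near the tuple, and these are separated by cubes that
    are small enough. *)
Lemma isolating_cells c p : locally_finite c -> injective p -> (forall i, c (p i)) ->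
  exists m, injective (dyadic_index m \o p) /\
    forall i q, c q -> dyadic_index m q = dyadic_index m (p i) -> q = p i.
Proof.
move=> lf pinj cp.
have [k pk] : exists k, forall i, window k (p i).
  pose b i j := Num.truncn `|(p i).1 ord0 j|.
  exists (\max_i \max_j b i j).+1 => i j.
  rewrite (le_trans (ltW (truncnS_gt _)))// ler_nat ltnS -/(b i j).
  by rewrite (leq_trans _ (leq_bigmax i))// (leq_trans _ (leq_bigmax j)).
have [N [s [sinj sP]]] := finite_enum (lf k.+1).
have [m Hm] := dyadic_separation sinj.
have near q i : c q -> dyadic_index m q = dyadic_index m (p i) -> window k.+1 q.
  move=> cq qp j; have := @dyadic_index_near R n.+1 m q (p i) (lift ord0 j) qp.
  rewrite [rV_cons q _ _]rV_consS [rV_cons (p i) _ _]rV_consS => d.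
  have P1 : 2 ^- m <= 1 :> R by rewrite invf_le1 ?exprn_gt0// exprn_ege1// ler1n.
  rewrite -(subrK ((p i).1 ord0 j) (q.1 ord0 j)) (le_trans (ler_normD _ _))//.
  by rewrite -natr1 addrC lerD ?pk// (le_trans (ltW d)).
have uniq_ q i : c q -> dyadic_index m q = dyadic_index m (p i) -> q = p i.
  move=> cq qp; have [a sa] : exists a, s a = q by apply/sP; split => //; exact: near qp.
  have [b sb] : exists b, s b = p i.
    by apply/sP; split=> //; exact: (near _ i).
  rewrite -sa -sb; congr s; apply: (Hm m (leqnn _)).
  by rewrite /= sa sb.
by exists m; split => [i j ij|i q]; [apply: pinj; exact: uniq_ ij|exact: uniq_].
Qed.

Definition in_cells m (z : {ffun 'I_n.+2 -> {ffun 'I_n.+2 -> int}}) (i : 'I_n.+2) : set H :=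
  [set q | dyadic_index m q = z i].

Definition in_cells_any m (z : {ffun 'I_n.+2 -> {ffun 'I_n.+2 -> int}}) (i : 'I_n.+3) : set H :=
  if unlift ord0 i is Some j then in_cells m z j else setT.

(** The cells [z] determine the tuple, so the second condition says that this tuple has
    an empty half-ball: an intruder is different from the vertices, since the power
    of a vertex is zero. *)
Lemma skeleton_hitP c G : locally_finite c ->
  skeleton (hyperbolic_delaunay (d := n.+2) c) `&` G !=set0 <->
  exists m z, has_tuple (in_cells m z) (hit_set G) c /\
    ~ has_tuple (in_cells_any m z) conflict_set c.
Proof.
move=> lf; split.
  move=> [x [[C /hyperbolic_delaunayP[p [[cp uM emp] ->]] bx] Gx]].
  have pinj : injective p by move=> i j /(congr1 fst); exact: affine_mx_inj.
  have [m [_ Hm]] := isolating_cells lf pinj cp.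
  exists m, [ffun i => dyadic_index m (p i)]; split.
    exists p; split => //.
      by move=> i; split => //; rewrite /in_cells /= ffunE.
    rewrite /hit_set /mkset row_point_tuple; split; first exact: uM.
    by exists x; split.
  move=> [p' [p'inj cp' []]]; rewrite row_point_tuple => uM'.
  have -> : (fun i => p' (lift ord0 i)) = p.
    apply/funext => i; have [cpi] := cp' (lift ord0 i).
    by rewrite /in_cells_any liftK /in_cells /= ffunE; exact: Hm.
  by rewrite ltNge emp//; have [] := cp' ord0.
move=> [m [z [[p [pinj cp [uM [x [bx Gx]]]]] nconf]]].
rewrite row_point_tuple in uM bx.
exists x; split => //; exists (simplex (fun i => (p i).1)) => //.
apply/hyperbolic_delaunayP; exists p; split => //; split => // [i|q cq].
  by have [] := cp i.
rewrite leNgt; apply/negP => pq; apply: nconf.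
have qp i : q <> p i by move=> qp; move: pq; rewrite qp power_vertex// ltxx.
exists (insert_point p q); split.
- move=> i j; rewrite /insert_point.
  have [i' ->|->] := unliftP ord0 i; have [j' ->|->] := unliftP ord0 j => //.
  + by move=> /pinj ->.
  + by move=> /esym/qp.
  + by move=> /qp.
- move=> i; rewrite /insert_point /in_cells_any; case: (unlift ord0 i) => [j|]; first exact: cp.
  by split.
- rewrite /conflict_set /= row_point_tuple /insert_point.
  rewrite (_ : (fun i => _) = p) ?unlift_none//.
  by apply/funext => i; rewrite liftK.
Qed.

End hit_formula.

(** * The Euclidean norm and the grid of cells *)

Section locality.
Context {R : realType} {n : nat}.
Local Notation E := 'rV[R]_n.+1.
Local Notation H := (E * measurableTypeR R)%type.
Implicit Types (p : 'I_n.+2 -> H) (q : H) (v w x : E) (c : set H).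

Lemma nsqN v : nsq (- v) = nsq v.
Proof. by apply: eq_bigr => i _; rewrite mxE sqrrN. Qed.

Lemma enormB v w : enorm (v - w) = enorm (w - v).
Proof. by rewrite /enorm -/(nsq (v - w)) -nsqN opprB. Qed.

Lemma nsqZ (a : R) v : nsq (a *: v) = a ^+ 2 * nsq v.
Proof. by rewrite /nsq mulr_sumr; apply: eq_bigr => i _; rewrite mxE exprMn. Qed.

(** The square of [|w| v - |v| w] is not negative. *)
Lemma dotv_le v w : dotv v w <= enorm v * enorm w.
Proof.
have [v0|v0] := eqVneq (enorm v) 0.
  have /nsq_eq0 -> : nsq v = 0 by rewrite -enorm_sqr v0 expr0n.
  rewrite /dotv big1 ?mulr_ge0 ?enorm_ge0// => i _.
  by rewrite mxE mul0r.
have [w0|w0] := eqVneq (enorm w) 0.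
  have /nsq_eq0 -> : nsq w = 0 by rewrite -enorm_sqr w0 expr0n.
  rewrite /dotv big1 ?mulr_ge0 ?enorm_ge0// => i _.
  by rewrite mxE mulr0.
have d : dotv (enorm w *: v) (enorm v *: w) = enorm w * enorm v * dotv v w.
  by rewrite /dotv mulr_sumr; apply: eq_bigr => i _; rewrite !mxE; ring.
have := nsq_ge0 (enorm w *: v - enorm v *: w).
rewrite nsqB !nsqZ d -!enorm_sqr => H.
have vw : 0 < enorm v * enorm w by rewrite mulr_gt0// lt_neqAle enorm_ge0 eq_sym andbT.
rewrite -(ler_pM2l vw); nra.
Qed.

Lemma enormD v w : enorm (v + w) <= enorm v + enorm w.
Proof.
rewrite -(@ler_pXn2r _ 2)// ?nnegrE ?addr_ge0 ?enorm_ge0// enorm_sqr.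
have := nsqB v (- w); rewrite opprK nsqN => ->.
have -> : dotv v (- w) = - dotv v w.
  by rewrite /dotv -sumrN; apply: eq_bigr => i _; rewrite mxE mulrN.
by have := dotv_le v w; rewrite -!enorm_sqr; nra.
Qed.

Lemma enormZ (a : R) v : 0 <= a -> enorm (a *: v) = a * enorm v.
Proof. by move=> a0; rewrite /enorm -/(nsq _) nsqZ sqrtrM ?sqr_ge0// sqrtr_sqr ger0_norm. Qed.

Lemma coord_le_enorm v i : `|v ord0 i| <= enorm v.
Proof.
rewrite -sqrtr_sqr ler_wsqrtr// (bigD1 i)//= lerDl.
by apply: sumr_ge0 => j _; exact: sqr_ge0.
Qed.

Lemma enorm_le_coord v (a : R) : (forall i, `|v ord0 i| <= a) -> enorm v <= n.+1%:R * a.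
Proof.
move=> va; have a0 : 0 <= a by exact: le_trans (va ord0).
rewrite -(@ler_pXn2r _ 2)// ?nnegrE ?mulr_ge0 ?enorm_ge0// enorm_sqr.
apply: (@le_trans _ _ (\sum_(i < n.+1) a ^+ 2)).
  by apply: ler_sum => i _; rewrite -(real_normK (num_real _)) lerXn2r ?nnegrE.
rewrite sumr_const card_ord -[_ *+ _]mulr_natl exprMn ler_wpM2r ?sqr_ge0//.
by rewrite -natrX ler_nat -{1}(expn1 n.+1) leq_pexp2l.
Qed.

Lemma continuous_nsq : continuous (nsq : E -> R).
Proof.
apply: cont_sum => i _; rewrite (_ : (fun _ => _) = (fun v : E => v ord0 i * v ord0 i)).
  by apply: cont_mul; exact: (@coord_continuous R 1 n.+1).
by apply/funext => v; rewrite expr2.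
Qed.

(** Jensen's inequality: the difference of the two sides is the variance of the
    vertices under the barycentric weights. *)
Lemma nsq_convex p x w : affine_mx p \in unitmx -> (forall i, 0 <= bary p x ord0 i) ->
  nsq (x - w) <= \sum_i bary p x ord0 i * nsq ((p i).1 - w).
Proof.
move=> uM b0; have [xE b1] := bary_comb x uM; set t := bary p x ord0 in b0 xE b1 *.
under eq_bigr do rewrite mulr_sumr.
rewrite exchange_big; apply: ler_sum => j _ /=.
have xj : x ord0 j = \sum_i t i * (p i).1 ord0 j.
  by rewrite xE summxE; apply: eq_bigr => i _; rewrite mxE.
rewrite -subr_ge0 (_ : _ - _ = \sum_i t i * ((p i).1 ord0 j - x ord0 j) ^+ 2).
  by apply: sumr_ge0 => i _; rewrite mulr_ge0 ?sqr_ge0.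
set y := x ord0 j in xj *.
rewrite [RHS](eq_bigr (fun i => t i * ((p i).1 - w) ord0 j ^+ 2 -
   2 * (y - w ord0 j) * (t i * (p i).1 ord0 j) + (y ^+ 2 - w ord0 j ^+ 2) * t i)); last first.
  move=> i _; have -> : ((p i).1 - w) ord0 j = (p i).1 ord0 j - w ord0 j by rewrite !mxE.
  by ring.
rewrite big_split sumrB/= -!mulr_sumr -xj b1.
have -> : (x - w) ord0 j = y - w ord0 j by rewrite !mxE.
by ring.
Qed.

Lemma simplex_in_ball p x : affine_mx p \in unitmx -> (forall i, 0 <= bary p x ord0 i) ->
  nsq (x - circumcenter p) <= radius2 p.
Proof.
move=> uM b0; apply: (le_trans (nsq_convex _ uM b0)).
have [_ b1] := bary_comb x uM.
rewrite -[leRHS]mul1r -b1 mulr_suml; apply: ler_sum => i _; rewrite ler_wpM2l//.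
by rewrite -subr_ge0 -oppr_le0 opprB; have := power_vertex i uM; rewrite powerE; have := sqr_ge0 (p i).2; lra.
Qed.

(** Cells of side [M / (2 (n + 1))] with indices from [- 4 (n + 1)] to [4 (n + 1)]
    cover the cube of half-side [2 M], and two points of one cell have distance at
    most [M / 2]. *)
Definition grid_size := (8 * n.+1).+1.

Definition grid_cell (M : nat) (z : {ffun 'I_n.+1 -> 'I_grid_size}) : set E :=
  [set v | forall i, Num.floor (v ord0 i * (2 * n.+1%:R / M%:R)) = (z i : nat)%:Z - (4 * n.+1)%:Z].

Definition occupied (c : set H) (M : nat) : Prop :=
  forall z, c `&` [set q | grid_cell M z q.1 /\ `|q.2| <= M%:R / 4] !=set0.

Lemma occupied_near c M v : (0 < M)%N -> occupied c M -> (forall i, `|v ord0 i| <= 2 * M%:R) ->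
  exists q, [/\ c q, enorm (q.1 - v) <= M%:R / 2 & `|q.2| <= M%:R / 4].
Proof.
move=> M0 occ vM; have M0' : 0 < M%:R :> R by rewrite ltr0n.
pose h : R := 2 * n.+1%:R / M%:R.
have h0 : 0 < h by rewrite divr_gt0// mulr_gt0// ltr0n.
have hM : h * M%:R = 2 * n.+1%:R by rewrite /h divfK// gt_eqF.
pose f i := Num.floor (v ord0 i * h).
have [f1 f2] : (forall i, (- (4 * n.+1)%:Z <= f i)%R) /\ (forall i, (f i <= (4 * n.+1)%:Z)%R).
  split=> i; rewrite /f; have /ler_normlP[a b] := vM i.
    rewrite floor_ge_int; apply: (@le_trans _ _ (- (2 * M%:R) * h)).
      by rewrite mulNr -mulrA (mulrC M%:R) hM intrN lerN2 -[((4 * n.+1)%N)%:~R]/((4 * n.+1)%N%:R) natrM; lra.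
    by rewrite ler_wpM2r ?(ltW h0)//; lra.
  rewrite -(ler_int R) (le_trans (floor_le_tmp _))//.
  apply: (@le_trans _ _ (2 * M%:R * h)); first by rewrite ler_wpM2r ?(ltW h0)//; lra.
  by rewrite -mulrA (mulrC M%:R) hM -[((4 * n.+1)%N)%:~R]/((4 * n.+1)%N%:R) natrM; lra.
have fb i : (`|(f i + (4 * n.+1)%:Z)%R|%N < grid_size)%N.
  have := f1 i; have := f2 i; rewrite /grid_size; lia.
have [q [cq [qz q2]]] := occ [ffun i => Ordinal (fb i)].
exists q; split => //.
rewrite (_ : M%:R / 2 = n.+1%:R * h^-1); last first.
  rewrite /h invf_div mulrA [n.+1%:R * _]mulrC invfM; field.
  by rewrite addrC natr1 pnatr_eq0.
apply: enorm_le_coord => i.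
have qf : Num.floor (q.1 ord0 i * h) = f i.
  rewrite [LHS]qz ffunE /=; have := f1 i; lia.
have /andP[a1 a2] := floor_itv (q.1 ord0 i * h).
have /andP[b1 b2] := floor_itv (v ord0 i * h).
rewrite qf -/(f i) in a1 a2 b1 b2; rewrite !mxE -(ler_pM2r h0) mulVf ?gt_eqF//.
rewrite -[X in _ * X](gtr0_norm h0) -normrM; apply/ler_normlP.
rewrite intrD in a2 b2.
by split; lra.
Qed.

End locality.

(** * Locality, closedness and measurability of the skeleton *)

Section local_delaunay.
Context {R : realType} {n : nat}.
Local Notation E := 'rV[R]_n.+1.
Local Notation H := (E * measurableTypeR R)%type.
Implicit Types (p : 'I_n.+2 -> H) (q : H) (v w x : E) (c : set H).

(** The Delaunay condition tested on the finitely many points of a window only. *)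
Definition local_delaunay c M p x : Prop :=
  [/\ forall i, (c `&` window (3 * M)) (p i), affine_mx p \in unitmx,
      forall q, (c `&` window (3 * M)) q -> 0 <= power p q &
      forall i, 0 <= bary p x ord0 i].

Lemma enorm_sub_le v w (r : R) : 0 <= r -> nsq (v - w) <= r ^+ 2 -> enorm (v - w) <= r.
Proof. by move=> r0; rewrite -enorm_sqr ler_pXn2r// nnegrE ?enorm_ge0. Qed.

(** Suppose that the radius is at least [M] and walk from [x] towards the centre, by
    [M] or up to the centre. The point [z] which is reached has distance at most
    [r - M] to the centre, and the low point [q] of the configuration near [z] is
    then inside the half-ball. *)
Lemma radius_small c M p x : (0 < M)%N -> occupied c M -> affine_mx p \in unitmx ->
  (forall q, (c `&` window (3 * M)) q -> 0 <= power p q) ->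
  (forall i, 0 <= bary p x ord0 i) -> enorm x <= M%:R -> radius2 p < M%:R ^+ 2.
Proof.
move=> M0 occ uM emp b0 xM; have M0' : 0 < M%:R :> R by rewrite ltr0n.
rewrite ltNge; apply/negP => rM.
set w := circumcenter p; pose d := enorm (x - w); pose r := Num.sqrt (radius2 p).
have r2 : r ^+ 2 = radius2 p by rewrite sqr_sqrtr// ltW// radius2_gt0.
have r0 : 0 <= r by exact: sqrtr_ge0.
have Mr : M%:R <= r by rewrite -(@ler_pXn2r _ 2)// ?nnegrE ?ler0n// r2.
have dr : d <= r by apply: enorm_sub_le => //; rewrite r2; exact: simplex_in_ball.
have d0 : 0 <= d by exact: enorm_ge0.
(* [z] is on the segment from [x] to the centre *)
have [z [zx zw]] : exists z, enorm (z - x) <= M%:R /\ enorm (z - w) <= r - M%:R.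
  have [dM|Md] := leP d M%:R.
    exists w; rewrite enormB subrr; split => //.
    have -> : enorm (0 : E) = 0 by apply/eqP; rewrite -sqrf_eq0 enorm_sqr /nsq big1// => i _; rewrite mxE expr0n.
    by rewrite subr_ge0.
  have dp : 0 < d by exact: lt_trans Md.
  exists (x + (M%:R / d) *: (w - x)); split.
    rewrite addrC addKr enormZ; last by rewrite divr_ge0// ltW.
    by rewrite enormB -/d divfK// gt_eqF.
  rewrite (_ : _ - w = (1 - M%:R / d) *: (x - w)); last first.
    by apply/rowP => i; rewrite !mxE; ring.
  rewrite enormZ; last by rewrite subr_ge0 ler_pdivrMr// mul1r ltW.
  by rewrite -/d mulrBl mul1r divfK ?gt_eqF// lerD2r.
have zM i : `|z ord0 i| <= 2 * M%:R.
  rewrite (le_trans (coord_le_enorm _ _))// -(subrK x z) (le_trans (enormD _ _))//.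
  by rewrite mulr2n mulrDl mul1r lerD.
have [q [cq q1 q2]] := occupied_near M0 occ zM.
have qW : window (3 * M) q.
  move=> i; rewrite (le_trans (coord_le_enorm _ _))//.
  have := enormD (q.1 - z) z; have := enormD (z - x) x; rewrite !subrK natrM; lra.
have := emp q (conj cq qW); apply/negP; rewrite -ltNge powerE -r2 -/w.
have qw : enorm (q.1 - w) <= r - M%:R / 2.
  have := enormD (q.1 - z) (z - w); rewrite addrA subrK; lra.
have e0 := enorm_ge0 (q.1 - w).
have s1 : nsq (q.1 - w) <= (r - M%:R / 2) ^+ 2.
  by rewrite -enorm_sqr lerXn2r// nnegrE; lra.
have s2 : q.2 ^+ 2 <= (M%:R / 4) ^+ 2.
  by rewrite -(real_normK (num_real q.2)) lerXn2r// nnegrE ?normr_ge0//; lra.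
by nra.
Qed.

Lemma in_window_of_ball M q w x : enorm x <= M%:R -> enorm (x - w) <= M%:R ->
  enorm (q.1 - w) <= M%:R -> window (3 * M) q.
Proof.
move=> xM xw qw i; rewrite (le_trans (coord_le_enorm _ _))//.
have := enormD (q.1 - w) w; have := enormD (w - x) x.
rewrite !subrK (enormB w x) natrM; lra.
Qed.

(** By [radius_small] the half-ball has radius less than [M], so everything inside it
    has its location at distance at most [3 M] from the origin. *)
Lemma local_delaunayP c M p x : (0 < M)%N -> occupied c M -> enorm x <= M%:R ->
  local_delaunay c M p x <-> is_delaunay c p /\ forall i, 0 <= bary p x ord0 i.
Proof.
move=> M0 occ xM; have M0' : 0 <= M%:R :> R by rewrite ler0n.
split=> [[cp uM emp b0]|[[cp uM emp] b0]].
  have r2 := radius_small M0 occ uM emp b0 xM.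
  have xw : enorm (x - circumcenter p) <= M%:R.
    by apply: enorm_sub_le => //; rewrite (le_trans (simplex_in_ball uM b0))// ltW.
  split => //; split => // [i|q cq]; first by case: (cp i).
  rewrite leNgt; apply/negP => pq.
  suff qW : window (3 * M) q by move: pq; rewrite ltNge emp.
  apply: in_window_of_ball xM xw _; apply: enorm_sub_le => //.
  by move: pq; rewrite powerE; have := sqr_ge0 q.2; lra.
have r2 : radius2 p < M%:R ^+ 2.
  by apply: radius_small M0 occ uM _ b0 xM => q [cq _]; exact: emp.
have xw : enorm (x - circumcenter p) <= M%:R.
  by apply: enorm_sub_le => //; rewrite (le_trans (simplex_in_ball uM b0))// ltW.
split => // [i|q [cq _]]; last exact: emp.
split => //; apply: in_window_of_ball xM xw _; apply: enorm_sub_le => //.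
by have := power_vertex i uM; rewrite powerE; have := sqr_ge0 (p i).2; lra.
Qed.

Lemma skeleton_local c M x : (0 < M)%N -> occupied c M -> enorm x <= M%:R ->
  skeleton (hyperbolic_delaunay (d := n.+2) c) x <->
  exists p, local_delaunay c M p x /\ exists i, bary p x ord0 i = 0.
Proof.
move=> M0 occ xM; split.
  move=> [C /hyperbolic_delaunayP[p [Dp ->]] /boundary_simplexP].
  move=> /(_ (let: And3 _ h _ := Dp in h))[b0 bi]; exists p; split => //.
  exact/(local_delaunayP _ M0 occ xM).
move=> [p [/(local_delaunayP _ M0 occ xM)[Dp b0] bi]].
exists (simplex (fun i => (p i).1)); first by apply/hyperbolic_delaunayP; exists p.
by apply/boundary_simplexP => //; case: Dp.
Qed.

(** The configurations on which the skeleton depends in a local way on the points. *)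
Definition good c : Prop := locally_finite c /\ forall k, exists2 M, (k <= M)%N & occupied c M.

Lemma good_occupied c k : good c -> exists M, [/\ (k <= M)%N, (0 < M)%N & occupied c M].
Proof. by move=> [_ /(_ k.+1)[M kM occ]]; exists M; split => //; [exact: ltnW|exact: leq_trans kM]. Qed.

(** Near a given point the skeleton is a finite union of boundaries of simplices. *)
Lemma good_skeleton_closed c : good c -> closed (skeleton (hyperbolic_delaunay (d := n.+2) c)).
Proof.
move=> gc; rewrite -openC openE => x nx.
have [M [kM M0 occ]] := good_occupied (Num.truncn (enorm x)).+1 gc.
have xM : enorm x < M%:R by rewrite (lt_le_trans (truncnS_gt _))// ler_nat.
have [N [s [sinj sP]]] := finite_enum (gc.1 (3 * M)%N).
pose S := skeleton (hyperbolic_delaunay (d := n.+2) c).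
have nearM : \forall y \near x, enorm y <= M%:R.
  have : nsq x < M%:R ^+ 2 by rewrite -enorm_sqr ltr_pXn2r// nnegrE ?enorm_ge0.
  move=> /(cvgr_lt (nsq x) (@continuous_nsq R n x)); apply: filterS => y yM.
  by rewrite -(@ler_pXn2r _ 2)// ?nnegrE ?enorm_ge0// enorm_sqr ltW.
pose T := {ffun 'I_n.+2 -> 'I_N}.
pose pt (f : T) : 'I_n.+2 -> H := fun i => s (f i).
have nearf : \forall y \near x, forall f : T, is_delaunay c (pt f) ->
    ~ boundary (simplex (fun i => (pt f i).1)) y.
  apply: (@filter_forall _ _ _ (nbhs x) (nbhs_filter x)) => f.
  have [Df|nDf] := pselect (is_delaunay c (pt f)); last by near=> y => /nDf.
  have : nbhs x (~` boundary (simplex (fun i => (pt f i).1))).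
    apply: open_nbhs_nbhs; split.
      rewrite openC /boundary setDE; apply: closedI; first exact: closed_closure.
      by rewrite closedC; exact: open_interior.
    move=> bx; apply: nx; exists (simplex (fun i => (pt f i).1)) => //.
    by apply/hyperbolic_delaunayP; exists (pt f).
  by apply: filterS => y.
apply: filterS2 nearM nearf => y yM yf.
move=> /(skeleton_local M0 occ yM)[p [lp bi]].
have [cp uM _ b0] := lp.
have [f fE] : exists f : T, pt f = p.
  have g i : {a | s a = p i} by apply: cid; apply/sP; exact: cp.
  by exists [ffun i => sval (g i)]; apply/funext => i; rewrite /pt ffunE; case: (g i).
have [Dp _] := (local_delaunayP p M0 occ yM).1 lp.
apply: (yf f); first by rewrite fE.
by apply/boundary_simplexP; rewrite fE.
Unshelve. all: by end_near. Qed.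

(** The skeleton as a closed set. The empty set is the value on configurations that
    are not good, where the skeleton need not be closed. *)
Definition skeleton_set c : closed_set E :=
  match pselect (good c) with
  | left gc => ClosedSet (good_skeleton_closed gc)
  | right _ => point
  end.

Lemma skeleton_setE c : good c ->
  closed_set_val (skeleton_set c) = skeleton (hyperbolic_delaunay (d := n.+2) c).
Proof. by rewrite /skeleton_set; case: pselect. Qed.

Lemma measurable_window k : measurable (window k : set H).
Proof.
rewrite (_ : window k = \bigcap_(i in [set: 'I_n.+1]) (fst @^-1` ((fun v : E => v ord0 i) @^-1` `[- k%:R, k%:R]%classic))).
  apply: fin_bigcap_measurable => [|i _]; first exact: finite_finset.
  rewrite -[X in measurable X]setTI; apply: measurable_fst => //.
  by rewrite -[X in measurable X]setTI; apply: measurable_row_coord.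
apply/seteqP; split=> q qk i; first by move=> _; rewrite /= in_itv/= -ler_norml; exact: qk.
by have := qk i I; rewrite /= in_itv/= -ler_norml.
Qed.

Lemma measurable_grid_cell M z : measurable (grid_cell M z : set E).
Proof.
rewrite (_ : grid_cell M z = \bigcap_(i in [set: 'I_n.+1])
  ((fun v : E => v ord0 i) @^-1` ((fun x : R => x * (2 * n.+1%:R / M%:R)) @^-1`
     `[((z i : nat)%:Z - (4 * n.+1)%:Z)%:~R, ((z i : nat)%:Z - (4 * n.+1)%:Z + 1)%:~R[%classic))).
  apply: fin_bigcap_measurable => [|i _]; first exact: finite_finset.
  rewrite -[X in measurable X]setTI; apply: measurable_row_coord => //.
  by rewrite -[X in measurable X]setTI; apply: mulrr_measurable.
apply/seteqP; split=> v vz i.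
  move=> _; rewrite /= in_itv/=; have := vz i.
  by move=> /eqP; rewrite floor_eq.
by have := vz i I; rewrite /= in_itv/= -floor_eq => /eqP.
Qed.

Lemma measurable_occupied M : measurable (occupied^~ M : set (config H)).
Proof.
rewrite (_ : (fun c => _) = \bigcap_(z in [set: {ffun 'I_n.+1 -> 'I_(@grid_size n)}])
   ~` empty_on [set q : H | grid_cell M z q.1 /\ `|q.2| <= M%:R / 4]).
  apply: fin_bigcap_measurable => [|z _]; first exact: finite_finset.
  apply: measurableC; apply: measurable_void.
  rewrite (_ : mkset _ = grid_cell M z `*` `[- (M%:R / 4), M%:R / 4]%classic).
    by apply: measurableX; [exact: measurable_grid_cell|exact: measurable_itv].
  by apply/seteqP; split=> q []; rewrite /= in_itv/= -ler_norml.
apply/seteqP; split=> c cM z => [_|].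
  by have [q [cq qz]] := cM z; rewrite /= /empty_on /= => /seteqP[/(_ q) h _]; apply: h.
by apply/set0P/eqP; exact: (cM z I).
Qed.

Lemma measurable_good : measurable (good : set (config H)).
Proof.
rewrite (_ : good = (\bigcap_k [set c : config H | finite_set (c `&` window k)]) `&`
    \bigcap_k \bigcup_(M in [set M | (k <= M)%N]) (occupied^~ M : set (config H))).
  apply: measurableI; apply: bigcapT_measurable => k.
    by apply: measurable_finite_in; exact: measurable_window.
  by apply: bigcup_measurable => M _; exact: measurable_occupied.
by apply/seteqP; split=> c [c1 c2]; split=> k; [move=> _; exact: c1|move=> _; exact: c2|exact: c1|exact: c2].
Qed.

(** It suffices to test the events of hitting an open cube, and [skeleton_hitP]
    expresses them by countably many tuple events. *)
Lemma measurable_skeleton_set : measurable_fun setT (skeleton_set : config H -> closed_set E).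
Proof.
apply: measurable_fun_closed_rV => r; set G := rat_ball r.
rewrite (_ : _ @^-1` _ = (good : set (config H)) `&` \bigcup_m
   \bigcup_(z in [set: {ffun 'I_n.+2 -> {ffun 'I_n.+2 -> int}}])
     (has_tuple (in_cells m z) (hit_set G) `\` has_tuple (in_cells_any m z) (@conflict_set R n))).
  apply: measurableI; first exact: measurable_good.
  apply: bigcupT_measurable => m; apply: countable_bigcupT_measurable => [|z]; first exact: countableP.
  apply: measurableD; apply: measurable_has_tuple.
  - by move=> i; exact: measurable_dyadic_cell.
  - by apply: open_hit_set; exact: rat_ball_open.
  - by move=> i; rewrite /in_cells_any; case: unlift => [j|]; [exact: measurable_dyadic_cell|].
  - exact: open_conflict_set.
apply/seteqP; split=> c.
  rewrite /hits /=; have [gc|ngc] := pselect (good c); last first.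
    by rewrite /skeleton_set; case: pselect => // _ [x []].
  rewrite skeleton_setE// => /(skeleton_hitP _ gc.1)[m [z [h1 h2]]].
  by split => //; exists m => //; exists z.
move=> [gc [m _ [z _ [h1 h2]]]]; rewrite /hits /= skeleton_setE//.
by apply/(skeleton_hitP _ gc.1); exists m, z.
Qed.

End local_delaunay.

(** * Stability of the skeleton under flattening *)

Section flattening.
Context {R : realType} {n : nat}.
Local Notation E := 'rV[R]_n.+1.
Local Notation H := (E * measurableTypeR R)%type.
Implicit Types (p : 'I_n.+2 -> H) (q : H) (v w x : E) (B : set H).

Definition compress (l : R) q : H := (q.1, l * q.2).

Lemma affine_mx_compress l p : affine_mx (compress l \o p) = affine_mx p.
Proof. by apply/matrixP => i j; rewrite !affine_mxE. Qed.

Lemma bary_compress l p x : bary (compress l \o p) x = bary p x.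
Proof. by rewrite /bary affine_mx_compress. Qed.

(** The tuples have the same affine part, and the heights enter only through their
    squares, which are all multiplied by [l ^ 2]. *)
Lemma power_compress p q : exists b : R, forall l : R,
  power (compress l \o p) (compress l q) = power (compress 0 \o p) (compress 0 q) + l ^+ 2 * b.
Proof.
pose h0 : 'cV[R]_n.+2 := \col_i nsq (p i).1.
pose h1 : 'cV[R]_n.+2 := \col_i (p i).2 ^+ 2.
have hE l : heights (compress l \o p) = h0 + l ^+ 2 *: h1.
  by apply/colP => i; rewrite !mxE /= exprMn.
exists (q.2 ^+ 2 - (lift1 q.1 *m (invmx (affine_mx p) *m h1)) ord0 ord0) => l.
rewrite /power /sphere_coef !affine_mx_compress !hE !mulmxDr -!scalemxAr /=.
have addE (A C : 'M[R]_1) : (A + C) ord0 ord0 = A ord0 ord0 + C ord0 ord0 by rewrite mxE.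
have scaleE a (A : 'M[R]_1) : (a *: A) ord0 ord0 = a * A ord0 ord0 by rewrite mxE.
rewrite !addE !scaleE; ring.
Qed.

Definition generic B : Prop := forall p q, (forall i, B (p i)) -> B q ->
  affine_mx p \in unitmx -> (forall i, q <> p i) ->
  power (compress 0 \o p) (compress 0 q) <> 0.

(** By [skeleton_local] the skeleton inside the ball is decided by the signs of the
    powers of finitely many points with respect to finitely many tuples. A vertex
    has power zero for all [l]. The other powers are different from zero at [l = 0]
    by genericity, and continuous in [l]. *)
Lemma skeleton_compress_stable B (r : R) : locally_finite B -> generic B ->
  (forall k, exists2 M, (k <= M)%N & forall l : R, `|l| <= 1 -> occupied (compress l @` B) M) ->
  \forall l \near (0 : R),
    skeleton (hyperbolic_delaunay (d := n.+2) (compress l @` B)) `&` eball r =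
    skeleton (hyperbolic_delaunay (d := n.+2) (compress 0 @` B)) `&` eball r.
Proof.
move=> lf gen occ; have [M kM occM] := occ (Num.truncn r).+1.
have M0 : (0 < M)%N by exact: leq_trans kM.
have rM : r <= M%:R by rewrite (le_trans (ltW (truncnS_gt _)))// ler_nat.
have [N [s [sinj sP]]] := finite_enum (lf (3 * M)%N).
pose T := ({ffun 'I_n.+2 -> 'I_N} * 'I_N)%type.
pose pt (f : {ffun 'I_n.+2 -> 'I_N}) : 'I_n.+2 -> H := fun i => s (f i).
have sB a : B (s a) by have [] := (sP (s a)).2 (ex_intro _ a erefl).
have sign : \forall l \near (0 : R), forall f : T, affine_mx (pt f.1) \in unitmx ->
    (0 <= power (compress l \o pt f.1) (compress l (s f.2))) =
    (0 <= power (compress 0 \o pt f.1) (compress 0 (s f.2))).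
  apply: (@filter_forall _ _ _ (nbhs (0 : R)) (nbhs_filter (0 : R))) => f.
  have [uM|nuM] := boolP (affine_mx (pt f.1) \in unitmx); last by near=> l.
  have [[i qi]|nq] := pselect (exists i, s f.2 = pt f.1 i).
    near=> l => _; have pv a : power (compress a \o pt f.1) (compress a (s f.2)) = 0.
      by rewrite qi; apply: (@power_vertex R n (compress a \o pt f.1)); rewrite affine_mx_compress.
    by rewrite !pv.
  have a0 := gen (pt f.1) (s f.2) (fun i => sB _) (sB _) uM (fun i h => nq (ex_intro _ i h)).
  have [b Hb] := power_compress (pt f.1) (s f.2).
  set a := power (compress 0 \o _) _ in a0 Hb *.
  have cb : (fun l : R => a + l ^+ 2 * b) @ (0 : R) --> a.
    have c : continuous (fun l : R => a + l ^+ 2 * b).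
      apply: cont_add; first exact: cont_cst.
      by apply: cont_mul; [exact: exprn_continuous|exact: cont_cst].
    by have := c 0; rewrite /continuous_at expr0n mul0r addr0.
  have [ap|an] := ltP 0 a.
    apply: filterS (cvgr_gt a cb 0 ap) => l l0 _.
    by rewrite Hb !ltW.
  have an' : a < 0 by rewrite lt_neqAle an andbT; apply/eqP.
  apply: filterS (cvgr_lt a cb 0 an') => l l0 _.
  by rewrite Hb leNgt l0 leNgt an'.
have l1 : \forall l \near (0 : R), `|l| <= 1.
  by apply: nbhs0_le.
apply: filterS2 sign l1 => l sg l1.
have loc a x : `|a| <= 1 -> enorm x <= M%:R ->
    skeleton (hyperbolic_delaunay (d := n.+2) (compress a @` B)) x <->
    exists f, [/\ affine_mx (pt f) \in unitmx,
      forall j, 0 <= power (compress a \o pt f) (compress a (s j)),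
      forall i, 0 <= bary (pt f) x ord0 i & exists i, bary (pt f) x ord0 i = 0].
  move=> a1 xM; rewrite (skeleton_local M0 (occM a a1) xM); split.
    move=> [p [[cp uM emp b0] bi]].
    have g i : {j | compress a (s j) = p i}.
      apply: cid; have [[u Bu up] wp] := cp i; rewrite -up in wp.
      by have [j sj] := (sP u).1 (conj Bu wp); exists j; rewrite sj.
    have pE : p = compress a \o pt [ffun i => sval (g i)].
      by apply/funext => i; rewrite /pt /= ffunE; case: (g i).
    exists [ffun i => sval (g i)]; rewrite -pE -(bary_compress a) -(affine_mx_compress a) -pE.
    split => // j; apply: emp; split; first by exists (s j) => //; exact: sB.
    by have [_] := (sP (s j)).2 (ex_intro _ j erefl).
  move=> [f [uM emp b0 bi]]; exists (compress a \o pt f).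
  rewrite /local_delaunay bary_compress affine_mx_compress; split => //; split => //.
    move=> i; split; first by exists (pt f i) => //; exact: sB.
    by have [_] := (sP (pt f i)).2 (ex_intro _ (f i) erefl).
  move=> q [[u Bu <-] wu]; have [j <-] := (sP u).1 (conj Bu wu).
  exact: emp.
have l01 : `|0 : R| <= 1 by rewrite normr0.
apply/seteqP; split=> x [sx xr]; split => //; have xM := le_trans xr rM.
  have [f [uM emp b0 bi]] := (loc l x l1 xM).1 sx.
  by apply/(loc 0 x l01 xM); exists f; split => // j; rewrite -(sg (f, j) uM); exact: emp.
have [f [uM emp b0 bi]] := (loc 0 x l01 xM).1 sx.
by apply/(loc l x l1 xM); exists f; split => // j; rewrite (sg (f, j) uM); exact: emp.
Unshelve. all: by end_near. Qed.

End flattening.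

(** * The law of the heights *)

Section density.
Context {d} {T : measurableType d} {R : realType} (mu : {measure set T -> \bar R}) (f : T -> \bar R).
Hypotheses (f0 : forall x, (0 <= f x)%E) (mf : measurable_fun setT f).

(** The measurability and positivity proofs are arguments so that the measure structure
    below can be found from the term. *)
Definition density (_ : forall x, (0 <= f x)%E) (_ : measurable_fun setT f) (A : set T) : \bar R :=
  (\int[mu]_(x in A) f x)%E.

Let density0 : density f0 mf set0 = 0%E. Proof. exact: integral_set0. Qed.
Let density_ge0 A : (0 <= density f0 mf A)%E. Proof. by apply: integral_ge0 => x _; exact: f0. Qed.
Let density_sigma_additive : semi_sigma_additive (density f0 mf).
Proof. exact: semi_sigma_additive_nng_induced. Qed.

HB.instance Definition _ := isMeasure.Build _ _ _ (density f0 mf) density0 density_ge0 density_sigma_additive.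

End density.

Section height_law.
Context {R : realType} (n : nat).

(** The inverse of the distribution function of the height in units of [lam]. *)
Definition height (t : R) : R := (1 - t) `^ (- (n.+1)%:R^-1).

Lemma height_ge0 t : 0 <= height t. Proof. exact: powR_ge0. Qed.

Lemma heightX t : t < 1 -> height t ^+ n.+1 = (1 - t)^-1.
Proof.
move=> t1; rewrite -powR_mulrn ?height_ge0// /height -powRrM mulNr mulVf ?pnatr_eq0//.
by rewrite powR_inv1// subr_ge0 ltW.
Qed.

Lemma measurable_height : measurable_fun setT (height : measurableTypeR R -> measurableTypeR R).
Proof.
apply: (@measurableT_comp _ _ _ _ _ _ (fun x : R => x `^ (- (n.+1)%:R^-1))).
  exact: measurable_powR.
exact: measurable_funB.
Qed.

Lemma height_lt (l a t : R) : 0 < l -> 0 <= a -> t < 1 ->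
  (l * height t < a) = (l ^+ n.+1 < a ^+ n.+1 * (1 - t)).
Proof.
move=> l0 a0 t1; rewrite -(@ltr_pXn2r _ n.+1)// ?nnegrE ?mulr_ge0 ?height_ge0 ?(ltW l0)//.
by rewrite exprMn heightX// -ltr_pdivlMr ?invrK// invr_gt0 subr_gt0.
Qed.

(** The antiderivative is [- y ^ (- (n + 1)) / (n + 1)]. *)
Lemma integral_invX (a b : R) : 0 < a -> a < b ->
  (\int[lebesgue_measure]_(y in `[a, b]) (y ^- n.+2)%:E =
   (n.+1%:R^-1 * (a ^- n.+1 - b ^- n.+1))%:E)%E.
Proof.
move=> a0 ab; pose F (y : R) := - n.+1%:R^-1 * (y^-1) ^+ n.+1.
have dF (y : R) : 0 < y -> is_derive y (1 : R) F (y ^- n.+2).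
  move=> y0; have yn : id y != 0 by rewrite gt_eqF.
  have dV : is_derive y 1 (fun x : R => x^-1) (- y ^- 2).
    have := is_deriveV yn (is_derive_id y (1 : R)); rewrite /GRing.scale/= mulr1; exact.
  have -> : F = (- n.+1%:R^-1) *: ((fun x : R => x^-1) ^+ n.+1).
    by apply/funext => x; rewrite /F [RHS]/= exprfctE.
  apply: is_derive_eq; rewrite /= /GRing.scale/= -!exprVn.
  transitivity (n.+1%:R^-1 * n.+1%:R * (y^-1 ^+ n * y^-1 ^+ 2)); first by ring.
  by rewrite mulVf ?pnatr_eq0// mul1r -exprD addn2.
have cF (k : nat) (y : R) : 0 < y -> {for y, continuous (fun x : R => x ^- k)}.
  move=> y0; apply: (@cvgV R R (nbhs y) _ (fun x : R => x ^+ k)); first by rewrite expf_neq0// gt_eqF.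
  exact: exprn_continuous.
rewrite (@continuous_FTC2 R (fun y => y ^- n.+2) F)//.
- by rewrite -EFinB /F !exprVn; congr EFin; ring.
- apply/continuous_in_subspaceT => y; rewrite inE/= in_itv/= => /andP[ay _].
  by apply: cF; exact: lt_le_trans ay.
- have cFF (y : R) : 0 < y -> F x @[x --> y] --> F y.
    by move=> y0; apply: differentiable_continuous; apply/derivable1_diffP; have [] := dF y y0.
  split => [y|//|//]; first by rewrite in_itv/= => /andP[ay _]; have [] := dF y (lt_trans a0 ay).
    exact/cvg_at_right_filter/cFF.
  by apply/cvg_at_left_filter/cFF/(lt_trans a0 ab).
- move=> y; rewrite in_itv/= => /andP[ay _].
  by have [_ <-] := dF y (lt_trans a0 ay); rewrite derive1E.
Qed.

Definition tail_density (l y : R) : \bar R := if l <= y then (y ^- n.+2)%:E else 0%E.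

Lemma tail_density_ge0 l y : 0 < l -> (0 <= tail_density l y)%E.
Proof.
move=> l0; rewrite /tail_density; case: ifP => // ly.
by rewrite lee_fin invr_ge0 exprn_ge0// (le_trans (ltW l0)).
Qed.

Lemma measurable_tail_density l : 0 < l ->
  measurable_fun setT (tail_density l : measurableTypeR R -> \bar R).
Proof.
move=> l0; rewrite (_ : tail_density l =
    fun y => if l <= y then (y `^ (- n.+2%:R))%:E else 0%E); last first.
  apply/funext => y; rewrite /tail_density; case: ifP => // ly.
  by rewrite powR_invn// (le_trans (ltW l0)).
apply: measurable_fun_ifT.
- exact: (measurable_fun_ler (measurable_cst l) (@measurable_id _ _ _)).
- by apply/measurable_EFinP; exact: measurable_powR.
- exact: measurable_cst.
Qed.

(** Both sides are measures of [C] that are finite on the rays below a number [a],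
    where they are both equal to [(1 - (l / a) ^ (n + 1)) / (n + 1)] if [a > l] and
    vanish otherwise. *)
Lemma height_law (l : R) (C : set (measurableTypeR R)) : 0 < l -> measurable C ->
  ((l ^+ n.+1)%:E * \int[lebesgue_measure]_(y in C) tail_density l y =
   n.+1%:R^-1%:E * lebesgue_measure ([set t : R | C (l * height t)%R] `&` `[0%R, 1%R[))%E.
Proof.
move=> l0 mC; have L0 : 0 <= l ^+ n.+1 by rewrite exprn_ge0// ltW.
have i0 : 0 <= n.+1%:R^-1 :> R by rewrite invr_ge0.
have mh : measurable_fun setT (fun t : measurableTypeR R => l * height t : measurableTypeR R).
  by apply: measurable_funM => //; exact: measurable_height.
pose mr := restricted_measure (@lebesgue_measure R) (measurable_itv `[0%R, 1%R[).
pose m1 : {measure set (measurableTypeR R) -> \bar R} := mscale (NngNum L0)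
  (density (@lebesgue_measure R) (fun y => tail_density_ge0 y l0) (measurable_tail_density l0)).
pose m2 : {measure set (measurableTypeR R) -> \bar R} := mscale (NngNum i0)
  (measure_function_pushforward__canonical__measure_function_Measure mr mh).
have E1 (A : set (measurableTypeR R)) : m1 A = ((l ^+ n.+1)%:E * \int[lebesgue_measure]_(y in A) tail_density l y)%E by [].
have E2 (A : set (measurableTypeR R)) : m2 A = (n.+1%:R^-1%:E * lebesgue_measure ([set t : R | A (l * height t)%R] `&` `[0%R, 1%R[))%E by [].
have H (a : R) : m1 `]-oo, a[%classic = m2 `]-oo, a[%classic /\ (m1 `]-oo, a[%classic < +oo)%E.
  rewrite E1 E2; have [al|la] := leP a l.
    rewrite integral0_eq ?mule0; last first.
      by move=> y /=; rewrite in_itv/= /tail_density => ya; rewrite leNgt (lt_le_trans ya).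
    rewrite (_ : _ `&` _ = set0) ?measure0 ?mule0 ?ltry//.
    rewrite -subset0 => t [] /=; rewrite !in_itv/= => ta /andP[t0 t1].
    have a0 : 0 < a by apply: le_lt_trans ta; rewrite mulr_ge0 ?height_ge0 ?(ltW l0).
    move: ta; rewrite height_lt// ?(ltW a0)// ltNge => /negP; apply.
    apply: (@le_trans _ _ (a ^+ n.+1)); last by rewrite lerXn2r// nnegrE ltW.
    by rewrite ler_piMr ?exprn_ge0 ?(ltW a0)//; lra.
  have a0 : 0 < a by exact: lt_trans la.
  have an0 : a ^+ n.+1 != 0 by rewrite expf_neq0// gt_eqF.
  have ln0 : l ^+ n.+1 != 0 by rewrite expf_neq0// gt_eqF.
  have -> : (\int[lebesgue_measure]_(y in `]-oo, a[) tail_density l y =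
      (n.+1%:R^-1 * (l ^- n.+1 - a ^- n.+1))%:E)%E.
    rewrite -integral_invX// -integral_itv_bndo_bndc; last first.
      apply: (eq_measurable_fun (fun y => (y `^ (- n.+2%:R))%:E)) => [y|].
        by rewrite inE/= in_itv/= => /andP[ly _]; rewrite powR_invn// (le_trans (ltW l0)).
      by apply: measurable_funTS; apply/measurable_EFinP; exact: measurable_powR.
    rewrite [LHS]integral_mkcond [RHS]integral_mkcond; apply: eq_integral => y _.
    rewrite !patchE /tail_density !mem_setE !in_itv/=.
    by case: (l <= y); case: (y < a).
  rewrite (_ : _ `&` _ = `[0%R, 1 - l ^+ n.+1 / a ^+ n.+1[%classic); last first.
    apply/seteqP; split=> t /=; rewrite !in_itv/=.
      move=> [ta /andP[t0 t1]]; rewrite t0/=; move: ta; rewrite height_lt// ?(ltW a0)//.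
      by rewrite mulrC -ltr_pdivrMr ?exprn_gt0//; lra.
    move=> /andP[t0 ta]; have t1 : t < 1.
      by apply: (lt_le_trans ta); rewrite lerBlDr lerDl divr_ge0// exprn_ge0// ltW.
    rewrite t0 t1 height_lt// ?(ltW a0)//; split=> //.
    by rewrite mulrC -ltr_pdivrMr ?exprn_gt0//; lra.
  have la1 : l ^+ n.+1 / a ^+ n.+1 < 1.
    by rewrite ltr_pdivrMr ?exprn_gt0// mul1r ltr_pXn2r// nnegrE ltW.
  rewrite lebesgue_measure_itv/= lte_fin subr_gt0 la1 -EFinB subr0 -!EFinM ltry; split => //.
  by congr EFin; field; rewrite an0 ln0 addrC natr1 pnatr_eq0.
apply: (etrans (esym (E1 C)) (etrans _ (E2 C))).
have mE : @measurable _ (measurableTypeR R) = <<s @RGenInftyO.G R >> by exact: RGenInftyO.measurableE.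
apply: (@measure_unique _ R (measurableTypeR R) (@RGenInftyO.G R) (fun k : nat => `]-oo, k%:R[%classic) mE) mC.
- move=> _ _ [x ->] [y ->]; exists (Num.min x y); apply/seteqP; split=> t /=; rewrite !in_itv/= lt_min.
    by move=> [-> ->].
  by move=> /andP[].
- by move=> k; exists k%:R.
- apply/seteqP; split=> // t _; exists (Num.truncn `|t|).+1 => //=.
  by rewrite in_itv/= (le_lt_trans (ler_norm _))// truncnS_gt.
- by move=> _ [x ->]; have [] := H x.
- by move=> k; have [_] := H k%:R.
Qed.
End height_law.

Section row_volume.
Context {R : realType}.

Lemma cell_volume_fin n (z : 'I_n.+1 -> int) : (lebesgue_measure_rV R n.+1 (cell z) < +oo)%E.
Proof.
have H := @random_row_law R (@coin_measure R) (@coin_measure_cyl R) nat n.+1 (fun i => i : nat) z (cell z) (@ord_inj n.+1) (measurable_cell z).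
by move: H; rewrite setIid => <-; rewrite (le_lt_trans (probability_le1 _ _)) ?ltry//; rewrite -[X in measurable X]setTI; apply: measurable_random_row => //; exact: measurable_cell.
Qed.

Lemma row_volume_sigma_finite n : sigma_finite setT (lebesgue_measure_rV R n.+1).
Proof.
have [z [g gK Kg]] := int_vectors_enum n.
exists (fun j => cell (z j)); last first.
  by move=> j; split; [exact: measurable_cell|exact: cell_volume_fin].
apply/esym/seteqP; split=> // v _; exists (g [ffun i => Num.floor (v ord0 i)]) => //.
by apply/cell_floor => i; rewrite Kg ffunE.
Qed.

(** Lebesgue measure under a name that carries its structure of a sigma-finite measure,
    as Fubini's theorem requires. *)
Definition row_volume n : set 'rV[R]_n.+1 -> \bar R := lebesgue_measure_rV R n.+1.

HB.instance Definition _ n := Measure.copy (@row_volume n) (lebesgue_measure_rV R n.+1).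
HB.instance Definition _ n := Measure_isSigmaFinite.Build _ _ _ (@row_volume n) (row_volume_sigma_finite n).

End row_volume.

Section intensity.
Context {R : realType} (n : nat).
Local Notation E := 'rV[R]_n.+1.
Local Notation H := (E * measurableTypeR R)%type.

Definition lift_height (l : R) (q : H) : H := (q.1, l * height n q.2).

Lemma measurable_lift_height l : measurable_fun setT (lift_height l).
Proof.
apply: measurable_fun_pair; first exact: measurable_fst.
apply: measurable_funM => //.
exact: (measurableT_comp (@measurable_height R n) measurable_snd).
Qed.

(** Fubini's theorem reduces the claim to [height_law] on each vertical line. *)
Lemma horoball_intensityE (l : R) (B : set H) : 0 < l -> measurable B ->
  horoball_intensity (d := n.+2) (l ^+ n.+1) l B =
  base_intensity n.+1%:R^-1 (lift_height l @^-1` B).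
Proof.
move=> l0 mB; rewrite /horoball_intensity /hyperbolic_volume.
pose f (q : H) : \bar R := if q \in B then tail_density n l q.2 else 0%E.
have -> : (\int[lebesgue_measure_rV R n.+2.-1 \x lebesgue_measure]_(p in
      (B `&` horoball (d := n.+2) l) `&` [set p | 0 < p.2]%R) (p.2 ^- n.+2)%:E =
    \int[@row_volume R n \x lebesgue_measure]_p f p)%E.
  rewrite integral_mkcond; apply: eq_integral => q _; rewrite patchE /f /tail_density.
  have -> : (q \in (B `&` horoball (d := n.+2) l) `&` [set p : H | 0 < p.2]) = (q \in B) && (l <= q.2).
    apply/idP/andP => [|[qB lq]]; first by rewrite inE => -[[qB lq] _]; split; first exact/mem_set.
    by rewrite inE; split; [split => //; exact: set_mem|exact: (lt_le_trans l0)].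
  by case: (q \in B).
have f0 q : (0 <= f q)%E by rewrite /f; case: ifP => // _; exact: tail_density_ge0.
have mf : measurable_fun setT f.
  apply: measurable_fun_ifT.
  - apply: (@measurable_fun_bool _ _ _ _ true).
    by rewrite setTI (_ : _ @^-1` _ = B)//; apply/seteqP; split=> q /=; [exact: set_mem|exact: mem_set].
  - exact: (measurableT_comp (measurable_tail_density n l0) measurable_snd).
  - exact: measurable_cst.
rewrite (fubini_tonelli1 _ mf f0) -ge0_integralZl_EFin//; last 3 first.
- by move=> x _; apply: integral_ge0 => y _; exact: f0.
- exact: measurable_fun_fubini_tonelli_F.
- by rewrite exprn_ge0// ltW.
set D := lift_height l @^-1` B `&` (setT `*` `[0%R, 1%R[%classic).
have mD : measurable D.
  apply: measurableI; last by apply: measurableX => //; exact: measurable_itv.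
  by rewrite -[X in measurable X]setTI; exact: measurable_lift_height.
rewrite /base_intensity -/D; transitivity (\int[@row_volume R n]_x (n.+1%:R^-1%:E * lebesgue_measure (xsection D x)))%E.
  apply: eq_integral => x _.
  have -> : fubini_F lebesgue_measure f x = (\int[lebesgue_measure]_(y in xsection B x) tail_density n l y)%E.
    rewrite /fubini_F [RHS]integral_mkcond; apply: eq_integral => y _.
    by rewrite patchE mem_xsection /f.
  apply: etrans (height_law n l0 (measurable_xsection x mB)) _.
  congr (_ * lebesgue_measure _)%E; apply/seteqP; split=> t; rewrite /D /xsection /= !inE.
    by move=> [? ?]; split.
  by move=> [? [? ?]]; split.
rewrite ge0_integralZl_EFin//; last exact: measurable_fun_xsection.
Qed.

End intensity.

(** * Images of Poisson processes *)

Section images.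
Context {R : realType}.

Lemma counting_image {X Y : choiceType} (f : X -> Y) (A : set X) : {in A &, injective f} ->
  counting (f @` A) = counting A :> \bar R.
Proof.
move=> finj; rewrite /counting; have AE := inj_card_eq finj.
rewrite (eq_finite_set AE); case: ifPn => // /asboolP fA.
have ffA : finite_set A by [].
rewrite (fset_set_image f ffA) card_in_imfset// => x y.
by rewrite !in_fset_set// => xA yA; exact: finj.
Qed.

(** Injectivity on configurations makes the number of image points in [B] the number of
    points in the preimage of [B]. *)
Lemma poisson_image {dX dY dO : measure_display} {X : measurableType dX} {Y : measurableType dY}
    {Om : measurableType dO} (P : probability Om R) (Lam : set X -> \bar R)
    (Lam' : set Y -> \bar R) (eta : Om -> set X) (f : X -> Y) :
  measurable_fun setT f -> (forall w, {in eta w &, injective f}) ->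
  (forall B, measurable B -> Lam' B = Lam (f @^-1` B)) ->
  is_poisson_process P Lam eta -> is_poisson_process P Lam' (fun w => f @` eta w).
Proof.
move=> mf finj LL' [mc fin inf ind].
have pc B : point_count (fun w => f @` eta w) B = point_count eta (f @^-1` B) :> (Om -> \bar R).
  apply/funext => w; rewrite /point_count -(@counting_image _ _ f); last first.
    by move=> x y; rewrite !inE => -[ex _] [ey _]; apply: (finj w); exact/mem_set.
  congr counting; apply/seteqP; split=> y; first by move=> [[x ex <-] Bx]; exists x.
  by move=> [x [ex Bx] <-]; split => //; exists x.
have mp B : measurable B -> measurable (f @^-1` B).
  by move=> mB; rewrite -[X in measurable X]setTI; exact: mf.
split.
- by move=> B mB; rewrite pc; apply: mc; exact: mp.
- by move=> B mB; rewrite LL'// pc; apply: fin; exact: mp.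
- by move=> B mB; rewrite LL'// pc; apply: inf; exact: mp.
- move=> m B mB tB A mA; under eq_bigcapr do rewrite pc.
  under eq_bigr do rewrite pc.
  apply: ind => // [i|]; first exact: mp.
  by apply/trivIsetP => i j _ _ ij; rewrite -preimage_setI ((trivIsetP.1 tB) i j)// preimage_set0.
Qed.

Context (n : nat).
Local Notation E := 'rV[R]_n.+1.
Local Notation H := (E * measurableTypeR R)%type.

Lemma base_intensity_fst (theta : R) (A : set E) : measurable A ->
  (theta%:E * lebesgue_measure_rV R n.+1 A)%E = base_intensity theta (fst @^-1` A : set H).
Proof.
move=> mA; rewrite /base_intensity; congr (_ * _)%E.
rewrite (_ : _ `&` _ = A `*` `[0%R, 1%R[%classic); last first.
  by apply/seteqP; split=> q; [move=> [? [_ ?]]|move=> [? ?]].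
rewrite product_measure1E//.
transitivity (lebesgue_measure_rV R n.+1 A * 1)%E; first by rewrite mule1.
congr (_ * _)%E; apply: esym; apply: etrans (lebesgue_measure_itv _) _.
by rewrite /= lte_fin ltr01 oppr0 adde0.
Qed.

End images.

(** * Cospherical points have probability zero *)

Section spheres.
Context {R : realType} (n : nat).
Local Notation E := 'rV[R]_n.+1.

Definition sphere (s : 'cV[R]_n.+2) : set E := [set v | nsq v = (lift1 v *m s) ord0 ord0].

Lemma measurable_nsq : measurable_fun setT (nsq : E -> measurableTypeR R).
Proof.
apply: measurable_sum => i; apply: (measurableT_comp (f := fun x : R => x ^+ 2)).
  exact: exprn_measurable.
exact: measurable_row_coord.
Qed.

Lemma measurable_sphere s : measurable (sphere s).
Proof.
pose g (v : E) : measurableTypeR R := nsq v - (s ord0 ord0 + \sum_i v ord0 i * s (lift ord0 i) ord0).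
have mg : measurable_fun setT g.
  apply: measurable_funB; first exact: measurable_nsq.
  apply: measurable_funD => //; apply: measurable_sum => i.
  by apply: measurable_funM => //; exact: measurable_row_coord.
rewrite (_ : sphere s = g @^-1` [set 0]); last first.
  apply/seteqP; split=> v; rewrite /sphere /g /= lift1_mul; first by move=> ->; rewrite subrr.
  by move/eqP; rewrite subr_eq0 => /eqP.
by rewrite -[X in measurable X]setTI; exact: mg.
Qed.

Lemma quadratic_null (b c : R) :
  lebesgue_measure [set y : R | y ^+ 2 = b * y + c] = 0%E :> \bar R.
Proof.
apply: countable_lebesgue_measure0; apply: finite_set_countable.
have [[y0 y0E]|none] := pselect (exists y : R, y ^+ 2 = b * y + c); last first.
  rewrite (_ : [set y | _] = set0)//.
  by rewrite -subset0 => y yE; apply: none; exists y.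
apply: (@sub_finite_set _ _ [set y0; b - y0]); last exact: finite_set2.
move=> y /= yE; have : (y - y0) * (y - (b - y0)) = 0.
  by transitivity (y ^+ 2 - y0 ^+ 2 - b * (y - y0)); [ring|rewrite yE y0E; ring].
by move/eqP; rewrite mulf_eq0 !subr_eq0 => /orP[]/eqP; [left|right].
Qed.

(** With all coordinates but the first fixed, the first one solves a quadratic
    equation. *)
Lemma sphere_null s : lebesgue_measure_rV R n.+1 (sphere s) = 0%E.
Proof.
have H (u : 'rV[R]_n) : (@lebesgue_measure R) (xsection (@rV_cons R n @^-1` sphere s) u) = 0%E.
  rewrite -(quadratic_null (s (lift ord0 ord0) ord0)
    (s ord0 ord0 + \sum_(i < n) u ord0 i * s (lift ord0 (lift ord0 i)) ord0 - \sum_(i < n) u ord0 i ^+ 2)).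
  have hN y : nsq (@rV_cons R n (u, y)) = y ^+ 2 + \sum_i u ord0 i ^+ 2.
    by rewrite /nsq big_ord_recl rV_cons0; congr (_ + _); apply: eq_bigr => i _; rewrite rV_consS.
  have hL y : (lift1 (@rV_cons R n (u, y)) *m s) ord0 ord0 = s ord0 ord0 +
      (y * s (lift ord0 ord0) ord0 + \sum_(i < n) u ord0 i * s (lift ord0 (lift ord0 i)) ord0).
    rewrite lift1_mul; congr (_ + _); rewrite big_ord_recl rV_cons0; congr (_ + _).
    by apply: eq_bigr => i _; rewrite rV_consS.
  congr (lebesgue_measure _); apply/seteqP; split=> y; rewrite xsectionE /sphere /= hN hL => yE; lra.
transitivity ((lebesgue_measure_rV R n \x lebesgue_measure)%E (@rV_cons R n @^-1` sphere s)); first by [].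
by rewrite /product_measure1; apply: integral0_eq => u _; exact: H.
Qed.

End spheres.

Section measurable_det.
Context {d} {T : measurableType d} {R : realType}.

Lemma measurable_det k (F : T -> 'M[R]_k) :
  (forall i j, measurable_fun setT (fun x => F x i j)) -> measurable_fun setT (fun x => \det (F x)).
Proof.
move=> mF; rewrite /determinant; apply: measurable_sum => s.
by apply: measurable_funM => //; apply: measurable_prod => i _; exact: mF.
Qed.

Lemma measurable_adj k (F : T -> 'M[R]_k) :
  (forall i j, measurable_fun setT (fun x => F x i j)) ->
  forall i j, measurable_fun setT (fun x => (\adj (F x)) i j).
Proof.
move=> mF i j.
rewrite (_ : (fun x => _) = (fun x => (-1) ^+ (j + i) * \det (row' j (col' i (F x))))); last first.
  by apply/funext => x; rewrite mxE.
apply: measurable_funM => //; apply: measurable_det => a b.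
rewrite (_ : (fun _ => _) = (fun x => F x (lift j a) (lift i b))); first exact: mF.
by apply/funext => y; rewrite !mxE.
Qed.

Lemma measurable_mulmx a b c (F : T -> 'M[R]_(a, b)) (G : T -> 'M[R]_(b, c)) :
  (forall i j, measurable_fun setT (fun x => F x i j)) -> (forall i j, measurable_fun setT (fun x => G x i j)) ->
  forall i j, measurable_fun setT (fun x => (F x *m G x) i j).
Proof.
move=> mF mG i j; rewrite (_ : (fun x => _) = (fun x => \sum_l F x i l * G x l j)); last first.
  by apply/funext => x; rewrite mxE.
by apply: measurable_sum => l; apply: measurable_funM; [exact: mF|exact: mG].
Qed.

End measurable_det.

Section cospherical.
Context {R : realType} (P : probability coins R) (fairP : fair P) (n : nat).
Variable z : nat -> {ffun 'I_n.+1 -> int}.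
Local Notation E := 'rV[R]_n.+1.
Local Notation H := (E * measurableTypeR R)%type.
Local Notation label := (nat * nat)%type.

Definition located (a : label) (w : coins) : E := base_location z a.1 a.2 w.

Definition located_tuple (b : {ffun 'I_n.+2 -> label}) (w : coins) (i : 'I_n.+2) : H :=
  (located (b i) w, 0).

Definition cospherical_on (a : label) (b : {ffun 'I_n.+2 -> label}) : set coins :=
  [set w | affine_mx (located_tuple b w) \in unitmx /\
     power (located_tuple b w) (located a w, 0) = 0].

(** The coefficients of the sphere through the tuple, multiplied by the determinant so
    that they are polynomials in the coordinates, preceded by the determinant. *)
Definition cleared_coef (b : {ffun 'I_n.+2 -> label}) (w : coins) : 'rV[R]_n.+3 :=
  \row_k (if unlift ord0 k is Some j
          then (\adj (affine_mx (located_tuple b w)) *m heights (located_tuple b w)) j ord0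
          else \det (affine_mx (located_tuple b w))).

Lemma measurable_located a i : measurable_fun setT (fun w => located a w ord0 i).
Proof.
by apply: (measurableT_comp (@measurable_row_coord R n.+1 i)); exact: measurable_base_location.
Qed.

Lemma measurable_affine_located b i j :
  measurable_fun setT (fun w => affine_mx (located_tuple b w) i j).
Proof.
have [l ->|->] := unliftP ord0 j.
  rewrite (_ : (fun _ => _) = (fun w => located (b i) w ord0 l)); first exact: measurable_located.
  by apply/funext => w; rewrite affine_mxE lift1S.
rewrite (_ : (fun _ => _) = (fun=> 1)); first exact: measurable_cst.
by apply/funext => w; rewrite affine_mxE lift10.
Qed.

Lemma measurable_cleared_coef b : measurable_fun setT (cleared_coef b).
Proof.
apply: measurable_fun_rV => k; rewrite /cleared_coef; under eq_fun do rewrite mxE.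
case: (unlift ord0 k) => [j|]; last by apply: measurable_det; exact: measurable_affine_located.
apply: measurable_mulmx => [i l|i l].
  by apply: measurable_adj; exact: measurable_affine_located.
rewrite (_ : (fun _ => _) = (fun w => \sum_m located (b i) w ord0 m ^+ 2)); last first.
  by apply/funext => w; rewrite mxE /= expr0n addr0.
apply: measurable_sum => m; apply: (measurableT_comp (f := fun x : R => x ^+ 2)).
  exact: exprn_measurable.
exact: measurable_located.
Qed.

(** The point [a] is independent of the points [b], and given the latter it would have
    to lie on a fixed sphere. *)
Lemma cospherical_on_null a (b : {ffun 'I_n.+2 -> label}) : (forall i, b i <> a) ->
  measurable (cospherical_on a b) /\ P (cospherical_on a b) = 0%E.
Proof.
move=> ba.
pose g (x : 'rV[R]_n.+3 * E) : measurableTypeR R := x.1 ord0 ord0 * nsq x.2 -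
  (x.1 ord0 (lift ord0 ord0) + \sum_i x.2 ord0 i * x.1 ord0 (lift ord0 (lift ord0 i))).
pose g0 (x : 'rV[R]_n.+3 * E) : measurableTypeR R := x.1 ord0 ord0.
have mc1 i : measurable_fun setT (fun x : 'rV[R]_n.+3 * E => x.1 ord0 i : measurableTypeR R).
  exact: (measurableT_comp (@measurable_row_coord R n.+3 i) measurable_fst).
have mc2 i : measurable_fun setT (fun x : 'rV[R]_n.+3 * E => x.2 ord0 i : measurableTypeR R).
  exact: (measurableT_comp (@measurable_row_coord R n.+1 i) measurable_snd).
have mg : measurable_fun setT g.
  apply: measurable_funB.
    apply: measurable_funM; first exact: mc1.
    exact: (measurableT_comp (@measurable_nsq R n) measurable_snd).
  apply: measurable_funD; first exact: mc1.
  by apply: measurable_sum => i; apply: measurable_funM; [exact: mc2|exact: mc1].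
pose D := (g0 @^-1` (~` [set 0])) `&` (g @^-1` [set 0]).
have mD : measurable D.
  apply: measurableI; rewrite -[X in measurable X]setTI; last exact: mg.
  by apply: (mc1 ord0) => //; exact: measurableC.
pose pair w := (cleared_coef b w, located a w).
have mloc : measurable_fun setT (located a) by exact: measurable_base_location.
have c0 w : cleared_coef b w ord0 ord0 = \det (affine_mx (located_tuple b w)).
  by rewrite mxE unlift_none.
have cS w j : cleared_coef b w ord0 (lift ord0 j) =
    (\adj (affine_mx (located_tuple b w)) *m heights (located_tuple b w)) j ord0.
  by rewrite [LHS]mxE liftK.
have gE w : affine_mx (located_tuple b w) \in unitmx -> g (pair w) =
    \det (affine_mx (located_tuple b w)) * power (located_tuple b w) (located a w, 0).
  move=> uM; have d0 : \det (affine_mx (located_tuple b w)) != 0 by rewrite -unitfE -unitmxE.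
  rewrite /power /sphere_coef /invmx uM -scalemxAl -scalemxAr [X in _ = _ * (_ - X)]mxE.
  rewrite /g /= c0 cS; under eq_bigr do rewrite cS.
  by rewrite -lift1_mul expr0n addr0 mulrBr mulrA divff// mul1r.
have cE : cospherical_on a b = pair @^-1` D.
  apply/seteqP; split=> w; rewrite /cospherical_on /D /g0 /= c0.
    move=> [uM pw]; rewrite gE// pw mulr0; split => //.
    by apply/eqP; rewrite -unitfE -unitmxE.
  move=> [/eqP d0]; have uM : affine_mx (located_tuple b w) \in unitmx by rewrite unitmxE unitfE.
  by rewrite gE// => /eqP; rewrite mulf_eq0 (negbTE d0) => /eqP.
split.
  by rewrite cE -[X in measurable X]setTI; apply: measurable_fun_pair => //; exact: measurable_cleared_coef.
rewrite cE; pose S := \bigcup_(i in [set: 'I_n.+2]) base_source (inr (b i)).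
apply: (@indep_pair_null R P fairP _ _ _ _ S (base_source (inr a))) => //.
- rewrite setI_bigcupl; apply: bigcup0 => i _; apply: base_sourceI => -[].
  exact: ba.
- move=> w w' ww'; have le i : located (b i) w = located (b i) w'.
    by apply: (@base_location_depends R n z (b i).1 (b i).2) => k bk; apply: ww'; exists i => //; move: bk; case: (b i).
  have -> : cleared_coef b w = cleared_coef b w' => //.
  have te : located_tuple b w = located_tuple b w' by apply/funext => i; rewrite /located_tuple le.
  by rewrite /cleared_coef te.
- by move=> w w' ww'; apply: base_location_depends; case: a ww' {ba g0 g mg D mD pair mloc gE cE S}.
- exact: measurable_cleared_coef.
- move=> s; have [s0|s0] := eqVneq (s ord0 ord0) 0.
    rewrite (_ : _ @^-1` _ = set0) ?measure0//; rewrite -subset0 => w /=.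
    by rewrite xsectionE /D /g0 /= => -[].
  pose s' : 'cV[R]_n.+2 := \col_j (s ord0 (lift ord0 j) / s ord0 ord0).
  have -> : xsection D s = sphere s'.
    have hs (v : E) : (lift1 v *m s') ord0 ord0 = (s ord0 (lift ord0 ord0) +
        \sum_i v ord0 i * s ord0 (lift ord0 (lift ord0 i))) / s ord0 ord0.
      rewrite lift1_mul mulrDl mulr_suml mxE; congr (_ + _).
      by apply: eq_bigr => i _; rewrite mxE mulrA.
    apply/seteqP; split=> v; rewrite xsectionE /D /g0 /g /sphere /= hs.
      by move=> [_ /eqP]; rewrite subr_eq0 => /eqP <-; rewrite mulrC mulKf.
    by move=> ->; split; [exact/eqP|rewrite mulrC divfK// subrr].
  have := base_location_law fairP z a.1 a.2 (measurable_sphere s').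
  rewrite /located => ->; apply/eqP; rewrite eq_le measure_ge0 andbT.
  rewrite -[leRHS](sphere_null s'); apply: le_measure; rewrite ?inE//.
    by apply: measurableI; [exact: measurable_sphere|exact: measurable_cell].
  exact: measurable_sphere.
Qed.

End cospherical.

(** * Boxes, grid cells and densely occupied configurations *)

Lemma coin_real_itv {R : realType} w : 0 <= (coin_real w : R) <= 1.
Proof.
apply/andP; split.
  apply: limr_ge; first by apply: cvgP; exact: cvg_coin_real.
  by near=> k; rewrite divr_ge0// exprn_ge0.
apply: limr_le; first by apply: cvgP; exact: cvg_coin_real.
near=> k; rewrite ler_pdivrMr ?exprn_gt0// mul1r -natrX ler_nat.
exact/ltnW/bits_value_lt.
Unshelve. all: by end_near. Qed.

Section box.
Context {R : realType}.

Definition box n (a b : 'I_n -> R) : set 'rV[R]_n := [set v | forall i, a i <= v ord0 i < b i].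

Lemma measurable_box n (a b : 'I_n -> R) : measurable (box a b).
Proof.
rewrite (_ : box a b = \bigcap_(i in [set: 'I_n]) ((fun v : 'rV[R]_n => v ord0 i) @^-1` `[a i, b i[%classic)).
  apply: fin_bigcap_measurable => [|i _]; first exact: finite_finset.
  by rewrite -[X in measurable X]setTI; apply: measurable_row_coord.
apply/seteqP; split=> v vab i; first by move=> _; rewrite /= in_itv/=; exact: vab.
by have := vab i I; rewrite /= in_itv/=.
Qed.

Lemma box_volume n (a b : 'I_n -> R) : (forall i, a i < b i) ->
  lebesgue_measure_rV R n (box a b) = (\prod_i (b i - a i))%:E.
Proof.
elim: n a b => [|n IH] a b ab.
  rewrite big_ord0 (_ : box a b = setT); last by apply/seteqP; split=> // v _ [].
  by rewrite /= diracE mem_set.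
pose a' (i : 'I_n) := a (lift ord0 i); pose b' (i : 'I_n) := b (lift ord0 i).
transitivity ((lebesgue_measure_rV R n \x lebesgue_measure)%E (@rV_cons R n @^-1` box a b)); first by [].
rewrite (_ : _ @^-1` _ = box a' b' `*` `[a ord0, b ord0[%classic); last first.
  apply/seteqP; split=> -[v y] /=.
    move=> H; split=> /=; last by rewrite in_itv/=; have := H ord0; rewrite rV_cons0.
    by move=> i; have := H (lift ord0 i); rewrite rV_consS.
  move=> [/= H]; rewrite in_itv/= => Hy i; have [j ->|->] := unliftP ord0 i; last by rewrite rV_cons0.
  by rewrite rV_consS; exact: H.
rewrite product_measure1E//; last exact: measurable_box.
rewrite big_ord_recl mulrC EFinM; congr (_ * _)%E; first by apply: IH => i; exact: ab.
by apply: etrans (lebesgue_measure_itv _) _; rewrite /= lte_fin ab.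
Qed.

Lemma grid_cell_box n M (z : {ffun 'I_n.+1 -> 'I_(@grid_size n)}) : (0 < M)%N ->
  grid_cell M z = box (fun i => ((z i : nat)%:Z - (4 * n.+1)%:Z)%:~R * (M%:R / (2 * n.+1%:R)))
    (fun i => (((z i : nat)%:Z - (4 * n.+1)%:Z)%:~R + 1) * (M%:R / (2 * n.+1%:R))) :> set 'rV[R]_n.+1.
Proof.
move=> M0; have h0 : 0 < 2 * n.+1%:R / M%:R :> R by rewrite divr_gt0 ?ltr0n// mulr_gt0// ltr0n.
rewrite (_ : M%:R / _ = (2 * n.+1%:R / M%:R)^-1 :> R); last by rewrite invf_div.
rewrite /grid_cell; move: (2 * _ / _ : R) h0 => h h0.
apply/seteqP; split=> v vz i; have := vz i; rewrite /= ?ler_pdivrMr// ?ltr_pdivlMr//.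
  by move=> /eqP; rewrite floor_eq [(_ + 1)%:~R]intrD.
by move=> H; apply/eqP; rewrite floor_eq [(_ + 1)%:~R]intrD.
Qed.

Lemma grid_cell_volume n M (z : {ffun 'I_n.+1 -> 'I_(@grid_size n)}) : (0 < M)%N ->
  lebesgue_measure_rV R n.+1 (grid_cell M z) = ((M%:R / (2 * n.+1%:R)) ^+ n.+1)%:E.
Proof.
move=> M0; have g0 : 0 < M%:R / (2 * n.+1%:R) :> R by rewrite divr_gt0 ?ltr0n// mulr_gt0// ltr0n.
rewrite grid_cell_box// box_volume; last by move=> i; rewrite ltr_pM2r// ltrDl.
rewrite (eq_bigr (fun=> M%:R / (2 * n.+1%:R))) ?prodr_const ?card_ord// => i _.
by ring.
Qed.

End box.

Section dense.
Context {R : realType} {n : nat}.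
Local Notation E := 'rV[R]_n.+1.
Local Notation H := (E * measurableTypeR R)%type.

Definition raise (q : H) : H := (q.1, height n q.2).

(** A mark at most one half gives a height at most two. *)
Definition low_block M (z : {ffun 'I_n.+1 -> 'I_(@grid_size n)}) : set H :=
  grid_cell M z `*` `[0%R, 2^-1%R]%classic.

(** Cells of arbitrarily large scales are all occupied; only the marks are
    constrained, so the condition serves all values of the parameter. *)
Definition dense_config (c : set H) : Prop := forall k, exists2 M, (k <= M)%N &
  forall z, c `&` low_block M z !=set0.

Lemma height_half t : t <= 2^-1 -> height n t <= 2 :> R.
Proof.
move=> t2; have t1 : t < 1 by rewrite (le_lt_trans t2)// invf_lt1// ltr1n.
rewrite -(@ler_pXn2r _ n.+1)// ?nnegrE ?height_ge0// heightX//.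
apply: (@le_trans _ _ 2); last by rewrite -[leLHS]expr1 ler_eXn2l// ltr1n.
rewrite invf_ple ?posrE ?subr_gt0//; have : 2^-1 + 2^-1 = 1 :> R by field. 
by lra.
Qed.

(** Heights are at most [2 a] after compression, which is below [M / 4] when
    [M >= 8 a]. *)
Lemma dense_occupied (c : set H) : dense_config c -> forall (a : R) k,
  exists2 M, (k <= M)%N & forall l : R, `|l| <= a -> occupied (compress l @` (raise @` c)) M.
Proof.
move=> dc a k; have [M kM dM] := dc (maxn k (Num.truncn (8 * a)).+1).
exists M; first by rewrite (leq_trans _ kM)// leq_maxl.
move=> l la z; have [q [cq [qz]]] := dM z; rewrite /= in_itv/= => /andP[q0 q2].
exists (compress l (raise q)); split; first by exists (raise q) => //; exists q.
split => //=; rewrite normrM (ger0_norm (height_ge0 _ _)).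
have aM : 8 * a <= M%:R.
  rewrite (le_trans (ltW (truncnS_gt _)))// ler_nat (leq_trans _ kM)// leq_maxr//.
have hq := height_half q2; have h0 := height_ge0 n q.2; have l0 := normr_ge0 l.
by nra.
Qed.

Lemma dense_good (c : set H) (l : R) : dense_config c -> locally_finite c ->
  good (compress l @` (raise @` c)).
Proof.
move=> dc lf; split=> k.
  apply: (@sub_finite_set _ _ (compress l @` (raise @` (c `&` window k)))).
    move=> _ [[_ [q cq <-] <-]] wq; exists (raise q) => //; exists q => //.
  by do 2 apply: finite_image; exact: lf.
by have [M kM H] := dense_occupied dc `|l| k; exists M => //; exact: H.
Qed.

End dense.

(** * Almost sure properties of the marked points *)

Section base_properties.
Context {R : realType} (P : probability coins R) (fairP : fair P) (n : nat).
Variables (theta : R) (theta0 : 0 < theta).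
Variables (z : nat -> {ffun 'I_n.+1 -> int}) (zbij : bijective z).
Local Notation E := 'rV[R]_n.+1.
Local Notation H := (E * measurableTypeR R)%type.
Local Notation label := (nat * nat)%type.

Definition cospherical : set coins := \bigcup_(ab : label * {ffun 'I_n.+2 -> label})
  (if [exists i, ab.2 i == ab.1] then set0 else cospherical_on (R := R) z ab.1 ab.2).

Lemma cospherical_null : measurable cospherical /\ P cospherical = 0%E.
Proof.
have H0 (ab : label * {ffun 'I_n.+2 -> label}) : measurable (if [exists i, ab.2 i == ab.1] then set0 else cospherical_on (R := R) z ab.1 ab.2) /\
    P (if [exists i, ab.2 i == ab.1] then set0 else cospherical_on (R := R) z ab.1 ab.2) = 0%E.
  case: ifPn => [_|/existsPn nab]; first by rewrite measure0.
  by apply: (cospherical_on_null fairP) => i; apply/eqP; exact: nab.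
have mc : measurable cospherical.
  by apply: countable_bigcupT_measurable => [|ab]; [exact: countableP|exact: (H0 ab).1].
split => //; suff : P.-negligible cospherical by move=> /negligibleP ->.
rewrite /cospherical (_ : \bigcup_ab _ = \bigcup_(k : nat) (if @choice.unpickle (label * {ffun 'I_n.+2 -> label})%type k is Some ab
  then (if [exists i, ab.2 i == ab.1] then set0 else cospherical_on (R := R) z ab.1 ab.2) else set0)).
  apply: negligible_bigcup => k; case: (choice.unpickle k) => [ab|]; last exact: negligible_set0.
  by apply/negligibleP; [exact: (H0 ab).1|exact: (H0 ab).2].
apply/seteqP; split=> w [ab _ Hab]; first by exists (choice.pickle ab) => //; rewrite choice.pickleK.
by move: Hab; case: (choice.unpickle ab) => // q Hq; exists q.
Qed.

Definition points : coins -> set H := base_config theta z cospherical.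

Lemma points_poisson : is_poisson_process P (base_intensity theta) points.
Proof. by apply: base_poisson => //; [exact: ltW|exact: cospherical_null.1|exact: cospherical_null.2]. Qed.

Lemma points_fst_inj w : {in points w &, injective fst}.
Proof.
move=> p q; rewrite !inE => -[nb [j [l [_ ->]]]] [_ [j' [l' [_ ->]]]] /= ll.
have [[<- <-]//|ne] := eqVneq (j, l) (j', l').
exfalso; apply: nb; left; exists ((j, l), (j', l')) => //=.
by rewrite (negbTE ne) /= ll.
Qed.

Lemma points_generic w : generic (raise @` points w).
Proof.
move=> p q cp [q' [nb [ja [la [_ q'E]]]] qE] uM qp pw.
have lab i : {b : label | p i = raise (base_point z b.1 b.2 w)}.
  by apply: cid; have [p' [_ [j [l [_ p'E]]]] <-] := cp i; exists (j, l); rewrite p'E.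
pose b := [ffun i => sval (lab i)].
have pE i : p i = raise (base_point z (b i).1 (b i).2 w).
  by rewrite /b ffunE; case: (lab i).
have tE : compress 0 \o p = located_tuple z b w.
  by apply/funext => i; rewrite /= pE /compress /located_tuple mul0r.
apply: nb; right; exists ((ja, la), b) => //=; case: ifPn => [/existsP[i /eqP bi]|_].
  by apply: (qp i); rewrite pE bi -qE q'E.
rewrite /cospherical_on /= -tE affine_mx_compress; split => //.
by move: pw; rewrite -qE q'E /compress /= mul0r.
Qed.

(** A window meets only finitely many unit cells, and each cell has finitely many
    points. *)
Lemma points_locally_finite w : locally_finite (points w).
Proof.
move=> k; have [g gK Kg] := zbij.
pose F : set {ffun 'I_n.+1 -> int} := [set f | forall i, (`|f i| <= k.+1%:Z)%R].
have finF : finite_set F.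
  pose s (h : {ffun 'I_n.+1 -> 'I_(2 * k.+1).+1}) : {ffun 'I_n.+1 -> int} :=
    [ffun i => (h i : nat)%:Z - k.+1%:Z].
  apply: (@sub_finite_set _ _ (range s)); last by apply: finite_image; exact: finite_finset.
  move=> f fk; have b i : (`|(f i + k.+1%:Z)%R|%N < (2 * k.+1).+1)%N.
    by have := fk i; lia.
  exists [ffun i => Ordinal (b i)] => //; apply/ffunP => i; rewrite !ffunE /=.
  by have := fk i; lia.
apply: (@sub_finite_set _ _ (\bigcup_(j in g @` F)
    ((fun l => base_point z j l w) @` `I_(base_number theta j w)))); last first.
  by apply: bigcup_finite => [|j _]; apply: finite_image.
move=> q [[_ [j [l [lN ->]]]] wq]; exists j; last by exists l.
exists (z j); last exact: gK.
move=> i; have := wq i; rewrite /= /base_location /random_row mxE.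
set u := unif _ w => /ler_normlP[a1 a2].
have /andP[u0 u1] : (0 : R) <= u <= 1 by exact: coin_real_itv.
rewrite -(ler_int R) intr_norm; apply/ler_normlP; rewrite -[k.+1%:~R]/(k.+1%:R) -natr1.
by split; lra.
Qed.

Lemma low_block_empty M zz : (0 < M)%N ->
  P [set w | points w `&` low_block M zz = set0] =
  (expR (- (theta * ((M%:R / (2 * n.+1%:R)) ^+ n.+1 / 2))))%:E.
Proof.
move=> M0; have g0 : 0 < M%:R / (2 * n.+1%:R) :> R by rewrite divr_gt0 ?ltr0n// mulr_gt0// ltr0n.
have mB : measurable (low_block M zz : set H).
  by apply: measurableX; [exact: measurable_grid_cell|]; exact: measurable_itv.
pose rate := theta * ((M%:R / (2 * n.+1%:R)) ^+ n.+1 / 2).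
have rate0 : 0 < rate by rewrite mulr_gt0// divr_gt0// exprn_gt0.
have LB : base_intensity theta (low_block M zz) = rate%:E.
  rewrite /base_intensity /rate EFinM; congr (_ * _)%E.
  rewrite (_ : _ `&` _ = grid_cell M zz `*` `[0%R, 2^-1%R]%classic); last first.
    apply/seteqP; split=> q; first by move=> [[]].
    move=> [q1 q2]; split; first by split.
    split => //; move: q2; rewrite /= !in_itv/= => /andP[-> q2].
    by rewrite (le_lt_trans q2)// invf_lt1// ltr1n.
  rewrite product_measure1E//; last exact: measurable_grid_cell.
  rewrite grid_cell_volume// EFinM; congr (_ * _)%E.
  by apply: etrans (lebesgue_measure_itv _) _; rewrite /= lte_fin invr_gt0 ltr0n oppr0 adde0.
rewrite (poisson_void points_poisson mB) LB /= ?lee_fin ?(ltW rate0)//.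
rewrite /poisson_prob rate0 esum_set1 /poisson_pmf rate0 expr0 fact0 invr1 !mul1r//.
Qed.

(** For a cell of scale [M] the probability to be empty is at most [exp (- theta M /
    (4 (n + 1)))] when [M >= 2 (n + 1)], while the number of cells does not depend on
    [M]. So the probability that some cell is empty at every scale [M >= k] is
    zero. *)
Lemma points_dense : exists N, [/\ measurable N, P N = 0%E & forall w, ~ N w -> dense_config (points w)].
Proof.
pose V M zz := [set w | points w `&` low_block M zz = set0].
have mV M zz : measurable (V M zz).
  have mB : measurable (low_block M zz : set H).
    by apply: measurableX; [exact: measurable_grid_cell|exact: measurable_itv].
  have := measurable_poisson_config points_poisson measurableT (measurable_void mB).
  by rewrite setTI.
pose U M := \bigcup_(zz in [set: {ffun 'I_n.+1 -> 'I_(@grid_size n)}]) V M zz.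
have mU M : measurable (U M) by apply: fin_bigcup_measurable => // ; exact: finite_finset.
pose A k := \bigcap_(M in [set M | (k <= M)%N]) U M.
have mA k : measurable (A k) by apply: bigcap_measurable => //; exists k => /=.
exists (\bigcup_k A k); split.
- exact: bigcupT_measurable.
- suff : P.-negligible (\bigcup_k A k).
    by move=> /negligibleP -> //; exact: bigcupT_measurable.
  apply: negligible_bigcup => k; apply/negligibleP => //.
  pose K := size (fset_set [set: {ffun 'I_n.+1 -> 'I_(@grid_size n)}]).
  apply/eqP; rewrite eq_le measure_ge0 andbT; apply/lee_addgt0Pr => e e0; rewrite add0e.
  have [m [mk m0 me]] : exists m, [/\ (k <= m)%N, (0 < m)%N & 2 * K%:R / (theta * e) <= m%:R].
    exists (maxn k (Num.truncn (2 * K%:R / (theta * e))).+1).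
    rewrite leq_maxl (leq_trans _ (leq_maxr _ _))//; split => //.
    by rewrite (le_trans (ltW (truncnS_gt _)))// ler_nat leq_maxr.
  (* the side of the cells of this scale is the integer [m] *)
  pose M := (m * (2 * n.+1))%N.
  have M0 : (0 < M)%N by rewrite muln_gt0 m0.
  have kM : (k <= M)%N by rewrite (leq_trans mk)// leq_pmulr.
  apply: (@le_trans _ _ (P (U M))).
    by apply: le_measure; rewrite ?inE// => w Aw; exact: Aw.
  have Mm : M%:R / (2 * n.+1%:R) = m%:R :> R.
    by rewrite /M !natrM mulfK// mulf_neq0// pnatr_eq0.
  have pV zz : P (V M zz) = (expR (- (theta * (m%:R ^+ n.+1 / 2))))%:E.
    by rewrite /V low_block_empty// Mm.
  apply: (@le_trans _ _ (\sum_(zz \in [set: {ffun 'I_n.+1 -> 'I_(@grid_size n)}]) P (V M zz))%E).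
    by apply: content_sub_fsum => //; exact: finite_finset.
  rewrite fsbig_finite; last exact: finite_finset.
  under eq_bigr do rewrite pV.
  rewrite sumEFin lee_fin big_const_seq count_predT iter_addr_0 -[leLHS]mulr_natl -/K.
  rewrite expRN ler_pdivrMr ?expR_gt0//.
  have mX : m%:R <= m%:R ^+ n.+1 :> R by rewrite -{1}(expr1 m%:R) ler_weXn2l// ler1n.
  have := expR_ge1Dx (theta * (m%:R ^+ n.+1 / 2)); move: me; rewrite ler_pdivrMr ?mulr_gt0//.
  set x := expR _; move=> me xe.
  have : theta * (m%:R / 2) <= x.
    have : theta * (m%:R / 2) <= theta * (m%:R ^+ n.+1 / 2) by rewrite ler_wpM2l ?(ltW theta0)//; lra.
    by move: xe; lra.
  by nra.
- move=> w nw k; apply: contrapT => nk; apply: nw; exists k => // M kM.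
  apply: contrapT => nU; apply: nk; exists M => // zz.
  by apply/set0P/eqP => V0; apply: nU; exists zz.
Qed.

End base_properties.

(** * Uniqueness of laws and bounded convergence *)

Section law_uniqueness.
Context {dX : measure_display} {X : measurableType dX} {T : topologicalType} {R : realType}.

Lemma closed_set_inj (F G : closed_set T) : closed_set_val F = closed_set_val G -> F = G.
Proof. by case: F G => [F cF] [G cG] /= FG; subst G; congr ClosedSet; exact: Prop_irrelevance. Qed.

(** Almost surely the random set is a fixed measurable function of the process, and
    the law of the process is determined by its intensity. *)
Lemma poisson_set_law_unique (Lam : set X -> \bar R) (sk : set X -> set T)
    (skset : config X -> closed_set T) (ok : set (config X))
    {dO} {Om : measurableType dO} (P : probability Om R) (eta : Om -> set X)
    (mu : probability (closed_set T) R) :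
  (forall B, measurable B -> (0 <= Lam B)%E) ->
  measurable_fun setT skset -> measurable ok ->
  (forall c, ok c -> closed_set_val (skset c) = sk c) ->
  is_poisson_process P Lam eta -> P (eta @^-1` (~` ok)) = 0%E ->
  is_law_of_poisson_set Lam sk mu ->
  forall A, measurable A -> mu A = P (eta @^-1` (skset @^-1` A)).
Proof.
move=> L0 msk mok okE pe P0 [dO' [Om' [P' [eta' [Z [pe' Zae muE]]]]]] A mA.
have mskA : measurable (skset @^-1` A) by rewrite -[X in measurable X]setTI; exact: msk.
rewrite muE// -(poisson_law_unique L0 pe' pe mskA).
have P'0 : P' (eta' @^-1` (~` ok)) = 0%E.
  by rewrite (poisson_law_unique L0 pe' pe)//; exact: measurableC.
have me' : measurable_fun setT (eta' : Om' -> config X) by exact: measurable_poisson_config pe'.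
have mpre (D : set (config X)) : measurable D -> measurable (eta' @^-1` D).
  by move=> mD; rewrite -[X in measurable X]setTI; exact: me'.
have mZ : measurable (Z @^-1` A) by rewrite -[X in measurable X]setTI; exact: (@measurable_funPT _ _ _ _ Z).
have [N [mN N0 ZN]] := Zae.
pose B := N `|` eta' @^-1` (~` ok).
have mB : measurable B by apply: measurableU => //; apply: mpre; exact: measurableC.
have B0 : P' B = 0%E by apply: null_set_setU => //; apply: mpre; exact: measurableC.
have same w : ~ B w -> Z w = skset (eta' w).
  move=> nB; apply: closed_set_inj; have gw : ok (eta' w).
    by apply: contrapT => no; apply: nB; right.
  rewrite okE//; apply: contrapT => ne; apply: nB; left; apply: ZN; exact: ne.
rewrite /distribution /pushforward /=.
have cut (D : set Om') : measurable D -> P' D = P' (D `\` B).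
  move=> mD; have DB0 : P' (D `&` B) = 0%E.
    by apply: (@subset_measure0 _ _ _ P' _ B) => //; exact: measurableI.
  rewrite measureD//=; last by rewrite (le_lt_trans (probability_le1 P' mD)) ?ltry.
  by rewrite [X in _ = (_ - X)%E]DB0 sube0.
rewrite cut// [RHS]cut; last exact: mpre.
congr (P' _); apply/seteqP; split=> w [] /= Aw nB; split => //.
  by rewrite -same.
by rewrite same.
Qed.

End law_uniqueness.

Section bounded_convergence.
Context {d} {T : measurableType d} {R : realType} (P : probability T R).

Lemma bounded_cvg (f_ : nat -> T -> R) (f : T -> R) (M : R) (N : set T) :
  (forall k, measurable_fun setT (f_ k)) -> measurable_fun setT f ->
  (forall k x, `|f_ k x| <= M) -> measurable N -> P N = 0%E ->
  (forall x, ~ N x -> f_ k x @[k --> \oo] --> f x) ->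
  (\int[P]_x (f_ k x)%:E)%E @[k --> \oo] --> (\int[P]_x (f x)%:E)%E.
Proof.
move=> mf_ mf fM mN N0 ff.
have [] := @dominated_convergence _ T R P setT measurableT (fun k x => (f_ k x)%:E)
  (fun x => (f x)%:E) (cst M%:E) => //.
- by move=> k; apply/measurable_EFinP.
- exact/measurable_EFinP.
- exists N; split => // x /= nx; apply: contrapT => nN; apply: nx => _.
  by apply: cvg_EFin; [exact: nearW|exact: ff].
- exact: finite_measure_integrable_cst.
- by apply: nearW => x k _; rewrite /= lee_fin.
Qed.

Lemma eventually_avoided_cvg (A : nat -> set T) (N : set T) :
  (forall k, measurable (A k)) -> measurable N -> P N = 0%E ->
  (forall x, ~ N x -> \forall k \near \oo, ~ A k x) ->
  P (A k) @[k --> \oo] --> 0%E.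
Proof.
move=> mA mN N0 H.
have := @bounded_cvg (fun k => \1_(A k)) (cst 0) 1 N.
under eq_cvg do rewrite integral_indic// setIT.
rewrite integral0; apply => //.
- by move=> k x; rewrite indicE ger0_norm// lern1 leq_b1.
- move=> x nx; apply: cvg_near_cst; have := H x nx; apply: filterS => k nA.
  by rewrite indicE memNset.
Qed.

End bounded_convergence.

(** * The coupling and the two forms of convergence *)

(** A compact set is contained in a ball and a point that witnesses a nonempty
    intersection lies in a ball; neighbourhoods are given by finitely many such
    conditions. *)
Lemma fell_cvg {R : realType} {n : nat} (F_ : nat -> closed_set 'rV[R]_n.+1) (F : closed_set 'rV[R]_n.+1) :
  (forall r : R, \forall k \near \oo, closed_set_val (F_ k) `&` eball r = closed_set_val F `&` eball r) ->
  F_ k @[k --> \oo] --> F.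
Proof.
move=> FF U; rewrite nbhsE => -[V [oV VF] VU].
have [s [sF sV]] := open_closed_setP oV VF.
suff H : \forall k \near \oo, forall B, B \in s -> B (F_ k).
  by apply: filterS H => k Hk; apply: VU; exact: sV.
elim: s sF {sV} => [|B s IH] sF; first by near=> k.
have Hs : \forall k \near \oo, forall B, B \in s -> B (F_ k).
  by apply: IH => C Cs; apply: sF; rewrite in_cons Cs orbT.
have HB : \forall k \near \oo, B (F_ k).
  have [sb BF] := sF B (mem_head _ _).
  case: sb BF => [[K cK ->] FK|[G oG ->] [x [Fx Gx]]].
    have cnK : compact (@nsq R n @` K).
      by apply: continuous_compact => //; apply: continuous_subspaceT; exact: continuous_nsq.
    have [M [_ KM]] := compact_bounded cnK.
    have M1 : M < `|M| + 1 by rewrite (le_lt_trans (ler_norm M))// ltrDl.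
    (* since [b >= 1], a squared norm below [b] gives a norm below [b] *)
    pose b := `|M| + 1.
    have b1 : 1 <= b by rewrite lerDr.
    have MK x : K x -> eball b x.
      move=> Kx; rewrite /eball /= -(@ler_pXn2r _ 2)// ?nnegrE ?enorm_ge0 ?addr_ge0//.
      rewrite enorm_sqr; apply: (le_trans (ler_norm _)).
      apply: (@le_trans _ _ b); first by apply: (KM b M1); exists x.
      by rewrite expr2 ler_peMl// (le_trans ler01).
    apply: filterS (FF b) => k Fk /=.
    rewrite -subset0 => x [Fx Kx].
    have : (closed_set_val F `&` eball b) x by rewrite -Fk; split => //; exact: MK.
    by move=> [Fx' _]; rewrite -FK; split.
  apply: filterS (FF (enorm x)) => k Fk /=; exists x; split => //.
  have : (closed_set_val F `&` eball (enorm x)) x by split => //; rewrite /eball /=.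
  by rewrite -Fk => -[].
apply: filterS2 Hs HB => k Hs HB C; rewrite in_cons => /orP[/eqP ->//|].
exact: Hs.
Unshelve. all: by end_near. Qed.

Lemma measurable_hits {T : ptopologicalType} (G : set T) : open G -> measurable (hits G).
Proof.
move=> oG; apply: sub_sigma_algebra; exists [set hits G]; last by rewrite bigcup_set1.
by move=> _ ->; apply: (@finI_from1 _ _ _ id); right; exists G.
Qed.

Lemma closed_eball {R : realType} {n : nat} (r : R) : 0 <= r -> closed (eball r : set 'rV[R]_n.+1).
Proof.
move=> r0; rewrite (_ : eball r = (@nsq R n) @^-1` [set x | x <= r ^+ 2]).
  by apply: closed_comp => [v _|]; [exact: continuous_nsq|exact: closed_le].
by apply/seteqP; split=> v; rewrite /eball /= -enorm_sqr ler_pXn2r// nnegrE enorm_ge0.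
Qed.

Lemma measurable_continuous_closed_set {T : topologicalType} {R : realType} (f : closed_set T -> R) :
  continuous f -> measurable_fun setT f.
Proof.
move=> cf; apply: (@measurability _ _ _ _ _ _ (@RGenOInfty.G R)); first exact: RGenOInfty.measurableE.
move=> _ [_ [x ->] <-]; rewrite setTI; apply: sub_sigma_algebra.
by apply: open_comp => [F _|]; [exact: cf|exact: interval_open].
Qed.

Lemma bounded_integrable {d} {T : measurableType d} {R : realType} (P : probability T R)
    (f : T -> R) (M : R) :
  measurable_fun setT f -> (forall x, `|f x| <= M) -> P.-integrable setT (EFin \o f).
Proof.
move=> mf fM; apply: measurable_bounded_integrable => //.
  by rewrite (le_lt_trans (probability_le1 P measurableT)) ?ltry.
exists M; split; first exact: num_real.
by move=> x Mx w _; apply: le_trans (fM _) (ltW Mx).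
Qed.

Section coupling.
Context {R : realType} (n : nat).
Local Notation E := 'rV[R]_n.+1.
Local Notation H := (E * measurableTypeR R)%type.
Variables (z : nat -> {ffun 'I_n.+1 -> int}) (zbij : bijective z).

Let P : probability coins R := @coin_measure R.
Let fairP : fair P := @coin_measure_cyl R.
Let theta : R := n.+1%:R^-1.
Let theta0 : 0 < theta. Proof. by rewrite invr_gt0 ltr0n. Qed.

Definition lifted (l : R) (w : coins) : set H := lift_height l @` points n.+1%:R^-1 z w.

Definition projected (w : coins) : set E := fst @` points n.+1%:R^-1 z w.

Lemma lifted_compress l w : lifted l w = compress l @` (raise @` points theta z w).
Proof.
by apply/seteqP; split=> [_ [q pq <-]|_ [_ [q pq <-] <-]]; [exists (raise q) => //; exists q|exists q].
Qed.

Lemma lifted_poisson l : 0 < l ->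
  is_poisson_process P (horoball_intensity (d := n.+2) (l ^+ n.+1) l) (lifted l).
Proof.
move=> l0; apply: (poisson_image (Lam := base_intensity theta)).
- exact: measurable_lift_height.
- by move=> w p q pw qw [pq _]; exact: points_fst_inj pw qw pq.
- by move=> B mB; exact: horoball_intensityE.
- exact: (points_poisson fairP theta0 zbij).
Qed.

Lemma projected_poisson : is_poisson_process P
  (fun A : set E => theta%:E * lebesgue_measure_rV R n.+1 A)%E projected.
Proof.
apply: (poisson_image (Lam := base_intensity theta)).
- exact: measurable_fst.
- exact: points_fst_inj.
- by move=> B mB; exact: base_intensity_fst.
- exact: (points_poisson fairP theta0 zbij).
Qed.

(** The classical model is the hyperbolic one at parameter zero. *)
Lemma flat_projected w : flat (projected w) = lifted 0 w.
Proof.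
apply/seteqP; split=> [_ [_ [q pq <-] <-]|_ [q pq <-]].
  by exists q => //; rewrite /lift_height mul0r.
by exists q.1; [exists q|rewrite /lift_height mul0r].
Qed.

Lemma measurable_lifted l : measurable_fun setT (lifted l : coins -> config H).
Proof.
apply: measurable_fun_config => B mB.
have mB' : measurable (lift_height l @^-1` B).
  by rewrite -[X in measurable X]setTI; exact: measurable_lift_height.
have := measurable_poisson_config (points_poisson fairP theta0 zbij) measurableT (measurable_void mB').
rewrite setTI; congr measurable; apply/seteqP; split=> w /=; rewrite /empty_on /= => w0.
  rewrite -subset0 => _ [[q pq <-] Bq].
  by have [] : (set0 : set H) q by rewrite -w0; split.
rewrite -subset0 => q [pq Bq].
by have [] : (set0 : set H) (lift_height l q) by rewrite -w0; split => //; exists q.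
Qed.

Definition skeleton_of l (w : coins) : closed_set E := skeleton_set (lifted l w).

Lemma measurable_skeleton_of l : measurable_fun setT (skeleton_of l).
Proof. exact: (measurableT_comp (@measurable_skeleton_set R n) (measurable_lifted l)). Qed.

Definition skeleton_rv l : {mfun coins >-> closed_set E} :=
  mfun_Sub (mem_set (measurable_skeleton_of l)).

(** All requirements hold outside one null set which serves every parameter. *)
Lemma lifted_good : exists N, [/\ measurable N, P N = 0%E &
  forall w, ~ N w -> (forall l, good (lifted l w)) /\
    forall r : R, \forall l \near (0 : R),
      closed_set_val (skeleton_of l w) `&` eball r = closed_set_val (skeleton_of 0 w) `&` eball r].
Proof.
have [N [mN N0 dN]] := points_dense fairP theta0 zbij; exists N; split => // w nw.
have dw := dN w nw; have lf := points_locally_finite theta0 zbij w.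
have gl l : good (lifted l w) by rewrite lifted_compress; exact: dense_good.
split => // r.
have : \forall l \near (0 : R),
    skeleton (hyperbolic_delaunay (d := n.+2) (compress l @` (raise @` points theta z w))) `&` eball r =
    skeleton (hyperbolic_delaunay (d := n.+2) (compress 0 @` (raise @` points theta z w))) `&` eball r.
  apply: skeleton_compress_stable.
  - move=> k; apply: (@sub_finite_set _ _ (raise @` (points theta z w `&` window k))).
      by move=> _ [[q pq <-] wq]; exists q.
    by apply: finite_image; exact: lf.
  - exact: points_generic.
  - by move=> k; have [M kM HM] := dense_occupied dw 1 k; exists M.
apply: filterS => l; rewrite -!lifted_compress => H.
by rewrite /skeleton_of !skeleton_setE.
Qed.

Lemma skeleton_rv_law l : 0 < l ->
  is_horoball_skeleton_law (d := n.+2) (l ^+ n.+1) l (distribution P (skeleton_rv l)).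
Proof.
move=> l0; exists _, _, P, (lifted l), (skeleton_rv l); split => //.
  exact: lifted_poisson.
have [N [mN N0 HN]] := lifted_good; exists N; split => // w /= nw.
by apply: contrapT => nN; apply: nw; apply: skeleton_setE; exact: (HN w nN).1.
Qed.

Lemma skeleton_rv0_law :
  is_poisson_delaunay_skeleton_law (d := n.+2) theta (distribution P (skeleton_rv 0)).
Proof.
exists _, _, P, projected, (skeleton_rv 0); split => //; first exact: projected_poisson.
have [N [mN N0 HN]] := lifted_good; exists N; split => // w /= nw.
apply: contrapT => nN; apply: nw; rewrite delaunay_flat flat_projected.
by apply: skeleton_setE; exact: (HN w nN).1.
Qed.

Lemma horoball_intensity_ge0 (g l : R) (B : set H) : 0 <= g ->
  (0 <= horoball_intensity (d := n.+2) g l B)%E.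
Proof.
move=> g0; apply: mule_ge0; first by rewrite lee_fin.
by apply: integral_ge0 => q [_ /= q0]; rewrite lee_fin invr_ge0 exprn_ge0// ltW.
Qed.

Lemma horoball_law_unique l (mu : probability (closed_set E) R) : 0 < l ->
  is_horoball_skeleton_law (d := n.+2) (l ^+ n.+1) l mu ->
  forall A, measurable A -> mu A = distribution P (skeleton_rv l) A.
Proof.
move=> l0 mul A mA.
apply: (poisson_set_law_unique (ok := good) _ (@measurable_skeleton_set R n) _ _ (lifted_poisson l0) _ mul mA).
- by move=> B mB; apply: horoball_intensity_ge0; rewrite exprn_ge0// ltW.
- exact: measurable_good.
- by move=> c gc; exact: skeleton_setE.
- have [N [mN N0 HN]] := lifted_good; apply: (@subset_measure0 _ _ _ P _ N) => //.
    rewrite -[X in measurable X]setTI; apply: measurable_lifted => //.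
    by apply: measurableC; exact: measurable_good.
  by move=> w /= ng; apply: contrapT => nN; apply: ng; exact: (HN w nN).1.
Qed.

Lemma measurable_flat : measurable_fun setT (flat : config E -> config H).
Proof.
have ml : measurable_fun setT (fun v : E => (v, 0) : H) by exact: measurable_pair2.
apply: measurable_fun_config => B mB.
have mB' : measurable ((fun v : E => (v, 0) : H) @^-1` B).
  by rewrite -[X in measurable X]setTI; exact: ml.
have := measurable_void mB'; congr measurable; apply/seteqP; split=> c /=; rewrite /empty_on /= => w0.
  rewrite -subset0 => _ [[q pq <-] Bq].
  by have [] : (set0 : set E) q by rewrite -w0; split.
rewrite -subset0 => q [pq Bq].
by have [] : (set0 : set H) (q, 0) by rewrite -w0; split => //; exists q.
Qed.

Lemma delaunay_law_unique (mu : probability (closed_set E) R) :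
  is_poisson_delaunay_skeleton_law (d := n.+2) theta mu ->
  forall A, measurable A -> mu A = distribution P (skeleton_rv 0) A.
Proof.
move=> mul A mA.
have mgf : measurable ((flat : config E -> config H) @^-1` good).
  by rewrite -[X in measurable X]setTI; apply: measurable_flat => //; exact: measurable_good.
have mS : measurable_fun setT (fun c : config E => skeleton_set (flat c) : closed_set E).
  exact: (measurableT_comp (@measurable_skeleton_set R n) measurable_flat).
rewrite (poisson_set_law_unique (ok := (flat : config E -> config H) @^-1` good) _ mS mgf _ projected_poisson _ mul mA).
- rewrite /distribution /pushforward; congr (P _); apply/seteqP; split=> w /=;
    by rewrite flat_projected.
- by move=> B mB; apply: mule_ge0; [rewrite lee_fin ltW|exact: measure_ge0].
- by move=> c gc; rewrite delaunay_flat; exact: skeleton_setE.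
- have [N [mN N0 HN]] := lifted_good; apply: (@subset_measure0 _ _ _ P _ N) => //.
    rewrite -[X in measurable X]setTI.
    by apply: (measurable_poisson_config projected_poisson) => //; exact: measurableC.
  by move=> w /= ng; apply: contrapT => nN; apply: ng; rewrite flat_projected; exact: (HN w nN).1.
Qed.

Lemma skeleton_rv_cvg (lam : nat -> R) : lam k @[k --> \oo] --> (0 : R) -> exists N,
  [/\ measurable N, P N = 0%E & forall w, ~ N w -> forall r : R, \forall k \near \oo,
     closed_set_val (skeleton_rv (lam k) w) `&` eball r =
     closed_set_val (skeleton_rv 0 w) `&` eball r].
Proof.
move=> lam0; have [N [mN N0 HN]] := lifted_good; exists N; split => // w nw r.
by have [_ /(_ r)] := HN w nw; move=> /lam0.
Qed.

Lemma skeleton_differs_cvg0 (lam : nat -> R) (r : R) : 0 <= r -> lam k @[k --> \oo] --> (0 : R) ->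
  P [set w | closed_set_val (skeleton_rv (lam k) w) `&` eball r <>
             closed_set_val (skeleton_rv 0 w) `&` eball r] @[k --> \oo] --> 0%E.
Proof.
move=> r0 lam0; have [N [mN N0 HN]] := skeleton_rv_cvg lam0.
apply: (eventually_avoided_cvg (N := N)) => // [k|w nw].
  have mh l p : measurable (skeleton_rv l @^-1` hits (rat_ball p)).
    rewrite -[X in measurable X]setTI; apply: measurable_skeleton_of => //.
    by apply: measurable_hits; exact: rat_ball_open.
  by apply: measurable_differ_on; [exact: mh|exact: mh|exact: closed_eball].
by apply: filterS (HN w nw r) => k Hk /=; rewrite Hk.
Qed.

Lemma skeleton_expectation_cvg (lam : nat -> R) (f : closed_set E -> R) (M : R) :
  continuous f -> (forall F, `|f F| <= M) -> lam k @[k --> \oo] --> (0 : R) ->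
  (\int[distribution P (skeleton_rv (lam k))]_F (f F)%:E)%E @[k --> \oo] -->
  (\int[distribution P (skeleton_rv 0)]_F (f F)%:E)%E.
Proof.
move=> cf fM lam0; have mf := measurable_continuous_closed_set cf.
have mfl l : measurable_fun setT (f \o skeleton_rv l).
  exact: (measurableT_comp mf (measurable_skeleton_of l)).
have intE l : (\int[distribution P (skeleton_rv l)]_F (f F)%:E = \int[P]_w (f (skeleton_rv l w))%:E)%E.
  rewrite integral_distribution//; first exact/measurable_EFinP.
  exact: (bounded_integrable P (mfl l) (fun w => fM (skeleton_rv l w))).
under eq_cvg do rewrite intE.
rewrite intE; have [N [mN N0 HN]] := skeleton_rv_cvg lam0.
apply: (bounded_cvg (M := M) (N := N)) => //.
- by move=> k; exact: mfl.
- exact: mfl.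
- by move=> w nw; apply: continuous_cvg; [exact: cf|apply: fell_cvg; exact: HN].
Qed.

End coupling.

Theorem theorem11 (R : realType) (d : nat) (hd : (2 <= d)%N) :
  (forall (mu : R -> probability (closed_set 'rV[R]_d.-1) R)
          (nu : probability (closed_set 'rV[R]_d.-1) R),
     (forall lam : R, 0 < lam ->
        is_horoball_skeleton_law (lam ^+ d.-1) lam (mu lam)) ->
     is_poisson_delaunay_skeleton_law (d.-1%:R^-1) nu ->
     weakly_converges (0 : R)^'+ mu nu)
  /\
  (forall lam : nat -> R, (forall n, 0 < lam n) ->
     lam n @[n --> \oo] --> (0 : R) ->
     exists (dO : measure_display) (Om : measurableType dO)
       (P : probability Om R)
       (S_ : nat -> {mfun Om >-> closed_set 'rV[R]_d.-1})
       (S : {mfun Om >-> closed_set 'rV[R]_d.-1}),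
       [/\ forall n, is_horoball_skeleton_law (lam n ^+ d.-1) (lam n)
             (distribution P (S_ n)),
           is_poisson_delaunay_skeleton_law (d.-1%:R^-1) (distribution P S) &
           forall r : R, 0 < r ->
             P [set w | closed_set_val (S_ n w) `&` eball r <>
                        closed_set_val (S w) `&` eball r] @[n --> \oo]
               --> 0%E]).
Proof.
case: d hd => [|[|n]]// _; have [z zbij] := int_vectors_enum n; split.
  move=> mu nu muL nuL f cf [M fM].
  have nuE : (\int[nu]_x (f x)%:E = \int[distribution (@coin_measure R) (skeleton_rv zbij 0)]_x (f x)%:E)%E.
    by apply: eq_measure_integral => A mA _; exact: delaunay_law_unique.
  have muE l : 0 < l -> (\int[mu l]_x (f x)%:E = \int[distribution (@coin_measure R) (skeleton_rv zbij l)]_x (f x)%:E)%E.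
    by move=> l0; apply: eq_measure_integral => A mA _; apply: horoball_law_unique => //; exact: muL.
  have nufin : (\int[nu]_x (f x)%:E)%E \is a fin_num.
    by apply: integrable_fin_num => //; exact: (bounded_integrable nu (measurable_continuous_closed_set cf) fM).
  rewrite -(fineK nufin); apply/cvge_at_rightP => u [u0 uc]; rewrite fineK// nuE.
  under eq_cvg do rewrite muE//.
  exact: (skeleton_expectation_cvg cf fM uc).
move=> lam lam0 lamc.
exists _, _, (@coin_measure R), (fun k => skeleton_rv zbij (lam k)), (skeleton_rv zbij 0); split.
- by move=> k; exact: skeleton_rv_law.
- exact: skeleton_rv0_law.
- by move=> r r0; have := @skeleton_differs_cvg0 R n z zbij lam r (ltW r0) lamc.
Qed.
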